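(* Let $\mathbb{F}$ be a field with $\operatorname{char}\mathbb{F}\neq 2,3$, and let $A$ and $B$ be countable-dimensional unital locally matrix $\mathbb{F}$-algebras. If the groups $[A^{*},A^{*}]$ and $[B^{*},B^{*}]$ are isomorphic, then the rings $A$ and $B$ are isomorphic. Moreover, identify $A$ with the algebra of periodic matrices $M_s^p(\mathbb{F})$, where $s=\mathbf{st}(A)$ is the Steinitz number of $A$, and let $t$ denote the transpose on $A=M_s^p(\mathbb{F})$. Then an arbitrary group isomorphism $\varphi:[A^{*},A^{*}]\to[B^{*},B^{*}]$ either extends to an isomorphism of rings $A\to B$, or there exists an isomorphism of rings $\theta:A\to B$ such that $\varphi(g)=\theta\big((g^{-1})^t\big)$ for every $g\in[A^{*},A^{*}]$.
   Context: An associative $\mathbb{F}$-algebra $A$ with unit $1$ is a unital locally matrix algebra if for every finite collection $a_1,\ldots,a_t\in A$ there is a subalgebra $A'\subset A$ with $1,a_1,\ldots,a_t\in A'$ and $A'\cong M_n(\mathbb{F})$ for some $n\in\mathbb{N}$ (positive integers). ''Countable-dimensional'' means of at most countable dimension over $\mathbb{F}$. $A^{*}$ denotes the group of invertible elements of $A$, and $[A^{*},A^{*}]$ its commutator subgroup. Ring isomorphisms are not required to be $\mathbb{F}$-linear. ''Either ... or'' is understood non-exclusively. A Steinitz number is a formal product $\prod_{p}p^{r_p}$ over all primes $p$ with $r_p\in\mathbb{N}\cup\{0,\infty\}$; Steinitz numbers are multiplied by adding exponents (with $\infty$ absorbing), and $s_2\mid s_1$ if $s_1=s_2s_3$ for some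 Steinitz number $s_3$. Let $D(A)$ be the set of positive integers $n$ such that there is a subalgebra $A'$ with $1\in A'\subset A$ and $A'\cong M_n(\mathbb{F})$; the Steinitz number $\mathbf{st}(A)$ is the least common multiple of $D(A)$ (the exponent of each prime $p$ is the supremum of its exponents in elements of $D(A)$). An $(\mathbb{N}\times\mathbb{N})$-matrix over $\mathbb{F}$ is $n$-periodic if it is block-diagonal of the form $\operatorname{diag}(a,a,\ldots)$ with $a\in M_n(\mathbb{F})$. $M_n^p(\mathbb{F})\cong M_n(\mathbb{F})$ is the algebra of all $n$-periodic matrices, and $M_s^p(\mathbb{F})=\bigcup_{n\mid s}M_n^p(\mathbb{F})$, the union over positive integers $n$ dividing $s$. This algebra is invariant under the matrix transpose $t$, which is an anti-isomorphism of it onto itself. By a theorem of Glimm, every countable-dimensional unital locally matrix algebra $A$ is isomorphic as an $\mathbb{F}$-algebra to $M_s^p(\mathbb{F})$ with $s=\mathbf{st}(A)$; the identification of $A$ with $M_s^p(\mathbb{F})$ is through a fixed such isomorphism $\iota$, so that $a^t=\iota^{-1}(\iota(a)^t)$ for $a\in A$. *)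

(* Defs.v *)
From HB Require Import structures.
From mathcomp Require Import all_boot all_order all_algebra.
From mathcomp Require Import mathcomp_extra boolp classical_sets functions.
From mathcomp Require Import cardinality fsbigop.

Set Implicit Arguments.
Unset Strict Implicit.
Unset Printing Implicit Defensive.

Import GRing.Theory.
Local Open Scope classical_set_scope.
Local Open Scope ring_scope.

Section UnitGroup.
Variable R : unitRingType.

(* MathComp's {unit R} is only available for finite rings. *)
Record unit_group := UnitGroup {
  uval : R;
  uvalP : uval \is a GRing.unit }.

HB.instance Definition _ := [isSub for uval].
HB.instance Definition _ := [Choice of unit_group by <:].

Implicit Types u v : unit_group.

Definition ug_one := UnitGroup (@unitr1 R).
Lemma ug_inv_subproof u : (uval u)^-1 \is a GRing.unit.
Proof. by rewrite unitrV; exact: uvalP. Qed.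
Definition ug_inv u := UnitGroup (ug_inv_subproof u).
Lemma ug_mul_subproof u v : uval u * uval v \is a GRing.unit.
Proof. by rewrite unitrMl; exact: uvalP. Qed.
Definition ug_mul u v := UnitGroup (ug_mul_subproof u v).

Lemma ug_mulA : associative ug_mul.
Proof. by move=> u v w; apply/val_inj; exact: mulrA. Qed.
Lemma ug_mul1 : left_id ug_one ug_mul.
Proof. by move=> u; apply/val_inj; exact: mul1r. Qed.
Lemma ug_mulr1 : right_id ug_one ug_mul.
Proof. by move=> u; apply/val_inj; exact: mulr1. Qed.
Lemma ug_mulV : left_inverse ug_one ug_inv ug_mul.
Proof. by move=> u; apply/val_inj; exact: mulVr (uvalP u). Qed.
Lemma ug_mulrV : right_inverse ug_one ug_inv ug_mul.
Proof. by move=> u; apply/val_inj; exact: mulrV (uvalP u). Qed.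

HB.instance Definition _ :=
  isGroup.Build unit_group ug_mulA ug_mul1 ug_mulr1 ug_mulV ug_mulrV.

End UnitGroup.

Section CommutatorSubgroup.
Variable G : groupType.

Inductive in_commutator_subgroup : G -> Prop :=
| in_comm_commg x y : in_commutator_subgroup [~ x, y]%g
| in_comm_one : in_commutator_subgroup 1%g
| in_comm_mul x y : in_commutator_subgroup x -> in_commutator_subgroup y ->
    in_commutator_subgroup (x * y)%g
| in_comm_inv x : in_commutator_subgroup x -> in_commutator_subgroup (x^-1)%g.

Definition commutator_pred : {pred G} :=
  [pred x | `[< in_commutator_subgroup x >]].

Record commutator_subgroup := CommutatorSubgroup {
  cval : G;
  cvalP : cval \in commutator_pred }.

HB.instance Definition _ := [isSub for cval].
HB.instance Definition _ := [Choice of commutator_subgroup by <:].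

Lemma commutator_group_closed : group_closed commutator_pred.
Proof.
split=> [|x y /asboolP hx /asboolP hy]; apply/asboolP.
  exact: in_comm_one.
by apply: in_comm_mul => //; exact: in_comm_inv.
Qed.

HB.instance Definition _ := SubChoice_isSubGroup.Build G commutator_pred
  commutator_subgroup commutator_group_closed.

End CommutatorSubgroup.

(* [A^*, A^*] as a group, with its inclusion into A. *)
Definition unit_commutators (R : unitRingType) : groupType :=
  commutator_subgroup (unit_group R).

Definition ucval (R : unitRingType) (g : unit_commutators R) : R :=
  uval (cval g).

Section Steinitz.

(* Exponent functions on the primes; None stands for the exponent oo. *)
Definition steinitz : Type := {p : nat | prime p} -> option nat.

Definition smul (s1 s2 : steinitz) : steinitz := fun p =>
  if (s1 p, s2 p) is (Some k1, Some k2) then Some (k1 + k2)%N else None.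

Definition sdvd (s2 s1 : steinitz) : Prop := exists s3, s1 = smul s2 s3.

(* The Steinitz number of an integer n > 0 (logn p 0 = 0, so 0 is junk). *)
Definition steinitz_nat (n : nat) : steinitz := fun p => Some (logn (val p) n).

Definition slcm (D : set nat) : steinitz := fun p =>
  match pselect (exists k, `[< forall n, D n -> logn (val p) n <= k >]%N) with
  | left bounded => Some (ex_minn bounded)
  | right _ => None
  end.

Lemma sdvd_natP n (s : steinitz) : sdvd (steinitz_nat n) s <->
  forall p, if s p is Some k then (logn (val p) n <= k)%N else true.
Proof.
split=> [[s3 ->] p|H].
  by rewrite /smul /=; case: (s3 p) => // k; rewrite leq_addr.
exists (fun p => omap (fun k => k - logn (val p) n)%N (s p)).
apply/funext => p; rewrite /smul /=; move: (H p).
by case: (s p) => //= k hk; rewrite subnKC.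
Qed.

Lemma sdvd_nat_lcm m n s : (0 < m)%N -> (0 < n)%N ->
  sdvd (steinitz_nat m) s -> sdvd (steinitz_nat n) s ->
  sdvd (steinitz_nat (lcmn m n)) s.
Proof.
move=> m0 n0 /sdvd_natP hm /sdvd_natP hn; apply/sdvd_natP => p.
move: (hm p) (hn p); case: (s p) => // k.
by rewrite logn_lcm // geq_max => -> ->.
Qed.

Lemma sdvd_nat1 s : sdvd (steinitz_nat 1) s.
Proof. by apply/sdvd_natP => p; case: (s p) => // k; rewrite logn1. Qed.

End Steinitz.

Section LocallyMatrix.
Variables (F : fieldType) (A : algType F).

(* S is a subalgebra of A containing 1 and isomorphic to M_n(F), n > 0. *)
Definition matrix_subalg (n : nat) (S : set A) : Prop :=
  exists2 m, n = m.+1 &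
  exists2 f : {lrmorphism 'M[F]_m.+1 -> A}, injective f & S = range f.

Definition locally_matrix : Prop := forall X : seq A,
  exists n S, matrix_subalg n S /\ forall x, x \in X -> S x.

Definition linearly_independent (S : set A) : Prop :=
  forall (X : seq A) (c : A -> F), uniq X -> (forall x, x \in X -> S x) ->
  \sum_(x <- X) c x *: x = 0 -> forall x, x \in X -> c x = 0.

Definition spanning (S : set A) : Prop :=
  forall a, exists (X : seq A) (c : A -> F),
  (forall x, x \in X -> S x) /\ a = \sum_(x <- X) c x *: x.

Definition countable_dim : Prop :=
  exists S : set A, [/\ countable S, linearly_independent S & spanning S].

Definition matrix_degrees : set nat := [set n | exists S, matrix_subalg n S].

Definition st : steinitz := slcm matrix_degrees.

End LocallyMatrix.

Section PeriodicMatrices.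
Variable F : fieldType.

(* F^o gives the entrywise F-module structure.  The pointwise ring structure
   on functions is not used: the product is nmx_mul. *)
Definition nmx := nat -> nat -> F^o.
HB.instance Definition _ := GRing.Lmodule.on nmx.

Definition nmx_mul (M N : nmx) : nmx := fun i j =>
  \sum_(k \in [set: nat]) ((M i k : F) * (N k j : F)).

Definition nmx1 : nmx := fun i j => (i == j)%:R.

Definition nmx_tr (M : nmx) : nmx := fun i j => M j i.

(* The block-diagonal matrix diag(a, a, ...); inZp i is i modulo m.+1. *)
Definition per_mx m (a : 'M[F]_m.+1) : nmx := fun i j =>
  if (i %/ m.+1 == j %/ m.+1)%N then a (inZp i) (inZp j) else 0.

Definition periodic (n : nat) (M : nmx) : Prop :=
  exists2 m, n = m.+1 & exists a : 'M[F]_m.+1, M = per_mx a.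

Lemma periodicP m (M : nmx) : periodic m.+1 M <->
  forall i j, M i j =
    if (i %/ m.+1 == j %/ m.+1)%N then M (i %% m.+1)%N (j %% m.+1)%N else 0.
Proof.
split=> [[_ [<-] [a ->]] i j|H].
  rewrite /per_mx !(divn_small (ltn_pmod _ _)) // eqxx; case: eqP => // _.
  by congr (a _ _); apply/val_inj; rewrite /= modn_mod.
exists m => //; exists (\matrix_(i, j) M i j).
apply/funext => i; apply/funext => j; rewrite H /per_mx.
by case: eqP => // _; rewrite mxE /=.
Qed.

Lemma periodic_dvd m n (M : nmx) :
  (m.+1 %| n.+1)%N -> periodic m.+1 M -> periodic n.+1 M.
Proof.
move=> /dvdnP[k nE] /periodicP H; apply/periodicP => i j.
rewrite [LHS]H [in RHS](H (i %% _)%N) !modn_dvdm ?nE ?dvdn_mull //.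
have k0 : (0 < k)%N by case: k nE.
have E x : (x %/ m.+1 = x %/ (k * m.+1) * k + x %% (k * m.+1) %/ m.+1)%N.
  by rewrite [in LHS](divn_eq x (k * m.+1)) mulnA divnMDl.
have lt x : (x %% (k * m.+1) %/ m.+1 < k)%N.
  by rewrite ltn_divLR // ltn_mod muln_gt0 k0.
have E1 x : (x %/ m.+1 %/ k = x %/ (k * m.+1))%N by rewrite mulnC divnMA.
have [e|ne] := eqVneq (i %/ (k * m.+1))%N (j %/ (k * m.+1))%N.
  by rewrite [in LHS](E i) [in LHS](E j) e eqn_add2l.
by case: eqP => // e; move: ne; rewrite -!E1 e eqxx.
Qed.

Lemma per_mxM m (a b : 'M[F]_m.+1) :
  nmx_mul (per_mx a) (per_mx b) = per_mx (a *m b).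
Proof.
apply/funext => i; apply/funext => j; rewrite /nmx_mul.
pose e (l : 'I_m.+1) := (i %/ m.+1 * m.+1 + l)%N.
have ediv l : (e l %/ m.+1 = i %/ m.+1)%N.
  by rewrite /e divnMDl // (divn_small (ltn_ord l)) addn0.
have emod l : inZp (e l) = l :> 'I_m.+1.
  by apply/val_inj; rewrite /= modnMDl modn_small.
have einj : injective e by move=> l l' /addnI /val_inj.
rewrite -(fsbig_widen [set` [seq e l | l <- enum 'I_m.+1]]) //; last first.
  move=> k [_ /= kN]; rewrite /per_mx; case: eqP => [ik|]; last by rewrite mul0r.
  case: kN; apply/mapP; exists (inZp k); rewrite ?mem_enum //.
  by rewrite /e ik /= -divn_eq.
rewrite -fsbig_seq; last by rewrite map_inj_uniq // enum_uniq.
rewrite big_map big_enum /= /per_mx.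
case: eqP => ij.
  by rewrite mxE; apply: eq_bigr => l _; rewrite ediv eqxx ij eqxx emod.
by apply: big1 => l _; rewrite ediv (introF eqP ij) mulr0.
Qed.

Lemma per_mx1 m : per_mx (1%:M : 'M[F]_m.+1) = nmx1.
Proof.
apply/funext => i; apply/funext => j; rewrite /per_mx /nmx1 mxE.
have [->|ij] := eqVneq i j; first by rewrite !eqxx.
case: eqP => // e; rewrite [in LHS](_ : _ == _ = false) //.
apply: contraNF ij => /eqP/(congr1 val) /= e'.
by rewrite (divn_eq i m.+1) e e' -divn_eq.
Qed.

Lemma per_mx_lin m (c : F) (a b : 'M[F]_m.+1) :
  c *: per_mx a + per_mx b = per_mx (c *: a + b).
Proof.
apply/funext => i; apply/funext => j; rewrite /per_mx !fctE.
by case: ifP => _; rewrite ?mxE ?scaler0 ?addr0.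
Qed.

Lemma per_mx_tr m (a : 'M[F]_m.+1) : nmx_tr (per_mx a) = per_mx a^T.
Proof.
apply/funext => i; apply/funext => j.
by rewrite /nmx_tr /per_mx mxE eq_sym.
Qed.

End PeriodicMatrices.

Section PeriodicAlgebra.
Variables (F : fieldType) (s : steinitz).

Definition permx_pred : {pred nmx F} :=
  [pred M | `[< exists n, [/\ (0 < n)%N, sdvd (steinitz_nat n) s &
                              periodic n M] >]].

(* The algebra M_s^p(F); its product, set up below, is nmx_mul. *)
Record permx := Permx { pval : nmx F; pvalP : pval \in permx_pred }.

HB.instance Definition _ := [isSub for pval].
HB.instance Definition _ := [Choice of permx by <:].

Lemma permx_common (M N P : nmx F) :
  M \in permx_pred -> N \in permx_pred -> P \in permx_pred ->
  exists m (a b c : 'M[F]_m.+1), sdvd (steinitz_nat m.+1) s /\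
    [/\ M = per_mx a, N = per_mx b & P = per_mx c].
Proof.
have merge m n : sdvd (steinitz_nat m.+1) s -> sdvd (steinitz_nat n.+1) s ->
    exists l, [/\ sdvd (steinitz_nat l.+1) s, m.+1 %| l.+1 & n.+1 %| l.+1]%N.
  move=> sm sn; have := sdvd_nat_lcm (ltn0Sn m) (ltn0Sn n) sm sn.
  have := dvdn_lcml m.+1 n.+1; have := dvdn_lcmr m.+1 n.+1.
  have : (0 < lcmn m.+1 n.+1)%N by rewrite lcmn_gt0.
  by case: lcmn => // l _ dn dm sl; exists l.
move=> /asboolP[k [+ + +]] /asboolP[l [+ + +]] /asboolP[q [+ + +]].
case: k => // m _ sm hm; case: l => // n _ sn hn; case: q => // p _ sp hp.
have [k [sk mk nk]] := merge _ _ sm sn.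
have [l [sl kl pl]] := merge _ _ sk sp.
have [_ [<-] [a ->]] := periodic_dvd (dvdn_trans mk kl) hm.
have [_ [<-] [b ->]] := periodic_dvd (dvdn_trans nk kl) hn.
have [_ [<-] [c ->]] := periodic_dvd pl hp.
by exists l, a, b, c.
Qed.

Lemma per_mx_in m (a : 'M[F]_m.+1) :
  sdvd (steinitz_nat m.+1) s -> per_mx a \in permx_pred.
Proof.
move=> sm; apply/asboolP; exists m.+1.
by split=> //; exists m => //; exists a.
Qed.

Lemma nmx1_in : nmx1 F \in permx_pred.
Proof. by rewrite -(per_mx1 F 0); apply: per_mx_in; exact: sdvd_nat1. Qed.

Lemma permx_submod_closed : submod_closed permx_pred.
Proof.
split=> [|c M N hM hN].
  have -> : 0 = per_mx (0 : 'M[F]_1) :> nmx F.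
    apply/funext => i; apply/funext => j.
    by rewrite /per_mx mxE; case: ifP.
  exact: per_mx_in (sdvd_nat1 s).
have [m [a [b [_ [sm [-> -> _]]]]]] := permx_common hM hN hN.
by rewrite per_mx_lin; exact: per_mx_in.
Qed.

HB.instance Definition _ := GRing.SubChoice_isSubLmodule.Build F (nmx F)
  permx_pred permx permx_submod_closed.

Lemma permx_mul_subproof (M N : permx) :
  nmx_mul (pval M) (pval N) \in permx_pred.
Proof.
have [m [a [b [_ [sm [-> -> _]]]]]] :=
  permx_common (pvalP M) (pvalP N) (pvalP N).
by rewrite per_mxM; exact: per_mx_in.
Qed.

Definition permx_mul (M N : permx) : permx := Permx (permx_mul_subproof M N).
Definition permx_one : permx := Permx nmx1_in.

Lemma permx_mulA : associative permx_mul.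
Proof.
move=> M N P; apply/val_inj; rewrite /permx_mul /=.
have [m [a [b [c [_ [-> -> ->]]]]]] :=
  permx_common (pvalP M) (pvalP N) (pvalP P).
by rewrite !per_mxM mulmxA.
Qed.

Lemma permx_mul1l : left_id permx_one permx_mul.
Proof.
move=> M; apply/val_inj; rewrite /permx_mul /=.
have [m [a [_ [_ [_ [-> _ _]]]]]] := permx_common (pvalP M) (pvalP M) (pvalP M).
by rewrite -(per_mx1 F m) per_mxM mul1mx.
Qed.

Lemma permx_mul1r : right_id permx_one permx_mul.
Proof.
move=> M; apply/val_inj; rewrite /permx_mul /=.
have [m [a [_ [_ [_ [-> _ _]]]]]] := permx_common (pvalP M) (pvalP M) (pvalP M).
by rewrite -(per_mx1 F m) per_mxM mulmx1.
Qed.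

Lemma per_mxD m (a b : 'M[F]_m.+1) : per_mx a + per_mx b = per_mx (a + b).
Proof. by have := per_mx_lin 1 a b; rewrite !scale1r. Qed.

Lemma per_mxZ m (c : F) (a : 'M[F]_m.+1) : c *: per_mx a = per_mx (c *: a).
Proof.
apply/funext => i; apply/funext => j; rewrite /per_mx !fctE.
by case: ifP => _; rewrite ?mxE ?scaler0.
Qed.

Lemma permx_mulDl : left_distributive permx_mul +%R.
Proof.
move=> M N P; apply/val_inj; rewrite /permx_mul /=.
have [m [a [b [c [_ [-> -> ->]]]]]] :=
  permx_common (pvalP M) (pvalP N) (pvalP P).
by rewrite !(per_mxD, per_mxM) mulmxDl.
Qed.

Lemma permx_mulDr : right_distributive permx_mul +%R.
Proof.
move=> M N P; apply/val_inj; rewrite /permx_mul /=.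
have [m [a [b [c [_ [-> -> ->]]]]]] :=
  permx_common (pvalP M) (pvalP N) (pvalP P).
by rewrite !(per_mxD, per_mxM) mulmxDr.
Qed.

Lemma permx_one_neq0 : permx_one != 0.
Proof.
apply/eqP => /(congr1 val) /= /(congr1 (fun M : nmx F => M 0 0)) /eqP.
by rewrite /nmx1 eqxx oner_eq0.
Qed.

HB.instance Definition _ := GRing.Zmodule_isNzRing.Build permx
  permx_mulA permx_mul1l permx_mul1r permx_mulDl permx_mulDr permx_one_neq0.

Lemma permx_scaleAl (c : F) (M N : permx) : c *: (M * N) = (c *: M) * N.
Proof.
apply/val_inj => /=; rewrite /GRing.mul /=.
have [m [a [b [_ [_ [-> -> _]]]]]] :=
  permx_common (pvalP M) (pvalP N) (pvalP N).
by rewrite !(per_mxZ, per_mxM) scalemxAl.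
Qed.

HB.instance Definition _ := GRing.Lmodule_isLalgebra.Build F permx permx_scaleAl.

Lemma permx_scaleAr (c : F) (M N : permx) : c *: (M * N) = M * (c *: N).
Proof.
apply/val_inj => /=; rewrite /GRing.mul /=.
have [m [a [b [_ [_ [-> -> _]]]]]] :=
  permx_common (pvalP M) (pvalP N) (pvalP N).
by rewrite !(per_mxZ, per_mxM) scalemxAr.
Qed.

HB.instance Definition _ := GRing.Lalgebra_isAlgebra.Build F permx permx_scaleAr.

Lemma permx_tr_subproof (M : permx) : nmx_tr (pval M) \in permx_pred.
Proof.
have [m [a [_ [_ [sm [-> _ _]]]]]] :=
  permx_common (pvalP M) (pvalP M) (pvalP M).
by rewrite per_mx_tr; exact: per_mx_in.
Qed.

Definition permx_tr (M : permx) : permx := Permx (permx_tr_subproof M).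

End PeriodicAlgebra.

(* The transpose a^t = iota^-1 (iota a)^t carried to A by an identification
   iota : A -> M_s^p(F) with inverse iotaV. *)
Definition transpose_via (F : fieldType) (A : algType F) (s : steinitz)
    (iota : A -> permx F s) (iotaV : permx F s -> A) (a : A) : A :=
  iotaV (permx_tr (iota a)).

(* Main.v *)
(* Write G(A) = [A^*, A^*].  If a^2 = 0 then x = 1 + a lies in G(A) and is
   conjugate there to x^(k^2) for all k invertible in F, so phi(x) = 1 + b with
   b nilpotent.  If b^2 were nonzero, conjugating b to b + b^2 would give an
   element z commuting with everything that commutes with phi(x); its preimage
   has the form 1 + m a, hence is sent to its fourth power by the torus element
   sending x to x^4, and comparing coefficients of b^2 yields 12 b^2 = 0 modulo
   b^3.  So phi induces a map psi on square-zero elements, which is additive and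
   multiplicatively trivial on orthogonal pairs, preserves sl_2-pairs (braid
   relation), and satisfies psi(xy) = [psi x, psi y] when yx = 0.

   If A contains matrix units e_ij of size n >= 3, the products psi(x) psi(y) and
   psi(y) psi(x), for x in e_ii A e_jj and y in e_jj A e_kk, generate orthogonal
   parts of B; as B is prime one of the two families vanishes, and psi extends to
   a ring isomorphism, possibly after twisting phi by an anti-automorphism of A.
   If A = M_2(F), then psi(t e_12) = s(t) psi(e_12) with s additive and
   compatible with inverses, hence a field automorphism; A = F is trivial.  An
   anti-automorphism of A exists because transposes of an increasing chain of
   matrix subalgebras can be made compatible by Skolem-Noether. *)
Require Import Defs.
From Stdlib Require Import Setoid Ncring Ncring_tac.
From HB Require Import structures.
From mathcomp Require Import all_boot all_order all_algebra all_field.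
From mathcomp Require Import boolp classical_sets cardinality functions.
From mathcomp Require Import zify ring.
Set Implicit Arguments.
Unset Strict Implicit.
Unset Printing Implicit Defensive.
Import GRing.Theory.
Delimit Scope nat_scope with N.
Local Open Scope ring_scope.

(** * Linear algebra *)

(** [phi] is not assumed to respect scalars and B comes without matrix units, so B is reached only
    through its primeness and through generation by square-zero elements, which [phi] controls. A
    torus element at s multiplies a by s^2, hence the exponents k^2. At s = 2 it shows that 1 + a is
    a commutator, with 1 + a/3 as second entry, since 2^2 - 1 = 3, and it is the source of the
    fourth powers. Nilpotency of b splits by characteristic: in characteristic p, x^p = 1 and
    Frobenius suffice; in characteristic zero all k > 0 are available, a finite set of nonzero
    eigenvalues closed under fourth powers consists of roots of unity, and conjugacy to a suitable
    power turns them into 1. The passage from b to b + b^2 must work in every characteristic, so it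
    comes from trace duality rather than from an exponential. Three indices matter because psi sees
    only off-diagonal elements, and a third index lets products be rerouted so as to stay
    off-diagonal. The anti-automorphism of the twist is arbitrary: the transpose is one instance,
    and the constructed one serves the first claim, where no identification with periodic matrices
    is at hand. *)

#[local] Instance nzRing_ring_ops (R : nzRingType) :
  @Ring_ops R 0 1 +%R *%R (fun x y => x - y) -%R eq := {}.

#[local] Instance nzRing_ring (R : nzRingType) :
  @Ring R 0 1 +%R *%R (fun x y => x - y) -%R eq (nzRing_ring_ops R).
Proof.
split; try exact _; try (by move=> *; rewrite /=; congr (_ _)).
all: try by move=> x y /= -> u v ->.
- exact: add0r.
- exact: addrC.
- exact: addrA.
- exact: mul1r.
- exact: mulr1.
- exact: mulrA.
- exact: mulrDl.
- move=> x y z; exact: mulrDr.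
- exact: subrr.
Qed.

(** It proves identities of free rings only. Relations such as [a * a = 0] enter through
    [transitivity] steps whose middle term displays the vanishing products, which a rewrite then
    removes. *)
Ltac ncring := non_commutative_ring.

Lemma unitr_1B_nilpotent (R : unitRingType) (b : R) k :
  b ^+ k = 0 -> 1 - b \is a GRing.unit.
Proof.
move=> bk; apply/unitrP; exists (\sum_(i < k) b ^+ i).
have E : (1 - b) * (\sum_(i < k) b ^+ i) = 1.
  by rewrite -opprB mulNr -subrX1 bk sub0r opprK.
split=> //; rewrite -[RHS]E mulr_suml mulr_sumr; apply: eq_bigr => i _.
by rewrite mulrBr mulrBl mulr1 mul1r -exprS -exprSr.
Qed.

Lemma unitr_1D_nilpotent (R : unitRingType) (b : R) k :
  b ^+ k = 0 -> 1 + b \is a GRing.unit.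
Proof.
move=> bk; rewrite -[b]opprK; apply: (@unitr_1B_nilpotent _ _ k).
by rewrite exprNn bk mulr0.
Qed.

Section ShiftIdentities.
Variables (R : nzRingType) (b X : R).
Hypothesis Xb : X * b = (b + b * b) * X + b.

(** If X maps the right ideal t R into itself, it does the same with b t R; starting from t = 1, X
    preserves the whole flag of right ideals b^i R. *)
Lemma shift_flag_step t Z : b * t = t * b -> X * t = t * Z ->
  X * (b * t) = b * t * ((1 + b) * Z + 1).
Proof.
move=> bt Xt; rewrite mulrA Xb.
transitivity (b * (1 + b) * (X * t) + b * t); first by ncring.
transitivity (b * t * ((1 + b) * Z + 1) + b * (b * t - t * b) * Z).
  by rewrite Xt; ncring.
by rewrite bt subrr mulr0 mul0r addr0.
Qed.

Lemma shift_conj : (1 + b * X) * b = (b + b * b) * (1 + b * X).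
Proof. by rewrite mulrDl mul1r -mulrA Xb; ncring. Qed.
End ShiftIdentities.

(** * Nilpotent matrices and trace duality *)

Section Nilpotent.
Variable F : fieldType.

(** Eigenvalues are avoided: a rank factorization N = L R gives the nilpotent matrix R L of smaller
    size with the same trace, and a nilpotent matrix of full rank has size zero. *)
Lemma mxtrace_nilpotent n (N : 'M[F]_n) k : N ^+ k = 0 -> \tr N = 0.
Proof.
elim/ltn_ind: n => n IH in N k * => Nk.
have [rN|] := ltnP (\rank N) n; last first.
  case: n IH N Nk => [|n] IH N Nk rN; first by rewrite /mxtrace big_ord0.
  have uN : N \in unitmx by rewrite -row_full_unit /row_full eqn_leq rank_leq_col rN.
  have : N ^+ k \in unitmx by rewrite -[_ \in _]/(N ^+ k \is a GRing.unit) unitrX.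
  by rewrite Nk unitmxE det0 unitr0.
pose L := col_base N; pose R := row_base N.
have NE : N = L *m R by rewrite /L /R mulmx_base.
rewrite NE mxtrace_mulC; apply: (IH _ rN _ k.+1).
have H j : (R *m L) ^+ j.+1 = R *m N ^+ j *m L.
  elim: j => [|j IHj]; first by rewrite expr1 expr0 mulmx1.
  rewrite exprS IHj [N ^+ j.+1]exprS -[in RHS]mulmxE [N in _ *m (N *m _)]NE.
  by rewrite -mulmxE !mulmxA.
by rewrite H Nk mulmx0 mul0mx.
Qed.

Lemma mxtrace_nondegenerate n (W : 'M[F]_n) :
  (forall Z, \tr (Z *m W) = 0) -> W = 0.
Proof.
move=> H; apply/matrixP => i l; rewrite mxE -(H (delta_mx l i)) /mxtrace.
rewrite (bigD1 l) //= big1 => [|q ql]; last first.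
  by rewrite mxE big1 // => s _; rewrite mxE (negbTE ql) mul0r.
rewrite addr0 mxE (bigD1 i) //= big1 => [|q qi]; last first.
  by rewrite mxE (negbTE qi) andbF mul0r.
by rewrite mxE !eqxx mul1r addr0.
Qed.

(** The image of L is its own double orthogonal for the trace form. *)
Lemma linear_image_trace n (L : {linear 'M[F]_n -> 'M[F]_n}) (b : 'M[F]_n) :
  (forall Y, (forall X, \tr (L X *m Y) = 0) -> \tr (b *m Y) = 0) ->
  exists X, L X = b.
Proof.
move=> H; have [/submxP[D DE]|] := boolP (mxvec b <= lin_mx L)%MS.
  exists (vec_mx D); apply: (can_inj mxvecK).
  by rewrite -mul_vec_lin vec_mxK -DE.
rewrite submxE; set K := cokermx (lin_mx L) => /eqP nz; case: nz.
apply/rowP => j; rewrite [RHS]mxE.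
(* Column j of the cokernel, reshaped with transposed indices, so that pairing with Y under the
   trace is the j-th cokernel coordinate. *)
pose Y : 'M[F]_n := \matrix_(i, k) K (mxvec_index k i) j.
have trY Z : \tr (Z *m Y) = (mxvec Z *m K) 0 j.
  rewrite mxE /mxtrace (reindex _ (curry_mxvec_bij _ _)) /=.
  under eq_bigr => i _ do rewrite mxE; rewrite pair_bigA /=.
  by apply: eq_bigr => -[i l] _ /=; rewrite mxvecE mxE.
rewrite -trY; apply: H => Z.
by rewrite trY -mul_vec_lin -mulmxA mulmx_coker mulmx0 mxE.
Qed.

(** Y preserves every right ideal b^i R, so each further factor b Y moves one step down the flag. *)
Lemma nilpotent_mul_flag (R : nzRingType) (b Y : R) k : b ^+ k = 0 ->
  (forall i, exists Z, Y * b ^+ i = b ^+ i * Z) -> (b * Y) ^+ k = 0.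
Proof.
move=> bk H; suff [Z ->] : exists Z, (b * Y) ^+ k = b ^+ k * Z by rewrite bk mul0r.
elim: k {bk} => [|k [Z ZE]]; first by exists 1; rewrite mulr1.
have [Z' ZE'] := H k; exists (Z' * Z).
by rewrite exprS ZE mulrA -(mulrA b) ZE' exprS !mulrA.
Qed.

(** It is enough to solve X b - (b + b^2) X = b, for then c = 1 + b X conjugates. By duality the
    equation is solvable if tr(b Y) = 0 whenever b Y = Y (b + b^2); such a Y satisfies Y b = b Y (1
    + b)^-1, preserves the flag b^i R, and so b Y is nilpotent. *)
Lemma conj_nilpotent n (b : 'M[F]_n.+1) k : b ^+ k = 0 ->
  exists2 c, c \is a GRing.unit & c * b = (b + b * b) * c.
Proof.
move=> bk; pose b' := b + b * b.
have ub := unitr_1D_nilpotent bk.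
pose L := fun X : 'M[F]_n.+1 => X * b - b' * X.
have Llin : linear L.
  move=> a X Y; rewrite /L mulrDl mulrDr -scalerAl -scalerAr scalerBr opprD.
  by rewrite addrACA.
pose L' : {linear 'M[F]_n.+1 -> 'M[F]_n.+1} :=
  HB.pack L (GRing.isLinear.Build _ _ _ _ L Llin).
have [X XE] : exists X, L' X = b.
  apply: linear_image_trace => Y LY.
  have bYE : b * Y = Y * b'.
    apply/eqP; rewrite -subr_eq0; apply/eqP/mxtrace_nondegenerate => Z.
    rewrite mulmxBr -[RHS](LY Z) /= /L mulmxBl !raddfB /= -!mulmxE -!mulmxA.
    by congr (_ - _); rewrite [RHS]mxtrace_mulC mulmxA.
  have Yb : Y * b = b * Y / (1 + b).
    by rewrite bYE /b' -{2}[b]mulr1 -mulrDr mulrA mulrK.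
  apply: (@mxtrace_nilpotent _ _ k); apply: nilpotent_mul_flag bk _ => i.
  elim: i => [|i [Z ZE]]; first by exists Y; rewrite mul1r mulr1.
  have cb : GRing.comm (b ^+ i) (1 + b)^-1.
    by apply: commrV; apply: commrD; [exact: commr1 | apply/commr_sym/commrX].
  exists (Z / (1 + b)).
  by rewrite exprS mulrA Yb -!mulrA -[_^-1 * _]cb (mulrA Y) ZE !mulrA.
have Xb : X * b = b' * X + b by rewrite -[in RHS]XE /= /L addrC subrK.
exists (1 + b * X); last exact: shift_conj.
apply: (@unitr_1D_nilpotent _ _ k); apply: nilpotent_mul_flag bk _ => i.
elim: i => [|i [Z ZE]]; first by exists X; rewrite mul1r mulr1.
exists ((1 + b) * Z + 1); rewrite exprS; apply: shift_flag_step ZE => //.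
by rewrite -exprS exprSr.
Qed.

End Nilpotent.

Section MatrixFacts.
Variable F : fieldType.

Lemma mx_regular n (a : 'M[F]_n) : exists r, a *m r *m a = a.
Proof. by exists (pinvmx a); rewrite -mulmxA -{2 3}[a]mul1mx; rewrite mul1mx mulmxA mulmxKpV. Qed.

Lemma mul_delta_mx_mulE m n p q (a : 'M[F]_(m, n)) (b : 'M[F]_(p, q)) i j k l :
  (a *m delta_mx j k *m b) i l = a i j * b k l.
Proof.
rewrite mxE (bigD1 k) //= big1 => [|s sk]; last first.
  rewrite mxE big1 ?mul0r // => t _.
  by rewrite [delta_mx _ _ _ _]mxE (negbTE sk) andbF mulr0.
rewrite addr0 mxE (bigD1 j) //= big1 => [|s sj]; last first.
  by rewrite [delta_mx _ _ _ _]mxE (negbTE sj) mulr0.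
by rewrite addr0 [delta_mx _ _ _ _]mxE !eqxx mulr1.
Qed.

Lemma delta_mx_sandwich n (X : 'M[F]_n) (i j k l : 'I_n) :
  delta_mx k i *m X *m delta_mx j l = X i j *: delta_mx k l.
Proof.
rewrite -(@mul_delta_mx _ _ _ _ (0 : 'I_1) k i) -(@mul_delta_mx _ _ _ _ (0 : 'I_1) j l).
rewrite -!mulmxA (mulmxA X) (mulmxA (delta_mx 0 i)) -colE -rowE.
rewrite [row _ _]mx11_scalar mul_scalar_mx -scalemxAr mul_delta_mx.
by rewrite !mxE.
Qed.

Lemma mx_neq0P m n (a : 'M[F]_(m, n)) : a != 0 -> exists i j, a i j != 0.
Proof.
move=> a0; have [[i j] /= ij|H] := pickP (fun p : 'I_m * 'I_n => a p.1 p.2 != 0).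
  by exists i, j.
by case/eqP: a0; apply/matrixP => i j; rewrite mxE; apply/eqP/negbFE/(H (i, j)).
Qed.

Lemma mx_prime n (a b : 'M[F]_n) : a != 0 -> b != 0 -> exists x, a *m x *m b != 0.
Proof.
move=> /mx_neq0P[i [j ij]] /mx_neq0P[k [l kl]]; exists (delta_mx j k).
apply/eqP => /matrixP/(_ i l); rewrite mul_delta_mx_mulE mxE => /eqP.
by rewrite mulf_eq0 (negbTE ij) (negbTE kl).
Qed.

Lemma mx_centroid n (a c : 'M[F]_n) : a != 0 ->
  (forall x, c *m x *m a = a *m x *m c) -> exists l, c = l *: a.
Proof.
move=> /mx_neq0P[k [l kl]] H; exists (c k l / a k l).
apply/matrixP => i j; rewrite mxE; apply: (mulIf kl).
have := H (delta_mx j k) => /matrixP/(_ i l); rewrite !mul_delta_mx_mulE => ->.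
by rewrite mulrAC divfK // mulrC.
Qed.

(** Write e and z for the bilinear forms of E and Z. The vector e(u,v) v' - e(u,v') v is orthogonal
    to u for e, hence for z: the forms are proportional in the second argument, and symmetrically in
    the first. *)
Lemma mx_proportional n (E Z : 'M[F]_n) :
  (forall (u : 'rV_n) (v : 'cV_n), u *m E *m v = 0 -> u *m Z *m v = 0) ->
  exists l, Z = l *: E.
Proof.
move=> H; pose e (u : 'rV[F]_n) (v : 'cV[F]_n) : F := (u *m E *m v) 0 0.
pose z (u : 'rV[F]_n) (v : 'cV[F]_n) : F := (u *m Z *m v) 0 0.
have entry (M : 'M[F]_n) i j :
    ((delta_mx 0 i : 'rV_n) *m M *m (delta_mx j 0 : 'cV_n)) 0 0 = M i j.
  by rewrite -rowE -colE !mxE.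
have eDl u u' v : e (u + u') v = e u v + e u' v by rewrite /e !mulmxDl mxE.
have zDl u u' v : z (u + u') v = z u v + z u' v by rewrite /z !mulmxDl mxE.
have eM u v : u *m E *m v = (e u v)%:M by rewrite [LHS]mx11_scalar.
have zM u v : u *m Z *m v = (z u v)%:M by rewrite [LHS]mx11_scalar.
have ez u v v' : e u v * z u v' = e u v' * z u v.
  have : u *m Z *m (e u v *: v' - e u v' *: v) = 0.
    apply: H; rewrite mulmxBr -!scalemxAr !eM !scale_scalar_mx.
    by rewrite mulrC subrr.
  rewrite mulmxBr -!scalemxAr !zM !scale_scalar_mx => /eqP.
  by rewrite subr_eq0 => /eqP/matrixP/(_ 0 0); rewrite !mxE !mulr1n.
have ze u u' v : e u v * z u' v = e u' v * z u v.
  have : (e u v *: u' - e u' v *: u) *m Z *m v = 0.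
    apply: H; rewrite !mulmxBl -!scalemxAl !eM !scale_scalar_mx.
    by rewrite mulrC subrr.
  rewrite !mulmxBl -!scalemxAl !zM !scale_scalar_mx => /eqP.
  by rewrite subr_eq0 => /eqP/matrixP/(_ 0 0); rewrite !mxE !mulr1n.
have [E0|/mx_neq0P[k [l kl]]] := eqVneq E 0.
  exists 0; rewrite scale0r; apply/matrixP => i j.
  by rewrite -entry H ?E0 ?mulmx0 ?mul0mx // !mxE.
pose u0 : 'rV[F]_n := delta_mx 0 k; pose v0 : 'cV[F]_n := delta_mx l 0.
have e0 : e u0 v0 != 0 by rewrite /e entry.
exists (z u0 v0 / e u0 v0).
have zv0 u : z u v0 = z u0 v0 / e u0 v0 * e u v0.
  by apply: (mulfI e0); rewrite ze mulrA mulrCA divff // mulr1 mulrC.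
have zE u v : e u v0 != 0 -> z u v = z u0 v0 / e u0 v0 * e u v.
  by move=> uv; apply: (mulfI uv); rewrite ez zv0; ring.
apply/matrixP => i j; rewrite [RHS]mxE -(entry Z) -(entry E).
set u := delta_mx 0 i; set v := delta_mx j 0; rewrite -/(e u v) -/(z u v).
(* When e(u,v0) vanishes, u is replaced by u + u0, for which it does not, and the known contribution
   of u0 is subtracted. *)
have [uv|] := eqVneq (e u v0) 0; last exact: zE.
have : e (u + u0) v0 != 0 by rewrite eDl uv add0r.
by move=> /(zE _ v); rewrite zDl eDl mulrDr (zE u0 v e0) => /addIr.
Qed.

(** If u E v = 0, then p = E v u E lies in the corner and has square zero. Commuting with it forces
    u Z v = 0, so the forms of E and Z are proportional. *)
Lemma mx_corner_center n (E Z : 'M[F]_n) : E *m E = E -> E *m Z *m E = Z ->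
  (forall p, E *m p *m E = p -> p *m p = 0 -> Z *m p = p *m Z) ->
  exists l, Z = l *: E.
Proof.
move=> EE ZE H; apply: mx_proportional => u v uv.
have EZ : E *m Z = Z by rewrite -ZE !mulmxA EE.
have ZE' : Z *m E = Z by rewrite -ZE -!mulmxA EE.
pose p := E *m v *m u *m E.
have pp : p *m p = 0.
  have -> : p *m p = E *m v *m (u *m (E *m E) *m v) *m u *m E by rewrite /p !mulmxA.
  by rewrite EE uv mulmx0 !mul0mx.
have := H p; rewrite /p !mulmxA EE -!mulmxA EE !mulmxA => /(_ erefl).
rewrite /p !mulmxA in pp; rewrite pp ZE' => /(_ erefl).
move=> /(congr1 (mulmx u)); rewrite !mulmxA -(mulmxA _ E Z) EZ uv !mul0mx.
rewrite -mulmxA => /eqP.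
have [uE _|uE] := eqVneq (u *m E) 0; first by rewrite -EZ mulmxA uE !mul0mx.
rewrite [_ *m Z *m v]mx11_scalar mul_scalar_mx scaler_eq0 (negbTE uE) orbF => /eqP->.
by apply/matrixP => i j; rewrite !mxE mul0rn.
Qed.

End MatrixFacts.

(** * Row reduction by transvections *)

Section Elementary.
Variables (F : fieldType) (n : nat).
Implicit Types (M g h : 'M[F]_n.+1) (i j k : 'I_n.+1) (t d : F).

Definition elem_mx t i j : 'M[F]_n.+1 := 1 + t *: delta_mx i j.

Inductive elem_prod : 'M[F]_n.+1 -> Prop :=
| elem_prod1 : elem_prod 1
| elem_prod_cons t i j M : i != j -> elem_prod M ->
    elem_prod (elem_mx t i j * M).

Lemma delta_mx_mul0 i j k l : j != k -> delta_mx i j * delta_mx k l = 0 :> 'M[F]_n.+1.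
Proof. exact: mul_delta_mx_0. Qed.

Lemma elem_mxK t i j : i != j -> elem_mx t i j * elem_mx (- t) i j = 1.
Proof.
move=> ij; rewrite /elem_mx mulrDl !mulrDr !mul1r mulr1 -scalerAl -scalerAr.
by rewrite delta_mx_mul0 1?eq_sym // !scaler0 addr0 -addrA scaleNr addNr addr0.
Qed.

Lemma elem_prodM M N : elem_prod M -> elem_prod N -> elem_prod (M * N).
Proof.
elim=> [|t i j {}M ij _ IH] hN; first by rewrite mul1r.
by rewrite -mulrA; apply: elem_prod_cons => //; apply: IH.
Qed.

Lemma elem_prod_elem t i j : i != j -> elem_prod (elem_mx t i j).
Proof.
by move=> ij; rewrite -[elem_mx _ _ _]mulr1; apply: elem_prod_cons => //; constructor.
Qed.

Lemma elem_prod_unit M : elem_prod M -> M \is a GRing.unit.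
Proof.
elim=> [|t i j {}M ij _ IH]; first exact: unitr1.
rewrite unitrMl //; apply/unitrP; exists (elem_mx (- t) i j); split.
  by rewrite -{2}[t]opprK elem_mxK.
exact: elem_mxK.
Qed.

Lemma elem_prodV M : elem_prod M -> elem_prod M^-1.
Proof.
elim=> [|t i j {}M ij hM IH]; first by rewrite invr1; constructor.
have u := elem_prod_unit (elem_prod_elem t ij).
rewrite invrM ?(elem_prod_unit hM) //; apply: elem_prodM => //.
have -> : (elem_mx t i j)^-1 = elem_mx (- t) i j.
  by apply: (mulrI u); rewrite divrr // elem_mxK.
exact: elem_prod_elem.
Qed.

Lemma elem_mx_mulE t i j M a b :
  (elem_mx t i j * M) a b = M a b + (if a == i then t * M j b else 0).
Proof.
rewrite mulrDl mul1r -scalerAl mxE; congr (_ + _).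
rewrite mxE mxE; case: ifP => [/eqP ->|ai].
  congr (_ * _); rewrite (bigD1 j) //= big1 => [|s sj].
    by rewrite addr0 mxE !eqxx mul1r.
  by rewrite mxE (negbTE sj) andbF mul0r.
by rewrite big1 ?mulr0 // => s _; rewrite mxE ai mul0r.
Qed.

Definition last_diag d : 'M[F]_n.+1 := 1 + (d - 1) *: delta_mx ord_max ord_max.

Lemma last_diagM d d' : last_diag d * last_diag d' = last_diag (d * d').
Proof.
rewrite /last_diag mulrDl !mulrDr !mul1r mulr1 -scalerAl -scalerAr.
rewrite [delta_mx _ _ * _]mul_delta_mx scalerA -!addrA -!scalerDl.
by congr (_ + _ *: _); ring.
Qed.

Lemma last_diag1 : last_diag 1 = 1.
Proof. by rewrite /last_diag subrr scale0r addr0. Qed.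

Lemma last_diag_unit d : d != 0 -> last_diag d \is a GRing.unit.
Proof.
move=> d0; apply/unitrP; exists (last_diag d^-1).
by rewrite !last_diagM mulVf // mulfV // last_diag1.
Qed.

Lemma last_diagV d : d != 0 -> (last_diag d)^-1 = last_diag d^-1.
Proof.
move=> d0; apply: (mulrI (last_diag_unit d0)).
by rewrite divrr ?last_diag_unit // last_diagM mulfV // last_diag1.
Qed.

Lemma conj_last_diag d t i j : d != 0 -> i != j -> exists t',
  last_diag d * elem_mx t i j = elem_mx t' i j * last_diag d.
Proof.
move=> d0 ij; pose s := if i == ord_max then d else if j == ord_max then d^-1 else 1.
exists (s * t); rewrite /last_diag /elem_mx !mulrDl !mulrDr !mul1r !mulr1.
rewrite -!scalerAl -!scalerAr /s; have [iE|iN] := eqVneq i ord_max.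
  have jN : j != ord_max by rewrite -iE eq_sym.
  rewrite iE [delta_mx _ _ * delta_mx _ j]mul_delta_mx.
  rewrite [_ * delta_mx ord_max ord_max]delta_mx_mul0 // !scaler0 addr0.
  have -> : (d * t) *: delta_mx ord_max j =
      t *: delta_mx ord_max j + (d - 1) *: (t *: delta_mx ord_max j) :> 'M[F]_n.+1.
    by rewrite scalerA -scalerDl; congr (_ *: _); ring.
  exact: addrACA.
rewrite delta_mx_mul0 1?eq_sym // !scaler0 addr0.
have [jE|jN] := eqVneq j ord_max.
  rewrite jE [delta_mx i _ * _]mul_delta_mx scalerA -scalerDl addrAC.
  by congr (_ + _ *: _); field.
by rewrite delta_mx_mul0 // !scaler0 addr0 mul1r addrAC.
Qed.

Lemma elem_prod_conj_last_diag d M : d != 0 -> elem_prod M ->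
  elem_prod (last_diag d * M * (last_diag d)^-1).
Proof.
move=> d0; have u := last_diag_unit d0.
elim=> [|t i j {}M ij _ IH]; first by rewrite mulr1 divrr //; constructor.
have [t' E] := conj_last_diag t d0 ij.
by rewrite mulrA E -!mulrA; apply: elem_prod_cons => //; rewrite mulrA.
Qed.

Let reduced (k : nat) M := forall i j, (j < k)%N -> M i j = (i == j)%:R.

Let reduced_elem (k : nat) M t i j : (k <= j)%N -> reduced k M -> reduced k (elem_mx t i j * M).
Proof.
move=> kj H a b bk; rewrite elem_mx_mulE H //; case: ifP; rewrite ?addr0 // => _.
have -> : M j b = 0; last by rewrite mulr0 addr0.
rewrite H //; case: eqP => // jb; move: bk; rewrite -jb ltnNge kj //.
Qed.

(** Without a pivot, column k would be a combination of the earlier, already standard columns; w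
    records that relation and is a nonzero kernel vector. *)
Let reduced_pivot k M : M \is a GRing.unit -> reduced k M ->
  exists2 i : 'I_n.+1, (k <= i)%N & M i k != 0.
Proof.
move=> uM H; have [i /andP[ki Mi]|N] := pickP (fun i : 'I_n.+1 => (k <= i)%N && (M i k != 0)).
  by exists i.
pose w : 'cV[F]_n.+1 :=
  \col_i (if i == k then 1 else if (i < k)%N then - M i k else 0).
have : M *m w = 0.
  apply/matrixP => a z; rewrite mxE [RHS]mxE (bigD1 k) //= mxE eqxx mulr1.
  have [ak|ka] := ltnP a k.
    rewrite (bigD1 a) //=; last by rewrite neq_ltn ak.
    rewrite mxE ak [M a a]H // eqxx mul1r ifN ?neq_ltn ?ak // addrA subrr add0r.
    apply: big1 => s /andP[sk sa]; rewrite mxE (negbTE sk).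
    by case: ifP => [s_lt|_]; rewrite ?mulr0 // H // eq_sym (negbTE sa) mul0r.
  have /eqP-> : M a k == 0 by move: (N a); rewrite ka /= => /negbFE.
  rewrite add0r; apply: big1 => s sk; rewrite mxE (negbTE sk).
  case: ifP => [s_lt|_]; rewrite ?mulr0 // H // [a == s](_ : _ = false) ?mul0r //.
  by apply/negbTE; rewrite neq_ltn (leq_trans s_lt ka) orbT.
move=> /(congr1 (mulmx (invmx M))); rewrite mulKmx // mulmx0 => /matrixP/(_ k 0).
by rewrite !mxE eqxx => /eqP; rewrite oner_eq0.
Qed.

Let clear_column k M : reduced k M -> M k k = 1 ->
  exists2 E, elem_prod E & reduced k.+1 (E * M).
Proof.
move=> H Mk.
suff /(_ n.+1)[E hE [EH Ek]] : forall l, exists2 E, elem_prod E & reduced k (E * M) /\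
    (forall i, (i < l)%N || (i == k) -> (E * M) i k = (i == k)%:R).
  exists E => // i j; rewrite ltnS leq_eqVlt => /orP[/eqP/val_inj->|]; last exact: EH.
  by rewrite Ek ?ltn_ord.
elim=> [|l [E hE [EH Ek]]].
  by exists 1; [constructor | rewrite mul1r; split=> // i /eqP->; rewrite eqxx].
have [ln|nl] := ltnP l n.+1; last first.
  by exists E => //; split=> // i _; apply: Ek; rewrite (leq_trans _ nl).
pose a := Ordinal ln; have [ak|ak] := eqVneq a k.
  exists E => //; split=> // i; rewrite ltnS leq_eqVlt -orbA => /or3P[/eqP il|il|ik].
  - by apply: Ek; rewrite -ak -val_eqE /= il eqxx orbT.
  - by apply: Ek; rewrite il.
  - by apply: Ek; rewrite ik orbT.
exists (elem_mx (- (E * M) a k) a k * E); first exact: elem_prod_cons.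
rewrite -mulrA; split=> [|i]; first exact: reduced_elem.
rewrite elem_mx_mulE (Ek k) ?eqxx ?orbT // mulr1.
have [->|ia] := eqVneq i a; first by rewrite subrr (negbTE ak).
rewrite addr0 ltnS leq_eqVlt -orbA => /or3P[/eqP il|il|ik].
- by case/eqP: ia; apply: val_inj.
- by apply: Ek; rewrite il.
- by apply: Ek; rewrite ik orbT.
Qed.

Let reduction g (k : nat) : g \is a GRing.unit -> (k <= n)%N ->
  exists2 E, elem_prod E & reduced k (E * g).
Proof.
move=> ug; elim: k => [|k IH] kn; first by exists 1 => //; constructor.
have [E hE H] := IH (ltnW kn); pose k' := Ordinal (leqW kn : (k < n.+1)%N).
have uM : E * g \is a GRing.unit by rewrite unitrMr // elem_prod_unit.
suff [E1 hE1 [H1 k1]] : exists2 E1, elem_prod E1 & reduced k (E1 * g) /\ (E1 * g) k' k' = 1.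
  have [E2 hE2 H2] := @clear_column k' _ H1 k1.
  by exists (E2 * E1); [exact: elem_prodM | rewrite -mulrA].
have step E2 i : elem_prod E2 -> reduced k (E2 * g) -> (k < i)%N -> (E2 * g) i k' != 0 ->
    exists2 E1, elem_prod E1 & reduced k (E1 * g) /\ (E1 * g) k' k' = 1.
  move=> hE2 H2 ki Mi; pose t := (1 - (E2 * g) k' k') / (E2 * g) i k'.
  exists (elem_mx t k' i * E2).
    by apply: elem_prod_cons; rewrite // neq_ltn ki.
  rewrite -mulrA; split; first by apply: reduced_elem => //; exact: ltnW.
  by rewrite elem_mx_mulE eqxx /t divfK // addrC subrK.
have [i ki Mi] := @reduced_pivot k' _ uM H.
move: ki; rewrite leq_eqVlt => /orP[/eqP/= kE|]; last by move=> ki; exact: (step E i).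
have {kE} iE : i = k' by apply: val_inj.
rewrite {i}iE in Mi.
(* The pivot sits in row k itself. Row k + 1 exists because k < n; if its entry vanishes, adding row
   k to it supplies a nonzero entry below the diagonal, with which the pivot can be made 1. *)
pose i : 'I_n.+1 := Ordinal (kn : (k.+1 < n.+1)%N).
have [Mi0|] := eqVneq ((E * g) i k') 0; last by move=> ?; exact: (step E i).
apply: (step (elem_mx 1 i k' * E) i) => //.
- by apply: elem_prod_cons; rewrite // neq_ltn /= ltnSn orbT.
- by rewrite -mulrA; apply: reduced_elem.
- by rewrite -mulrA elem_mx_mulE Mi0 eqxx mul1r add0r.
Qed.

Lemma elem_decomposition g : g \is a GRing.unit ->
  exists2 E, elem_prod E & exists2 d, d != 0 & g = E * last_diag d.
Proof.
move=> ug; have [E hE H] := reduction ug (leqnn n).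
have uE := elem_prod_unit hE.
have uM : E * g \is a GRing.unit by rewrite unitrMr.
pose m : 'I_n.+1 := ord_max; pose d := (E * g) m m.
have [i mi di] := @reduced_pivot m _ uM H.
have im : i = m by apply/val_inj/eqP; rewrite eqn_leq mi -ltnS ltn_ord.
rewrite {i mi}im -/d in di.
have uD := last_diag_unit di.
have H' : reduced m (E * g * (last_diag d)^-1).
  move=> i j jm; rewrite last_diagV // mulrDr mulr1 -scalerAr mxE H //.
  rewrite [X in _ + X]mxE [X in _ * X]mxE big1 ?mulr0 ?addr0 // => s _.
  by rewrite [delta_mx _ _ _ _]mxE -[j == _]val_eqE /= (ltn_eqF jm) andbF mulr0.
have H1 : (E * g * (last_diag d)^-1) m m = 1.
  rewrite last_diagV // mulrDr mulr1 -scalerAr mxE -/d.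
  rewrite [X in _ + X]mxE [X in _ * X]mxE (bigD1 m) //= big1 => [|s sm]; last first.
    by rewrite [delta_mx _ _ _ _]mxE (negbTE sm) mulr0.
  by rewrite [delta_mx _ _ _ _]mxE !eqxx mulr1 addr0 -/d; field.
have [E' hE' H''] := clear_column H' H1.
have E1 : E' * (E * g * (last_diag d)^-1) = 1.
  by apply/matrixP => i j; rewrite H'' ?ltn_ord // mxE.
exists (E^-1 * E'^-1); first by apply: elem_prodM; apply: elem_prodV.
exists d => //; have uE' := elem_prod_unit hE'.
rewrite -[g](mulKr uE) -mulrA; congr (_ * _).
by rewrite -[E * g in LHS](mulrVK uD) -[in LHS](mulKr uE' (_ / _)) E1 mulr1.
Qed.


(** The matrices [last_diag d] normalise the elementary products and commute with one another, so
    the diagonal parts of g and h cancel in the commutator. No determinant is involved. *)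
Lemma elem_prod_commutator g h : g \is a GRing.unit -> h \is a GRing.unit ->
  elem_prod (g * h * g^-1 * h^-1).
Proof.
move=> /elem_decomposition[E hE [d d0 ->]] /elem_decomposition[E' hE' [d' d'0 ->]].
have uE := elem_prod_unit hE; have uE' := elem_prod_unit hE'.
have ud := last_diag_unit d0; have ud' := last_diag_unit d'0.
have -> : E * last_diag d * (E' * last_diag d') * (E * last_diag d)^-1 * (E' * last_diag d')^-1 =
   E * (last_diag d * E' * (last_diag d)^-1) * (last_diag d' * E^-1 * (last_diag d')^-1) * E'^-1.
  rewrite !invrM // !mulrA; do 2! congr (_ * _).
  rewrite -!(mulrA (E * last_diag d * E')); congr (_ * _ * _).
  by rewrite last_diagV // !last_diagM mulrC.
apply: elem_prodM (elem_prodV hE'); apply: elem_prodM; first apply: elem_prodM => //.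
  exact: elem_prod_conj_last_diag.
exact: elem_prod_conj_last_diag (elem_prodV hE).
Qed.

End Elementary.

(** * Idempotent matrices and the Skolem-Noether theorem *)

Section Idempotents.
Variable F : fieldType.

Lemma codiagonalize_idempotents n (I : finType) (e : I -> 'M[F]_n.+1) :
  (forall i, e i * e i = e i) -> (forall i j, e i * e j = e j * e i) ->
  exists2 P : 'M[F]_n.+1, P \is a GRing.unit &
    forall i a b, a != b -> (P * e i * P^-1) a b = 0.
Proof.
move=> ee eC; have [|P uP /allP/= H] := (codiagonalizableP [seq e i | i <- enum I]).1.
  split=> [_ _ /mapP[i _ ->] /mapP[j _ ->]|_ /mapP[i _ ->]]; first exact: eC.
  apply/diagonalizableP; exists [:: 0; 1].
    by rewrite /= inE eq_sym oner_eq0.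
  apply: mxminpoly_min; rewrite !big_cons big_nil mulr1 rmorphM !rmorphB /=.
  by rewrite horner_mx_X !horner_mx_C raddf0 subr0 mulrBr mulr1 ee subrr.
exists P => // i a b ab.
have /H : e i \in [seq e i | i <- enum I] by apply: map_f; rewrite mem_enum.
by move=> /(diagonalizable_forP _ uP)/(_ a b ab).
Qed.

Lemma idempotent_factor n r (E : 'M[F]_n) : E *m E = E -> \rank E = r ->
  exists (C : 'M_(n, r)) (R : 'M_(r, n)), C *m R = E /\ R *m C = 1%:M.
Proof.
move=> EE <-; exists (col_base E), (row_base E); split; first exact: mulmx_base.
have := EE; rewrite -{1 2 3}(mulmx_base E).
set C := col_base E; set R := row_base E => H.
have CK : pinvmx C *m C = 1%:M by rewrite mulVpmx ?col_base_full.
have RK : R *m pinvmx R = 1%:M by rewrite mulmxVp ?row_base_free.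
rewrite -[LHS]mul1mx -CK -[LHS]mulmx1 -RK.
transitivity (pinvmx C *m (C *m R *m (C *m R)) *m pinvmx R); first by rewrite !mulmxA.
by rewrite H mulmxA CK mul1mx RK.
Qed.

Lemma idempotents_rank_sum n (I : finType) (e : I -> 'M[F]_n) :
  (forall i, e i *m e i = e i) -> (forall i j, i != j -> e i *m e j = 0) ->
  \sum_i e i = 1%:M -> (\sum_i \rank (e i))%N = n.
Proof.
move=> ee eO e1; have dx : mxdirect (\sum_i e i)%MS.
  apply/mxdirect_sumsP => i _; apply/eqP/rowV0P => v; rewrite sub_capmx => /andP[].
  move=> /submxP[x vE] /sub_sumsmxP[u vE'].
  have <- : v *m e i = v by rewrite vE -mulmxA ee.
  by rewrite vE' mulmx_suml big1 // => j ji; rewrite -mulmxA eO // mulmx0.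
rewrite -(mxdirectP dx) /= -[RHS](mxrank1 F n); apply/eqmx_rank; apply/andP; split.
  exact: submx1.
rewrite -[X in (X <= _)%MS]e1; apply: summx_sub => i _; exact: sumsmx_sup (submx_refl _).
Qed.

(** The images of the diagonal units are orthogonal idempotents of equal rank with sum 1, so those
    of the first unit have the same rank under f1 and f2. Rank factorizations then give X linking
    these two idempotents, and u spreads X over all indices. *)
Lemma matrix_embeddings_conj k m (f1 f2 : {lrmorphism 'M[F]_k.+1 -> 'M[F]_m.+1}) :
  exists2 u, u \is a GRing.unit & forall x, u * f1 x = f2 x * u.
Proof.
pose d i j : 'M[F]_k.+1 := delta_mx i j.
have dM i j l : d i j * d j l = d i l by exact: mul_delta_mx.
have d0 i j j' l : j != j' -> d i j * d j' l = 0 by move=> ?; exact: mul_delta_mx_0.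
have d1 : \sum_i d i i = 1.
    apply/matrixP => a b; rewrite summxE (bigD1 a) //= big1 => [|i ia]; last first.
      by rewrite mxE [a == _]eq_sym (negbTE ia).
    by rewrite !mxE eqxx addr0 eq_sym.
have rk (f : {lrmorphism 'M[F]_k.+1 -> 'M[F]_m.+1}) :
    (k.+1 * \rank (f (d ord0 ord0)))%N = m.+1.
  rewrite -[RHS](@idempotents_rank_sum _ _ (fun i => f (d i i))).
  - rewrite -[in LHS](card_ord k.+1) -sum_nat_const; apply: eq_bigr => i _.
    apply/eqP; rewrite eqn_leq; apply/andP; split.
      rewrite -(dM ord0 i ord0) -(dM i i ord0) !rmorphM /= -!mulmxE.
      exact: leq_trans (mxrankM_maxr _ _) (mxrankM_maxl _ _).
    rewrite -(dM i ord0 i) -(dM ord0 ord0 i) !rmorphM /= -!mulmxE.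
    exact: leq_trans (mxrankM_maxr _ _) (mxrankM_maxl _ _).
  - by move=> i; rewrite mulmxE -rmorphM dM.
  - by move=> i j ij; rewrite mulmxE -rmorphM d0 // rmorph0.
  - by rewrite -raddf_sum d1; exact: rmorph1.
have [r r1] : {r | \rank (f1 (d ord0 ord0)) = r} by eexists.
have r2 : \rank (f2 (d ord0 ord0)) = r.
  by rewrite -r1; apply/eqP; rewrite -(eqn_pmul2l (ltn0Sn k)) !rk.
have id0 (f : {lrmorphism 'M[F]_k.+1 -> 'M[F]_m.+1}) :
  f (d ord0 ord0) *m f (d ord0 ord0) = f (d ord0 ord0) by rewrite mulmxE -rmorphM dM.
have [C1 [R1 [CR1 RC1]]] := idempotent_factor (id0 f1) r1.
have [C2 [R2 [CR2 RC2]]] := idempotent_factor (id0 f2) r2.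
pose X : 'M[F]_m.+1 := C2 *m R1; pose Y : 'M[F]_m.+1 := C1 *m R2.
have XY : X * Y = f2 (d ord0 ord0).
  by rewrite -mulmxE /X /Y mulmxA -(mulmxA C2) RC1 mulmx1.
have X1 : X * f1 (d ord0 ord0) = X.
  by rewrite -mulmxE /X -CR1 -mulmxA (mulmxA R1) RC1 mul1mx.
pose u := \sum_i f2 (d i ord0) * X * f1 (d ord0 i).
pose v := \sum_i f1 (d i ord0) * Y * f2 (d ord0 i).
have uv : u * v = 1.
  rewrite /u mulr_suml -(rmorph1 f2) -d1 raddf_sum /=; apply: eq_bigr => i _.
  rewrite /v mulr_sumr (bigD1 i) //= big1 => [|j ji].
    rewrite addr0 !mulrA -(mulrA _ (f1 _) (f1 _)) -rmorphM dM -(mulrA _ X) X1.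
    by rewrite -(mulrA _ X) XY -rmorphM dM -rmorphM dM.
  by rewrite !mulrA -(mulrA _ (f1 _) (f1 _)) -rmorphM d0 1?eq_sym // rmorph0 mulr0 !mul0r.
exists u; first by apply/unitrP; exists v; split=> //; exact: mulmx1C.
move=> x; rewrite (matrix_sum_delta x) !raddf_sum /= mulr_sumr mulr_suml.
apply: eq_bigr => a _; rewrite !raddf_sum /= mulr_sumr mulr_suml.
apply: eq_bigr => b _.  rewrite !linearZZ -scalerAr -scalerAl; congr (_ *: _).
rewrite /u mulr_suml mulr_sumr (bigD1 a) //= big1 => [|j ja]; last first.
  by rewrite -!mulrA -rmorphM d0 // rmorph0 !mulr0.
rewrite (bigD1 b) //= big1 => [|j jb]; last first.
  by rewrite !mulrA -rmorphM d0 1?eq_sym // rmorph0 !mul0r.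
by rewrite !addr0 !mulrA -rmorphM dM -!mulrA -rmorphM dM.
Qed.
End Idempotents.

(** * Unipotence from conjugacy with powers *)

Section UnipotentCriterion.
Variable F : fieldType.

Definition torsion_poly (N : nat) : {poly F} := 'X * ('X^N - 1).

Lemma irreducible_root_dvdp (L : fieldExtType F) (p r : {poly F}) (z : L) :
  irreducible_poly p -> root (map_poly (in_alg L) p) z ->
  root (map_poly (in_alg L) r) z -> p %| r.
Proof.
move=> [p1 irr] rp rr; have [g1|g1] := eqVneq (size (gcdp p r)) 1.
  have : coprimep (map_poly (in_alg L) p) (map_poly (in_alg L) r).
    by rewrite coprimep_map /coprimep g1.
  by move=> /coprimep_root/(_ rp); rewrite (rootP rr) eqxx.
have := irr _ g1 (dvdp_gcdl _ _).
by move=> /eqp_dvdl <-; apply: dvdp_gcdr.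
Qed.

(* On each irreducible factor, a root z generates the finite orbit of its powers
   z^(4^i) among the roots of mu; z = 0 is allowed, whence the factor 'X. *)
Lemma stable_roots_torsion (mu : {poly F}) : mu != 0 -> mu %| mu \Po 'X^4 ->
  forall q, q %| mu -> exists N M, (0 < N)%N /\ q %| torsion_poly N ^+ M.
Proof.
move=> mu0 mu4 q; have [s] := ubnP (size q).
elim: s q => // s IH q qs qmu.
have q0 : q != 0 by apply: contraNneq mu0 => q0; rewrite -dvd0p -q0.
have [q1|q1] := leqP (size q) 1.
  exists 1, 0; split=> //; rewrite expr0 dvdp1 eqn_leq q1.
  by rewrite lt0n size_poly_eq0.
have [irr|nirr] := pselect (irreducible_poly q).
  have [L _ [z qz _]] := irredp_FAdjoin irr.
  pose muL := map_poly (in_alg L) mu.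
  have muz : root muL z.
    by move: qmu => /dvdpP[r muE]; rewrite /muL muE rmorphM rootM qz orbT.
  have step x : root muL x -> root muL (x ^+ 4).
    move=> mux; have : muL %| muL \Po 'X^4.
      by rewrite -[X in _ \Po X](map_polyXn (in_alg L)) -map_comp_poly dvdp_map.
    move=> /dvdpP[r rE]; move: (congr1 (horner^~ x) rE).
    rewrite horner_comp hornerXn hornerM (rootP mux) mulr0 => H.
    exact/rootP.
  have roots i : root muL (z ^+ (4 ^ i)).
    by elim: i => [|i IHi]; rewrite ?expr1 // expnSr exprM; apply: step.
  pose rs := mkseq (fun i => z ^+ (4 ^ i)) (size mu).
  have : ~~ uniq rs.
    apply/negP => urs; have := @max_poly_roots _ muL rs.
    rewrite map_poly_eq0 mu0 size_map_poly size_mkseq ltnn => H.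
    by suff : false by []; apply: H => //; apply/allP => _ /mapP[i _ ->].
  move=> /(uniqPn 0)[i [j [ij]]]; rewrite size_mkseq => js.
  rewrite !nth_mkseq ?(ltn_trans ij) // => zE.
  exists (4 ^ j - 4 ^ i)%N, 1; split; first by rewrite subn_gt0 ltn_exp2l.
  rewrite expr1; apply: (@irreducible_root_dvdp L _ _ z) => //.
  have le : (4 ^ i <= 4 ^ j)%N by rewrite leq_exp2l // ltnW.
  rewrite /torsion_poly rmorphM rmorphB /= map_polyX map_polyXn rmorph1.
  rewrite rootE !hornerE mulf_eq0; have [//|z0 /=] := eqVneq z 0.
  apply/eqP/(mulfI (expf_neq0 (4 ^ i) z0)).
  by rewrite mulr0 mulrBr mulr1 -exprD subnKC // zE subrr.
have [d [d1 dq ndq]] : exists d : {poly F}, [/\ size d != 1, d %| q & ~~ (d %= q)].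
  apply: contrapT => H; apply: nirr; split=> // d d1 dq.
  by apply: contrapT => /negP ndq; apply: H; exists d.
have d0 : d != 0 by apply: contraNneq q0 => d0; rewrite -dvd0p -d0.
have qE := divpK dq; set c := q %/ d in qE.
have c0 : c != 0 by apply: contraNneq q0 => c0; rewrite -qE c0 mul0r.
have sq : size q = (size c + size d).-1 by rewrite -qE size_mul.
have sd : (1 < size d)%N.
  by rewrite ltn_neqAle eq_sym d1 lt0n size_poly_eq0.
have sc : (1 < size c)%N.
  rewrite ltn_neqAle lt0n size_poly_eq0 c0 andbT eq_sym.
  apply: contra ndq => /eqP c1; rewrite -dvdp_size_eqp // sq c1 //.
have [N1 [M1 [N10 H1]]] : exists N M, (0 < N)%N /\ c %| torsion_poly N ^+ M.
  apply: IH; last by apply: dvdp_trans qmu; rewrite -qE dvdp_mulIl.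
  by move: qs sd sc; rewrite sq; move: (size c) (size d) => x1 x2; lia.
have [N2 [M2 [N20 H2]]] : exists N M, (0 < N)%N /\ d %| torsion_poly N ^+ M.
  apply: IH; last exact: dvdp_trans dq qmu.
  by move: qs sd sc; rewrite sq; move: (size c) (size d) => x1 x2; lia.
have T N K : (0 < K)%N -> (N %| K)%N -> torsion_poly N %| torsion_poly K.
  move=> K0 /dvdnP[e KE]; apply: dvdp_mul => //.
  by rewrite KE mulnC exprM -[X in _ %| _ - X](expr1n _ e) subrXX dvdp_mulr.
exists (N1 * N2)%N, (M1 + M2)%N; split; first by rewrite muln_gt0 N10.
rewrite -qE exprD; apply: dvdp_mul.
  by apply: dvdp_trans H1 _; apply: dvdp_exp2r; apply: T; rewrite ?muln_gt0 ?N10 // dvdn_mulr.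
by apply: dvdp_trans H2 _; apply: dvdp_exp2r; apply: T; rewrite ?muln_gt0 ?N10 // dvdn_mull.
Qed.

(** Conjugacy of y with y^4 makes the minimal polynomial divide its composite with X^4, so its roots
    are zero or roots of unity. As y is invertible, y^N - 1 is nilpotent for some N > 0. Taking k =
    N, y - 1 is conjugate to y^(N^2) - 1, a multiple of y^N - 1. *)
Lemma unipotent_of_conj_squares (B : unitAlgType F) m
    (f : {lrmorphism 'M[F]_m.+1 -> B}) (Y : 'M[F]_m.+1) (y := f Y) :
  injective f -> y \is a GRing.unit ->
  (forall k, (0 < k)%N ->
    exists2 h, h \is a GRing.unit & h * y = y ^+ (k ^ 2) * h) ->
  exists M, (y - 1) ^+ M = 0.
Proof.
move=> finj uy H; pose mu := mxminpoly Y.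
pose E : {poly F} -> B := fun p => f (horner_mx Y p).
have EX : E 'X = y by rewrite /E horner_mx_X.
have EC c : E c%:P = c%:A.
  by rewrite /E horner_mx_C -scalemx1 linearZZ rmorph1.
have ED p q : E (p + q) = E p + E q by rewrite /E !rmorphD.
have EM p q : E (p * q) = E p * E q by rewrite /E !rmorphM.
have EXn k : E 'X^k = y ^+ k by rewrite /E !rmorphXn /= horner_mx_X.
have E0 p : mu %| p -> E p = 0.
  by rewrite /E dvd_mxminpoly => /eqP->; rewrite rmorph0.
have conjP h k p : h * y = y ^+ k * h -> E (p \Po 'X^k) * h = h * E p.
  move=> hy; elim/poly_ind: p => [|p c IH].
    by rewrite comp_poly0 /E !rmorph0 mulr0 mul0r.
  rewrite comp_polyD comp_polyM comp_polyX comp_polyC !ED !EM EXn EX EC.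
  rewrite mulrDl mulrDr -mulrA -hy !mulrA IH; congr (_ + _).
  by rewrite mulr_algl mulr_algr.
have mu0 : mu != 0 by rewrite monic_neq0 // mxminpoly_monic.
have mu4 : mu %| mu \Po 'X^4.
  have [h uh hy] := H 2 isT.
  rewrite dvd_mxminpoly; apply/eqP/finj; rewrite rmorph0.
  by apply: (mulIr uh); rewrite -/(E _) conjP // E0 // mulr0 mul0r.
have [N [M [N0 muT]]] := stable_roots_torsion mu0 mu4 (dvdpp mu).
have yN : (y ^+ N - 1) ^+ M = 0.
  apply: (mulrI (unitrX M uy)); rewrite mulr0 -(E0 _ muT).
  rewrite /torsion_poly exprMn_comm; last exact: mulrC.
  rewrite EM EXn; congr (_ * _).
  by rewrite /E !(rmorphXn, rmorphB, rmorph1) /= horner_mx_X.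
have [h uh hy] := H N N0; exists M.
apply: (mulrI uh); rewrite mulr0.
have hyM e : h * (y - 1) ^+ e = (y ^+ (N ^ 2) - 1) ^+ e * h.
  elim: e => [|e IHe]; first by rewrite !expr0 mul1r mulr1.
  rewrite exprSr mulrA IHe exprSr -!mulrA; congr (_ * _).
  by rewrite mulrBr mulrBl hy mulr1 mul1r.
rewrite hyM -mulnn exprM subrX1 exprMn_comm ?yN ?mul0r //.
rewrite /GRing.comm mulr_suml mulr_sumr; apply: eq_bigr => i _.
have : GRing.comm (y ^+ N) (y ^+ N ^+ i) by apply: commrX.
by move=> c; rewrite mulrBl mulrBr mulr1 mul1r c.
Qed.
End UnipotentCriterion.

(** * Commutator subgroups and locally matrix algebras *)

Section CommutatorUnits.
Variable A : unitRingType.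
Implicit Types x y u : A.

Definition comm_units x : Prop := exists g : unit_commutators A, ucval g = x.

Lemma ucvalM (g h : unit_commutators A) : ucval (g * h)%g = ucval g * ucval h.
Proof. by []. Qed.

Lemma ucvalV (g : unit_commutators A) : ucval (g^-1)%g = (ucval g)^-1.
Proof. by []. Qed.

Lemma ucval_inj : injective (@ucval A).
Proof. by move=> g h gh; apply/val_inj/val_inj. Qed.

Lemma ucval_unit (g : unit_commutators A) : ucval g \is a GRing.unit.
Proof. exact: uvalP. Qed.

Lemma comm_units1 : comm_units 1.
Proof. by exists 1%g. Qed.

Lemma comm_unitsM x y : comm_units x -> comm_units y -> comm_units (x * y).
Proof. by move=> [g <-] [h <-]; exists (g * h)%g. Qed.

Lemma comm_unitsV x : comm_units x -> comm_units x^-1.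
Proof. by move=> [g <-]; exists g^-1%g. Qed.

Lemma comm_units_unit x : comm_units x -> x \is a GRing.unit.
Proof. by move=> [g <-]; apply: ucval_unit. Qed.

Lemma comm_units_comm x y : x \is a GRing.unit -> y \is a GRing.unit ->
  comm_units (x * y * x^-1 * y^-1).
Proof.
move=> ux uy; pose g : unit_group A := UnitGroup ux; pose h : unit_group A := UnitGroup uy.
(* The library commutator of x and y is x^-1 y^-1 x y, hence the inverses. *)
have hg : [~ g^-1, h^-1]%g \in @commutator_pred (unit_group A).
  by apply/asboolP; constructor.
exists (CommutatorSubgroup hg); by rewrite /ucval /= !invrK !mulrA.
Qed.

Lemma comm_units_conj u x : u \is a GRing.unit -> comm_units x ->
  comm_units (u * x * u^-1).
Proof.
move=> uu hx; have ux := comm_units_unit hx.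
by rewrite -[u * x * _](mulrVK ux); apply: comm_unitsM => //; apply: comm_units_comm.
Qed.

(** No closure under inverses is asked of P, since the inverse of a commutator is a commutator: P is
    carried for g and g^-1 together. *)
Lemma comm_units_ind (P : A -> Prop) : P 1 ->
  (forall x y, P x -> P y -> P (x * y)) ->
  (forall x y, x \is a GRing.unit -> y \is a GRing.unit -> P (x * y * x^-1 * y^-1)) ->
  forall x, comm_units x -> P x.
Proof.
move=> P1 PM PC _ [[g gP] <-]; rewrite /ucval /=.
suff [] : P (uval g) /\ P (uval (g^-1)%g) by [].
have comm (x y : unit_group A) : P (uval [~ x, y]%g).
  have := PC (uval x)^-1 (uval y)^-1; rewrite !unitrV !uvalP !invrK => /(_ isT isT).
  by rewrite /commg /conjg /= !mulrA.
move/asboolP: gP; elim=> {g} [x y||x y _ [Px Px'] _ [Py Py']|x _ [Px Px']].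
- split; rewrite ?invgR; exact: comm.
- by rewrite invg1.
- by rewrite invgM; split; apply: PM.
- by rewrite invgK.
Qed.

End CommutatorUnits.

(** * Primeness, centroid and double centralizers *)

Section LocallyMatrixFacts.
Variables (F : fieldType) (A : unitAlgType F).
Hypothesis locA : locally_matrix A.
Implicit Types a b c e r x y z : A.

Lemma loc_mx (X : seq A) : exists m (f : {lrmorphism 'M[F]_m.+1 -> A}),
  injective f /\ forall x, x \in X -> exists M, x = f M.
Proof.
have [n [S [[m nE [f finj SE]] H]]] := locA X.
exists m, f; split=> // x /H; rewrite SE => -[M _ <-]; by exists M.
Qed.

Lemma loc_prime a b : (forall x, a * x * b = 0) -> a = 0 \/ b = 0.
Proof.
move=> H; have [m [f [finj Hf]]] := loc_mx [:: a; b].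
have [Ma aE] := Hf a (mem_head _ _).
have [Mb bE] : exists M, b = f M by apply: Hf; rewrite !inE eqxx orbT.
have [->|a0] := eqVneq a 0; first by left.
have [->|b0] := eqVneq b 0; first by right.
have nz M : f M != 0 -> M != 0 by apply: contra => /eqP->; rewrite rmorph0.
rewrite aE in a0; rewrite bE in b0.
have [x /eqP[]] := mx_prime (nz _ a0) (nz _ b0).
by apply: finj; rewrite rmorph0 -(H (f x)) aE bE -!rmorphM.
Qed.

Lemma loc_centroid a c : a != 0 -> (forall x, c * x * a = a * x * c) ->
  exists l, c = l *: a.
Proof.
move=> a0 H; have [m [f [finj Hf]]] := loc_mx [:: a; c].
have [Ma aE] := Hf a (mem_head _ _).
have [Mc cE] : exists M, c = f M by apply: Hf; rewrite !inE eqxx orbT.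
have Ma0 : Ma != 0 by apply: contraNneq a0 => M0; rewrite aE M0 rmorph0.
have [|l lE] := @mx_centroid _ _ Ma Mc Ma0.
  by move=> x; apply: finj; have := H (f x); rewrite aE cE -!rmorphM.
by exists l; rewrite cE lE linearZZ aE.
Qed.

Lemma loc_corner_center e z : e * e = e -> e * z * e = z ->
  (forall p, e * p * e = p -> p * p = 0 -> z * p = p * z) -> exists l, z = l *: e.
Proof.
move=> ee ez H; have [m [f [finj Hf]]] := loc_mx [:: e; z].
have [Me eE] := Hf e (mem_head _ _).
have [Mz zE] : exists M, z = f M by apply: Hf; rewrite !inE eqxx orbT.
have [|||l lE] := @mx_corner_center _ _ Me Mz.
- apply: finj; by rewrite -[_ *m _]/(_ * _) rmorphM /= -eE.
- by apply: finj; rewrite -[_ *m _ *m _]/(_ * _ * _) !rmorphM /= -eE -zE.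
- move=> p pE pp; apply: finj; rewrite -[Mz *m p]/(Mz * p) -[p *m Mz]/(p * Mz) !rmorphM /= -zE.
  apply: H; first by rewrite eE -!rmorphM /=; congr (f _).
  by rewrite -rmorphM -[RHS](rmorph0 f); congr (f _).
by exists l; rewrite zE lE linearZZ eE.
Qed.

(** A von Neumann inverse r0 of a is made reflexive by passing to r1 = r0 a r0; multiplying by 1 - a
    r1 on the left then kills its square and, as a^2 = 0, spoils nothing. *)
Lemma loc_square_zero_partner a : a * a = 0 ->
  exists r, [/\ a * r * a = a, r * a * r = r & r * r = 0].
Proof.
move=> aa; have [m [f [finj Hf]]] := loc_mx [:: a].
have [Ma aE] := Hf a (mem_head _ _); have [Mr MrE] := mx_regular Ma.
pose r0 := f Mr.
have ar0 : a * r0 * a = a by rewrite /r0 aE -!rmorphM; congr (f _).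
pose r1 := r0 * a * r0.
have ar1 : a * r1 * a = a by rewrite /r1 !mulrA ar0 ar0.
have ra1 : r1 * a * r1 = r1.
  transitivity (r0 * (a * r0 * a) * r0 * a * r0); first by rewrite /r1; ncring.
  by rewrite ar0 -!mulrA [a * (r0 * (a * _))]mulrA [a * r0 * (a * _)]mulrA ar0 /r1 !mulrA.
exists ((1 - a * r1) * r1); split.
- transitivity (a * r1 * a - a * a * r1 * r1 * a); first by ncring.
  by rewrite ar1 aa !mul0r subr0.
- transitivity ((1 - a * r1) * (r1 * a * r1) - (1 - a * r1) * r1 * (a * a) * r1 * r1).
    by ncring.
  by rewrite ra1 aa mulr0 !mul0r subr0.
- transitivity ((1 - a * r1) * (r1 * r1 - (r1 * a * r1) * r1)); first by ncring.
  by rewrite ra1 subrr mulr0.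
Qed.

(** Each conclusion comes from one family of test elements s. Elements a x a give z a = l a; after
    subtracting l, elements e x g and g x (r a), with e = a r and g the complementary idempotent,
    confine z' to e A (r a). There z' is determined by z' r in the corner of e, which turns out to
    be scalar. *)
Lemma loc_double_centralizer a z : a != 0 -> a * a = 0 ->
  (forall s, s * s = 0 -> s * a = a * s -> z * s = s * z) ->
  exists l m, z = l%:A + m *: a.
Proof.
move=> a0 aa Hz; have [r [ara rar rr]] := loc_square_zero_partner aa.
have [l lE] : exists l, z * a = l *: a.
  apply: loc_centroid => // x; have := Hz (a * x * a).
  have -> : a * x * a * (a * x * a) = a * x * (a * a) * x * a by ncring.
  have -> : a * x * a * a = a * x * (a * a) by ncring.
  have -> : a * (a * x * a) = a * a * x * a by ncring.
  rewrite aa !mulr0 !mul0r => /(_ erefl erefl).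
  move=> E; transitivity (z * (a * x * a)); first by rewrite !mulrA.
  by rewrite E (Hz a) // !mulrA.
pose z' := z - l%:A.
have z'a : z' * a = 0 by rewrite mulrBl lE mulr_algl subrr.
have Hz' s : s * s = 0 -> s * a = a * s -> z' * s = s * z'.
  move=> ss sa; rewrite mulrBl mulrBr (Hz s) //; congr (_ - _).
  by rewrite mulr_algl mulr_algr.
have az' : a * z' = 0 by rewrite -Hz'.
pose e := a * r; pose g := 1 - a * r - r * a.
have ga : g * a = 0.
  transitivity (a - a * r * a - r * (a * a)); first by rewrite /g; ncring.
  by rewrite ara aa mulr0 subr0 subrr.
have ag : a * g = 0.
  transitivity (a - a * r * a - (a * a) * r); first by rewrite /g; ncring.
  by rewrite ara aa mul0r subr0 subrr.
have gz' : g * z' = 0.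
  have [x|e0|//] := @loc_prime e (g * z').
  - have := Hz' (e * x * g); rewrite /e.
    have -> : a * r * x * g * (a * r * x * g) = a * r * x * (g * a) * r * x * g by ncring.
    have -> : a * r * x * g * a = a * r * x * (g * a) by ncring.
    have -> : a * (a * r * x * g) = (a * a) * r * x * g by ncring.
    rewrite ga aa !mulr0 !mul0r => /(_ erefl erefl).
    by rewrite !mulrA z'a !mul0r => <-.
  - by case/eqP: a0; rewrite -ara -/e e0 mul0r.
have z'g : z' * g = 0.
  have [x|//|f0] := @loc_prime (z' * g) (r * a).
  - have := Hz' (g * x * (r * a)).
    have -> : g * x * (r * a) * (g * x * (r * a)) = g * x * r * (a * g) * x * (r * a) by ncring.
    have -> : g * x * (r * a) * a = g * x * r * (a * a) by ncring.
    have -> : a * (g * x * (r * a)) = (a * g) * x * (r * a) by ncring.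
    rewrite ag aa !mulr0 !mul0r => /(_ erefl erefl).
    have -> : g * x * (r * a) * z' = g * x * r * (a * z') by ncring.
    by rewrite az' mulr0 => <-; rewrite !mulrA.
  - by case/eqP: a0; rewrite -ara -mulrA f0 mulr0.
have z'e : z' = e * z'.
  transitivity (e * z' + r * (a * z') + g * z'); first by rewrite /g /e; ncring.
  by rewrite az' gz' mulr0 !addr0.
have z'f : z' = z' * (r * a).
  transitivity (z' * a * r + z' * (r * a) + z' * g); first by rewrite /g; ncring.
  by rewrite z'a z'g mul0r add0r addr0.
have ea : e * a = a by [].
have ee : e * e = e by rewrite /e mulrA ara.
have [m mE] : exists m, z' * r = m *: e.
  apply: loc_corner_center => //.
    by rewrite !mulrA -z'e /e -!mulrA [r * (a * r)]mulrA rar.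
  move=> p pE pp; have pe : p * e = p by rewrite -pE -mulrA ee.
  have ep : e * p = p.
    have : e * (e * p * e) = e * e * p * e by ncring.
    by rewrite ee pE.
  have pr : p * r = 0 by rewrite -pe /e -!mulrA rr !mulr0.
  have ap : a * p = 0 by rewrite -ep /e !mulrA aa !mul0r.
  (* This is p copied into both diagonal blocks, so that it commutes with a. *)
  have := Hz' (p + r * p * a).
  have -> : (p + r * p * a) * (p + r * p * a) =
    p * p + (p * r) * p * a + r * p * (a * p) + r * (p * (a * r) * p * a) by ncring.
  have -> : (p + r * p * a) * a = p * a + r * p * (a * a) by ncring.
  have -> : a * (p + r * p * a) = a * p + a * r * p * a by ncring.
  rewrite pr ap aa -/e pe ep !pp !(mulr0, mul0r) !addr0 add0r => /(_ erefl erefl).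
  have -> : z' * (p + r * p * a) = z' * p + z' * r * p * a by ncring.
  have -> : (p + r * p * a) * z' = p * z' + r * p * (a * z') by ncring.
  rewrite az' mulr0 addr0 -{1}ep /e !mulrA z'a !mul0r add0r => /(congr1 (fun t => t * r)).
  by rewrite -!(mulrA _ a r) -/e -(mulrA _ p e) pe.
exists l, m; rewrite -[z](subrK l%:A) addrC -/z' z'f mulrA mE.
by rewrite -scalerAl ea.
Qed.

End LocallyMatrixFacts.

(** * Square-zero elements under a group isomorphism *)

(** The elements a and r are the off-diagonal units of a 2 x 2 block with diagonal idempotents a r
    and r a; the block need not have the identity of R. *)
Definition sl2_pair (R : nzRingType) (a r : R) : Prop :=
  [/\ a * a = 0, r * r = 0, a * r * a = a & r * a * r = r].

Section Sl2.
Variables (F : fieldType) (A : unitAlgType F).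
Hypotheses (F2 : 2%:R != 0 :> F) (F3 : 3%:R != 0 :> F).
Implicit Types (a r x : A) (s : F).

Lemma square_zero_unit a : a * a = 0 -> 1 + a \is a GRing.unit.
Proof. by move=> aa; apply: (@unitr_1D_nilpotent _ _ 2); rewrite expr2. Qed.

Lemma square_zero_mul a : a * a = 0 -> (1 + a) * (1 - a) = 1.
Proof.
by move=> aa; transitivity (1 - a * a); [ncring | rewrite aa subr0].
Qed.

Lemma square_zero_inv a : a * a = 0 -> (1 + a)^-1 = 1 - a.
Proof.
move=> aa; apply: (mulrI (square_zero_unit aa)).
by rewrite divrr ?square_zero_unit // square_zero_mul.
Qed.

Lemma square_zeroZ s a : a * a = 0 -> (s *: a) * (s *: a) = 0.
Proof. by move=> aa; rewrite -scalerAl -scalerAr aa !scaler0. Qed.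

Lemma square_zero_exp a k : a * a = 0 -> (1 + a) ^+ k = 1 + a *+ k.
Proof.
move=> aa; elim: k => [|k IH]; first by rewrite addr0.
rewrite exprS IH mulrDl mul1r mulrDr mulr1 mulrnAr aa mul0rn addr0 -addrA.
by rewrite mulrSr.
Qed.

Lemma sl2_pairC a r : sl2_pair a r -> sl2_pair r a.
Proof. by case=> ? ? ? ?; split. Qed.

Lemma sl2_pairZ s a r : s != 0 -> sl2_pair a r -> sl2_pair (s *: a) (s^-1 *: r).
Proof.
move=> s0 [aa rr ara rar]; split.
- exact: square_zeroZ.
- exact: square_zeroZ.
- rewrite -!(scalerAl, scalerAr) !scalerA ara.
  by congr (_ *: _); field.
- rewrite -!(scalerAl, scalerAr) !scalerA rar.
  by congr (_ *: _); field.
Qed.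

Lemma sl2_pairN a r : sl2_pair a r -> sl2_pair (- a) (- r).
Proof.
by case=> aa rr ara rar; split; rewrite ?mulrNN // mulrN ?ara ?rar.
Qed.

(** On the block of the pair this is the matrix with rows (0, 1) and (-1, 0), and on the complement
    the identity. Its two factorizations into unipotents form the braid relation. *)
Definition weyl a r : A := 1 - a * r - r * a + a - r.

Lemma weylE a r : sl2_pair a r -> (1 + a) * (1 - r) * (1 + a) = weyl a r.
Proof.
case=> aa rr ara rar.
transitivity (weyl a r + (a - a * r * a) + a * a); first by rewrite /weyl; ncring.
by rewrite ara aa subrr !addr0.
Qed.

Lemma weylE' a r : sl2_pair a r -> (1 - r) * (1 + a) * (1 - r) = weyl a r.
Proof.
case=> aa rr ara rar.
transitivity (weyl a r + (r * a * r - r) + r * r); first by rewrite /weyl; ncring.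
by rewrite rar rr subrr !addr0.
Qed.

(** The matrix diag(s, s^-1) on the block, in Steinberg's form w(s) w(1)^-1, which exhibits it as a
    product of unipotents. *)
Definition torus s a r : A := weyl (s *: a) (s^-1 *: r) * weyl (- a) (- r).

Lemma torusE s a r : s != 0 -> sl2_pair a r ->
  torus s a r = 1 - a * r - r * a + s *: (a * r) + s^-1 *: (r * a).
Proof.
move=> s0 [aa rr ara rar].
rewrite /torus /weyl -!scalerAl -!scalerAr !scalerA mulfV // mulVf // !scale1r.
have scal (u : F) : exists2 t : A, forall x, u *: x = t * x & forall x, x * t = t * x.
  by exists u%:A => x; rewrite ?mulr_algr mulr_algl.
have [t tE tC] := scal s; have [t' t'E t'C] := scal s^-1; rewrite !tE !t'E.
pose g := 1 - a * r - r * a.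
have ga : g * a = 0.
  transitivity (a - a * r * a - r * (a * a)); first by rewrite /g; ncring.
  by rewrite ara aa mulr0 subr0 subrr.
have ag : a * g = 0.
  transitivity (a - a * r * a - (a * a) * r); first by rewrite /g; ncring.
  by rewrite ara aa mul0r subr0 subrr.
have gr : g * r = 0.
  transitivity (r - r * a * r - a * (r * r)); first by rewrite /g; ncring.
  by rewrite rar rr mulr0 subr0 subrr.
have rg : r * g = 0.
  transitivity (r - r * a * r - (r * r) * a); first by rewrite /g; ncring.
  by rewrite rar rr mul0r subr0 subrr.
have gg : g * g = g.
  transitivity (g - g * a * r - g * r * a); first by rewrite {2}/g; ncring.
  by rewrite ga gr !mul0r !subr0.
transitivity (g * g + (g * r - g * a) + t * (a * g) - t * (a * a) + t * (a * r)
  - t' * (r * g) + t' * (r * a) - t' * (r * r)); first by rewrite /g; ncring.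
by rewrite ga ag gr rg gg aa rr !mulr0 !subr0 !addr0.
Qed.

Lemma torus_conj s a r : s != 0 -> sl2_pair a r ->
  torus s a r * a = (s ^+ 2) *: (a * torus s a r).
Proof.
move=> s0 ar; rewrite torusE //; case: ar => aa rr ara rar.
have -> : a * (1 - a * r - r * a + s *: (a * r) + s^-1 *: (r * a)) = s^-1 *: a.
  rewrite !(mulrDr, mulrN) -!scalerAr !mulrA aa ara mul0r mulr1 scaler0.
  by rewrite subr0 subrr !add0r.
rewrite !(mulrDl, mulNr) -!scalerAl -!mulrA aa mulrA ara mulr0 mul1r scaler0.
by rewrite subrr subr0 !addr0 add0r scalerA; congr (_ *: _); field.
Qed.

Lemma torus_unit s a r : s != 0 -> sl2_pair a r -> torus s a r \is a GRing.unit.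
Proof.
have W b c : sl2_pair b c -> weyl b c \is a GRing.unit.
  move=> bc; rewrite -weylE //; case: bc => bb cc _ _.
  have uc : 1 - c \is a GRing.unit by apply: square_zero_unit; rewrite mulrNN.
  have ub := square_zero_unit bb.
  by rewrite unitrMl // unitrMl.
move=> s0 ar; have u := W _ _ (sl2_pairN ar).
by rewrite unitrMl //; apply/W/sl2_pairZ.
Qed.

(** With c = a/3 and t the torus element at 2, conjugation by t turns 1 + c into 1 + 4 c, and the
    commutator is 1 + 3 c. *)
Lemma comm_units_1D_pair a r : sl2_pair a r -> comm_units (1 + a).
Proof.
move=> ar; have [aa _ _ _] := ar; pose t := torus 2%:R a r.
have ut : t \is a GRing.unit by apply: torus_unit.
pose c := 3%:R^-1 *: a; have cc : c * c = 0 by apply: square_zeroZ.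
have -> : 1 + a = t * (1 + c) * t^-1 * (1 + c)^-1; last first.
  by apply: comm_units_comm => //; apply: square_zero_unit.
have -> : t * (1 + c) * t^-1 = 1 + 4%:R *: c.
  rewrite mulrDr mulr1 mulrDl divrr // /c -scalerAr torus_conj // -!scalerAl mulrK //.
  by rewrite !scalerA; congr (_ + _ *: _); ring.
rewrite square_zero_inv // mulrDl mul1r mulrBr mulr1 -scalerAl cc scaler0 subr0.
rewrite -addrA; congr (_ + _); rewrite addrC.
rewrite -{2}[c]scale1r -scalerBl /c scalerA.
have -> : 4%:R - 1 = 3%:R :> F by ring.
by rewrite mulfV // scale1r.
Qed.

Lemma comm_units_torus s a r : s != 0 -> sl2_pair a r -> comm_units (torus s a r).
Proof.
have W b c : sl2_pair b c -> comm_units (weyl b c).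
  move=> bc; rewrite -weylE //; have ub := comm_units_1D_pair bc.
  apply: comm_unitsM => //; apply: comm_unitsM => //.
  by apply: (@comm_units_1D_pair _ (- b)); apply/sl2_pairN/sl2_pairC.
by move=> s0 ar; apply: comm_unitsM; apply: W; [apply: sl2_pairZ | apply: sl2_pairN].
Qed.

Lemma comm_units_weyl a r : sl2_pair a r -> comm_units (weyl a r).
Proof.
move=> ar; rewrite -weylE //; have ua := comm_units_1D_pair ar.
apply: comm_unitsM => //; apply: comm_unitsM => //.
by apply: (@comm_units_1D_pair _ (- a)); apply/sl2_pairN/sl2_pairC.
Qed.

Hypothesis locA : locally_matrix A.

Lemma square_zero_pair a : a * a = 0 -> exists r, sl2_pair a r.
Proof.
by move=> aa; have [r [ara rar rr]] := loc_square_zero_partner locA aa; exists r; split.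
Qed.

Lemma comm_units_1D a : a * a = 0 -> comm_units (1 + a).
Proof. by move=> /square_zero_pair[r /comm_units_1D_pair]. Qed.

End Sl2.

Section Unipotent.
Variables (F : fieldType) (B : unitAlgType F).
Hypothesis locB : locally_matrix B.

Lemma unipotent_criterion (y : B) : y \is a GRing.unit ->
  (forall k : nat, k%:R != 0 :> F ->
    exists2 h, h \is a GRing.unit & h * y = y ^+ (k ^ 2) * h) ->
  (forall p, p \in [pchar F] -> y ^+ p = 1) ->
  exists M, (y - 1) ^+ M = 0.
Proof.
move=> uy H Hp; have [[p pF]|F0] := pselect (exists p, p \in [pchar F]).
  exists p; have pB : p \in [pchar B] by rewrite pchar_lalg.
  have := pFrobenius_autB_comm pB (commr1 y); rewrite !pFrobenius_autE => ->.
  by rewrite Hp // expr1n subrr.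
have [m [f [finj Hf]]] := loc_mx locB [:: y].
have [Y yE] := Hf y (mem_head _ _); rewrite yE in uy H *.
apply: unipotent_of_conj_squares finj uy _ => k k0; apply: H.
by apply/negP => kF; apply: F0; apply: natf0_pchar kF.
Qed.
End Unipotent.

(* An isomorphism of commutator subgroups, as a pair of mutually inverse total
   functions whose values outside the subgroups are junk. *)
Record group_iso (A B : unitRingType) (phi : A -> B) (phi' : B -> A) : Prop := GroupIso {
  gi_in : forall x, comm_units x -> comm_units (phi x);
  gi_in' : forall y, comm_units y -> comm_units (phi' y);
  gi_mul : forall x y, comm_units x -> comm_units y -> phi (x * y) = phi x * phi y;
  gi_K : forall x, comm_units x -> phi' (phi x) = x;
  gi_K' : forall y, comm_units y -> phi (phi' y) = y }.

Lemma comm_unitsX (R : unitRingType) (x : R) k : comm_units x -> comm_units (x ^+ k).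
Proof.
move=> hx; elim: k => [|k IH]; first exact: comm_units1.
by rewrite exprS; apply: comm_unitsM.
Qed.

Section GroupIsoTheory.
Variables (A B : unitRingType) (phi : A -> B) (phi' : B -> A).
Hypothesis iso : group_iso phi phi'.

Lemma group_iso_sym : group_iso phi' phi.
Proof.
case: iso => i i' M K K'; split=> // u v hu hv.
have [ju jv] := (i' u hu, i' v hv).
by rewrite -{1}(K' u) // -{1}(K' v) // -M // K //; apply: comm_unitsM.
Qed.

Lemma gi_unit x : comm_units x -> phi x \is a GRing.unit.
Proof. by move=> /(gi_in iso)/comm_units_unit. Qed.

Lemma gi_one : phi 1 = 1.
Proof.
have h1 := comm_units1 A; have u := gi_unit h1.
by apply: (mulrI u); rewrite -(gi_mul iso) // !mulr1.
Qed.

Lemma gi_exp x k : comm_units x -> phi (x ^+ k) = phi x ^+ k.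
Proof.
move=> hx; elim: k => [|k IH]; first by rewrite gi_one.
by rewrite !exprS (gi_mul iso) ?IH //; apply: comm_unitsX.
Qed.

Lemma gi_inj x y : comm_units x -> comm_units y -> phi x = phi y -> x = y.
Proof. by move=> hx hy E; rewrite -(gi_K iso hx) E (gi_K iso). Qed.
End GroupIsoTheory.

(** * Images of square-zero elements *)

Section SquareZero.
Variables (F : fieldType) (A B : unitAlgType F) (phi : A -> B) (phi' : B -> A).
Hypotheses (F2 : 2%:R != 0 :> F) (F3 : 3%:R != 0 :> F).
Hypotheses (locA : locally_matrix A) (locB : locally_matrix B).
Hypothesis iso : group_iso phi phi'.
Implicit Types (a r s x : A).

Let one1D a : a * a = 0 -> comm_units (1 + a) := @comm_units_1D F A F2 F3 locA a.

Lemma torus_exp a r k : k%:R != 0 :> F -> sl2_pair a r ->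
  torus k%:R a r * (1 + a) = (1 + a) ^+ (k ^ 2) * torus k%:R a r.
Proof.
move=> k0 ar; have [aa _ _ _] := ar; rewrite square_zero_exp // mulrDr mulr1 mulrDl mul1r.
by rewrite torus_conj // -natrX scaler_nat mulrnAl.
Qed.

Lemma unipotent_image a : a * a = 0 -> exists M, (phi (1 + a) - 1) ^+ M = 0.
Proof.
move=> aa; have [r ar] := square_zero_pair locA aa; have ha := one1D aa.
apply: (unipotent_criterion locB); first exact: (gi_unit iso).
  move=> k k0; have ht := comm_units_torus F2 F3 k0 ar.
  exists (phi (torus k%:R a r)); first exact: (gi_unit iso).
  by rewrite -(gi_exp iso) // -!(gi_mul iso) ?torus_exp //; apply: comm_unitsX.
move=> p pF; rewrite -(gi_exp iso) // square_zero_exp // -mulr_natr.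
have pA : p \in [pchar A] by rewrite pchar_lalg.
by rewrite pcharf0 // mulr0 addr0 (gi_one iso).
Qed.

(** The quotient left after removing the factor -2 X^2 and the constant 6 from the difference of the
    two sides. At a nilpotent b the factor 6 + b (...) stays invertible. *)
Let quartic_poly : {poly F} :=
  18%:R + 25%:R * 'X + 20%:R * 'X ^+ 2 + 9%:R * 'X ^+ 3 + 2%:R * 'X ^+ 4.

(* With [b1 := (1 + b)^4 - 1], the two sides of the hypothesis agree up to
   degree 1 in [b] and differ by [12 b^2] in degree 2. *)
Lemma quartic_square_zero (b : B) M : b ^+ M = 0 ->
  let b1 := (1 + b) ^+ 4 - 1 in
  (1 + b + b * b) ^+ 4 = 1 + b1 + b1 * b1 -> b * b = 0.
Proof.
move=> bM b1 E; have [h hX] : exists h : {rmorphism {poly F} -> B}, h 'X = b.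
  by exists (horner_alg b); rewrite /= horner_algX.
pose P : {poly F} := (1 + 'X + 'X * 'X) ^+ 4
  - (1 + ((1 + 'X) ^+ 4 - 1) + ((1 + 'X) ^+ 4 - 1) * ((1 + 'X) ^+ 4 - 1)).
have hP : h P = 0.
  rewrite /P !(rmorphB, rmorphD, rmorphM, rmorphXn, rmorph1) hX.
  by apply/eqP; rewrite subr_eq0; apply/eqP.
have PE : P = (- 2%:R) * (6%:R + 'X * quartic_poly) * ('X * 'X).
  by rewrite /P /quartic_poly; ring.
have six : 6%:R != 0 :> F by rewrite (natrM _ 2 3) mulf_neq0.
pose w := h (6%:R + 'X * quartic_poly).
have uw : w \is a GRing.unit.
  rewrite /w rmorphD rmorphM hX rmorph_nat.
  have u6 : (6%:R : B) \is a GRing.unit.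
    by rewrite -(rmorph_nat (in_alg B)) rmorph_unit // unitfE.
  have -> : 6%:R + b * h quartic_poly = 6%:R * (1 + 6%:R^-1 *: (b * h quartic_poly)).
    rewrite mulrDr mulr1; congr (_ + _).
    by rewrite -scalerAr mulr_natl -scaler_nat scalerA mulVf ?scale1r.
  rewrite unitrMr //; apply: (@unitr_1D_nilpotent _ _ M).
  rewrite exprZn exprMn_comm ?bM ?mul0r ?scaler0 //.
  by rewrite -hX /GRing.comm -!rmorphM mulrC.
have u2 : (- 2%:R : B) \is a GRing.unit.
  by rewrite unitrN -(rmorph_nat (in_alg B)) rmorph_unit // unitfE.
apply: (mulrI uw); apply: (mulrI u2); rewrite !mulr0 -hP PE.
by rewrite !rmorphM rmorphN hX rmorph_nat mulrA.
Qed.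

Lemma square_zero_image a : a * a = 0 -> (phi (1 + a) - 1) * (phi (1 + a) - 1) = 0.
Proof.
move=> aa; have [->|a0] := eqVneq a 0.
  by rewrite addr0 (gi_one iso) subrr mul0r.
have ha := one1D aa; have [r ar] := square_zero_pair locA aa.
have [M bM] := unipotent_image aa.
set y := phi (1 + a) in bM *.
have [b bE] : exists b, b = y - 1 by exists (y - 1).
rewrite -bE in bM *; have yE : y = 1 + b by rewrite bE addrC subrK.
have hy : comm_units y := gi_in iso ha.
(* The unit c need not lie in the commutator subgroup; normality is enough for z = c y c^-1 to lie
   there and to have a preimage x. *)
have [c uc cb] : exists2 c, c \is a GRing.unit & c * b = (b + b * b) * c.
  have [m [f [finj Hf]]] := loc_mx locB [:: b].
  have [Mb bM'] := Hf b (mem_head _ _).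
  have MbM : Mb ^+ M = 0 by apply: finj; rewrite rmorphXn /= -bM' bM rmorph0.
  have [C uC CE] := conj_nilpotent MbM.
  exists (f C); first exact: rmorph_unit.
  by rewrite bM' -!(rmorphM, rmorphD) CE.
pose z := 1 + b + b * b.
have cy : c * y = z * c 
  by rewrite {1}yE mulrDr mulr1 cb; rewrite /z; ncring.
have zE : z = c * y * c^-1 by rewrite cy mulrK.
have hz : comm_units z by rewrite zE; apply: comm_units_conj.
pose x := phi' z; have hx : comm_units x := gi_in' iso hz.
have xz : phi x = z := gi_K' iso hz.
(* If s commutes with a, then the image of 1 + s commutes with y, hence with the polynomial z in b;
   pulled back, x commutes with s. *)
have [l [m xE]] : exists l m, x = l%:A + m *: a.
  apply: (loc_double_centralizer locA a0 aa) => s ss sa.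
  have hs := one1D ss.
  suff : x * (1 + s) = (1 + s) * x by rewrite mulrDr mulrDl mulr1 mul1r => /addrI.
  apply: (gi_inj iso); [exact: comm_unitsM|exact: comm_unitsM|].
  rewrite !(gi_mul iso) // xz.
  have sy : y * phi (1 + s) = phi (1 + s) * y.
    rewrite -!(gi_mul iso) //; congr phi.
    by transitivity (1 + a + s + a * s); [ncring | rewrite -sa; ncring].
  have sb : b * phi (1 + s) = phi (1 + s) * b by rewrite bE mulrBl mulrBr sy mulr1 mul1r.
  have sbb : b * b * phi (1 + s) = phi (1 + s) * (b * b).
    exact/esym/(commrM (esym sb) (esym sb)).
  by rewrite /z !mulrDl !mulrDr mul1r mulr1 sb sbb.
(* Since z is conjugate to y under c, the conjugacies of y with its powers carry over to z, and
   [phi'] takes them to x. Unipotence then forces l = 1. *)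
have [M' xM] : exists M, (x - 1) ^+ M = 0.
  apply: (unipotent_criterion locA); first exact: comm_units_unit.
    move=> k k0; have ht := comm_units_torus F2 F3 k0 ar.
    pose t := phi (torus k%:R a r).
    have ty : t * y = y ^+ (k ^ 2) * t.
      by rewrite -(gi_exp iso) // -!(gi_mul iso) ?torus_exp //; apply: comm_unitsX.
    have hct : comm_units (c * t * c^-1) by apply: comm_units_conj => //; apply: (gi_in iso).
    exists (phi' (c * t * c^-1)); first by apply/comm_units_unit/(gi_in' iso).
    have iso' := group_iso_sym iso.
    rewrite /x -(gi_exp iso') // -!(gi_mul iso') //; last exact: comm_unitsX.
    congr phi'; rewrite {1}zE !mulrA mulrVK // -(mulrA c t y) ty.
    have -> : z ^+ (k ^ 2) = c * y ^+ (k ^ 2) * c^-1.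
      apply: (mulIr uc); rewrite mulrVK //.
      elim: (expn k 2) => [|e IH]; first by rewrite mulr1 mul1r.
      by rewrite exprS -mulrA IH !mulrA -cy -!mulrA -exprS.
    by rewrite !mulrA mulrVK.
  move=> p pF; apply: (gi_inj iso) => //; [exact: comm_unitsX|exact: comm_units1|].
  rewrite (gi_exp iso) // xz (gi_one iso).
  have yp : y ^+ p = 1.
    rewrite -(gi_exp iso) // square_zero_exp // -mulr_natr.
    have pA : p \in [pchar A] by rewrite pchar_lalg.
    by rewrite pcharf0 // mulr0 addr0 (gi_one iso).
  apply: (mulIr uc); rewrite mul1r -[in RHS](mulr1 c) -yp.
  elim: (p) => [|e IH]; first by rewrite mulr1 mul1r.
  by rewrite exprS -mulrA IH !mulrA -cy -!mulrA -exprS.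
have l1 : l = 1.
  have H e : (x - 1) ^+ e * a = (l - 1) ^+ e *: a.
    elim: e => [|e IH]; first by rewrite mul1r scale1r.
    have xa : (x - 1) * a = (l - 1) *: a.
      by rewrite mulrBl mul1r xE mulrDl mulr_algl -scalerAl aa scaler0 addr0 scalerBl scale1r.
    by rewrite exprSr -mulrA xa -scalerAr IH scalerA -exprS.
  have := H M'; rewrite xM mul0r => /esym/eqP.
  by rewrite scaler_eq0 (negbTE a0) orbF expf_eq0 subr_eq0 => /andP[_ /eqP].
(* One torus element, at 2, raises both 1 + a and x = 1 + m a to the fourth power. As z = 1 + b +
   b^2, this gives z^4 = 1 + b1 + b1^2 with b1 = y^4 - 1. *)
have [t ht [ty tz]] : exists2 t : B, t \is a GRing.unit & t * y = y ^+ 4 * t /\ t * z = z ^+ 4 * t.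
  have ht := comm_units_torus F2 F3 F2 ar.
  exists (phi (torus 2%:R a r)); first exact: (gi_unit iso).
  rewrite -xz -!(gi_exp iso) // -!(gi_mul iso) //; try exact: comm_unitsX.
  split; congr phi; first exact: torus_exp.
  have ma : (m *: a) * (m *: a) = 0 by apply: square_zeroZ.
  rewrite xE l1 scale1r square_zero_exp // mulrDr mulr1 mulrDl mul1r.
  rewrite -scalerAr torus_conj // scalerA mulrnAl -scaler_nat -scalerAl scalerA.
  by congr (_ + _ *: _); ring.
apply: (quartic_square_zero bM); apply: (mulIr ht); rewrite -/z -tz.
have tb : t * b = (y ^+ 4 - 1) * t.
  by rewrite bE mulrBr mulr1 ty mulrBl mul1r.
rewrite -yE; set b1 := y ^+ 4 - 1 in tb *.
have -> : t * z = t + t * b + t * b * b by rewrite /z; ncring.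
by rewrite tb -(mulrA b1) tb; ncring.
Qed.

End SquareZero.

Definition unip_part (A B : nzRingType) (phi : A -> B) (a : A) : B := phi (1 + a) - 1.

Section UnipotentPart.
Variables (F : fieldType) (A B : unitAlgType F) (phi : A -> B) (phi' : B -> A).
Hypotheses (F2 : 2%:R != 0 :> F) (F3 : 3%:R != 0 :> F).
Hypotheses (locA : locally_matrix A) (locB : locally_matrix B).
Hypothesis iso : group_iso phi phi'.
Implicit Types (a b r s x y : A).
Local Notation psi := (unip_part phi).

Let one1D a : a * a = 0 -> comm_units (1 + a) := @comm_units_1D F A F2 F3 locA a.

Local Ltac cu := solve [by repeat first [apply: comm_unitsM | apply: one1D]].

Lemma unip_partE a : phi (1 + a) = 1 + psi a.
Proof. by rewrite /unip_part [RHS]addrC subrK. Qed.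

Lemma unip_part_sq a : a * a = 0 -> psi a * psi a = 0.
Proof. exact: square_zero_image F2 F3 locA locB iso a. Qed.

Lemma unip_part0 : psi 0 = 0.
Proof. by rewrite /unip_part addr0 (gi_one iso) subrr. Qed.

Lemma unip_part_inj a b : a * a = 0 -> b * b = 0 -> psi a = psi b -> a = b.
Proof.
rewrite /unip_part => aa bb /addIr E; apply: (@addrI _ 1).
exact: (gi_inj iso (one1D aa) (one1D bb) E).
Qed.

Lemma unip_part_comm a b : a * a = 0 -> b * b = 0 -> a * b = b * a ->
  psi a * psi b = psi b * psi a.
Proof.
move=> aa bb ab; have : phi (1 + a) * phi (1 + b) = phi (1 + b) * phi (1 + a).
  rewrite -!(gi_mul iso); try cu; congr phi.
  by transitivity (1 + a + b + a * b); [ncring | rewrite ab; ncring].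
rewrite !unip_partE => E; apply/eqP; rewrite -subr_eq0; apply/eqP.
transitivity ((1 + psi a) * (1 + psi b) - (1 + psi b) * (1 + psi a)); first by ncring.
by rewrite E subrr.
Qed.

Lemma double_eq0 (x : B) : x + x = 0 -> x = 0.
Proof.
move=> xx; have : 2%:R *: x = 0 by rewrite scaler_nat mulr2n.
by move=> /eqP; rewrite scaler_eq0 (negbTE F2) => /eqP.
Qed.

(** With p and q the two images, which commute and have square zero, psi(a + b) = p + q + p q
    squares to 2 p q; it also squares to zero because a + b does. *)
Lemma unip_part_orth a b : a * a = 0 -> b * b = 0 -> a * b = 0 -> b * a = 0 ->
  psi (a + b) = psi a + psi b /\ psi a * psi b = 0.
Proof.
move=> aa bb ab ba; have pq := unip_part_comm aa bb (etrans ab (esym ba)).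
have sq : (a + b) * (a + b) = 0 by rewrite mulrDl !mulrDr aa bb ab ba !addr0.
have E : psi (a + b) = psi a + psi b + psi a * psi b.
  apply: (@addrI _ 1); rewrite -unip_partE.
  have -> : 1 + (a + b) = (1 + a) * (1 + b).
    by transitivity (1 + a + b + a * b); [rewrite ab addr0 addrA | ncring].
  rewrite (gi_mul iso); try cu; rewrite !unip_partE; ncring.
have pp := unip_part_sq aa; have qq := unip_part_sq bb.
suff pq0 : psi a * psi b = 0 by rewrite E pq0 addr0.
have := unip_part_sq sq; rewrite E; set p := psi a in pp pq *; set q := psi b in qq pq *.
have pqp : p * q * p = 0 by rewrite pq -mulrA pp mulr0.
have -> : (p + q + p * q) * (p + q + p * q) = p * p * (1 + q) + (p * q + q * p)
   + q * q + q * p * q + p * q * p + p * (q * q) + p * q * p * q by ncring.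
rewrite -pq pqp pp -(mulrA p q q) qq mulr0 !mul0r !addr0 add0r.
exact: double_eq0.
Qed.

Lemma unip_partD a b : a * a = 0 -> b * b = 0 -> a * b = 0 -> b * a = 0 ->
  psi (a + b) = psi a + psi b.
Proof. by move=> aa bb ab ba; case: (unip_part_orth aa bb ab ba). Qed.

Lemma unip_part_mul0 a b : a * a = 0 -> b * b = 0 -> a * b = 0 -> b * a = 0 ->
  psi a * psi b = 0.
Proof. by move=> aa bb ab ba; case: (unip_part_orth aa bb ab ba). Qed.

Lemma unip_partN a : a * a = 0 -> psi (- a) = - psi a.
Proof.
move=> aa; have naa : - a * - a = 0 by rewrite mulrNN.
apply/eqP; rewrite -subr_eq0 opprK; apply/eqP.
by rewrite -unip_partD ?addNr ?unip_part0 // ?mulNr ?mulrN aa oppr0.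
Qed.

(** As y x = 0, the group commutator of 1 + x and 1 + y is 1 + x y. Orthogonality of x y to x and to
    y removes the mixed terms on the B side. *)
Lemma unip_part_bracket x y : x * x = 0 -> y * y = 0 -> y * x = 0 ->
  psi (x * y) = psi x * psi y - psi y * psi x.
Proof.
move=> xx yy yx.
have sq : x * y * (x * y) = 0 by rewrite !mulrA -(mulrA x y) yx mulr0 mul0r.
have Xq : psi (x * y) * psi y = 0.
  by apply: unip_part_mul0; rewrite // ?mulrA ?yx ?mul0r // -mulrA yy mulr0.
have Xp : psi (x * y) * psi x = 0.
  by apply: unip_part_mul0; rewrite // ?mulrA ?xx ?mul0r // -mulrA yx mulr0.
have : phi (1 + x * y) * phi (1 + y) * phi (1 + x) = phi (1 + x) * phi (1 + y).
  rewrite -!(gi_mul iso); try cu.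
  congr phi; transitivity ((1 + x) * (1 + y) + (1 + x * y) * (y * x) + x * (y * y) + x * (y * x)).
    by ncring.
  by rewrite yx yy !mulr0 !addr0.
rewrite !unip_partE; set p := psi x in Xp *; set q := psi y in Xq *; set X := psi _ in Xp Xq *.
move=> E; apply/eqP; rewrite -subr_eq0; apply/eqP.
transitivity ((1 + X) * (1 + q) * (1 + p) - (1 + p) * (1 + q) - X * p - X * q * (1 + p)).
  by ncring.
by rewrite E Xp Xq subrr mul0r !subr0.
Qed.

(* With p = psi a and q = psi r, the braid relation for (a, r) only gives
   p - pqp = qpq - q; for (2a, r/2) the two sides scale by 2 and 1/2, so both
   vanish. *)
Lemma unip_part_pair a r : sl2_pair a r -> sl2_pair (psi a) (psi r).
Proof.
have braid b c : sl2_pair b c -> psi b + psi c =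
    psi b * psi c * psi b + psi c * psi b * psi c.
  move=> bc; have [bb cc _ _] := bc.
  have pp := unip_part_sq bb; have qq := unip_part_sq cc.
  have ncc : - c * - c = 0 by rewrite mulrNN.
  have : phi ((1 + b) * (1 - c) * (1 + b)) = phi ((1 - c) * (1 + b) * (1 - c)).
    by rewrite weylE // weylE'.
  rewrite !(gi_mul iso); try cu; rewrite !unip_partE unip_partN //.
  set p := psi b in pp *; set q := psi c in qq *.
  move=> E; apply/eqP; rewrite -subr_eq0; apply/eqP.
  transitivity ((1 + p) * (1 - q) * (1 + p) - (1 - q) * (1 + p) * (1 - q)
    - p * p + q * q); first by ncring.
  by rewrite E pp qq subrr subr0 addr0.
move=> ar; have [aa rr ara rar] := ar.
have pp := unip_part_sq aa; have qq := unip_part_sq rr.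
have E1 := braid _ _ ar.
have E2 := braid _ _ (sl2_pairZ F2 ar).
have p2 : psi (2%:R *: a) = psi a + psi a.
  by rewrite scaler_nat mulr2n unip_partD.
have q2 : psi r = psi (2%:R^-1 *: r) + psi (2%:R^-1 *: r).
  have hr : 2%:R^-1 *: r + 2%:R^-1 *: r = r.
    by rewrite -scalerDl -[RHS]scale1r; congr (_ *: _); field.
  by rewrite -{1}hr unip_partD; try exact: square_zeroZ.
rewrite p2 in E2.
have cc : psi (2%:R^-1 *: r) * psi (2%:R^-1 *: r) = 0 by apply/unip_part_sq/square_zeroZ.
rewrite {}q2 {p2} in E1 qq *.
set p := psi a in pp E1 E2 *; set c := psi _ in cc E1 E2 *.
have three (z : B) : z + z + z = 0 -> z = 0.
  move=> xx; have : 3%:R *: z = 0 by rewrite scaler_nat mulrS mulr2n addrA.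
  by move=> /eqP; rewrite scaler_eq0 (negbTE F3) => /eqP.
have D1 : p + (c + c) - (p * (c + c) * p + (c + c) * p * (c + c)) = 0.
  by rewrite E1 subrr.
have D2 : p + p + c - ((p + p) * c * (p + p) + c * (p + p) * c) = 0.
  by rewrite E2 subrr.
split=> //; apply/eqP; rewrite eq_sym -subr_eq0; apply/eqP/three.
  transitivity ((p + p + c - ((p + p) * c * (p + p) + c * (p + p) * c))
    + (p + p + c - ((p + p) * c * (p + p) + c * (p + p) * c))
    - (p + (c + c) - (p * (c + c) * p + (c + c) * p * (c + c)))); first by ncring.
  by rewrite D1 D2 !addr0 subrr.
transitivity ((1 + 1) * ((1 + 1) * (p + (c + c) - (p * (c + c) * p + (c + c) * p * (c + c)))
    - (p + p + c - ((p + p) * c * (p + p) + c * (p + p) * c)))); first by ncring.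
by rewrite D1 D2 !(mulr0, subrr).
Qed.

Lemma unip_part_weyl a r : sl2_pair a r -> phi (weyl a r) = weyl (psi a) (psi r).
Proof.
move=> ar; have [aa rr _ _] := ar; have rr' : - r * - r = 0 by rewrite mulrNN.
rewrite -weylE // -weylE; last exact: unip_part_pair.
by rewrite !(gi_mul iso); try cu; rewrite !unip_partE unip_partN.
Qed.

End UnipotentPart.

(** * Matrix units *)

Record matrix_units (R : nzRingType) n (e : 'I_n -> 'I_n -> R) : Prop := MatrixUnits {
  mu_mul : forall i j k, e i j * e j k = e i k;
  mu_mul0 : forall i j k l, j != k -> e i j * e k l = 0;
  mu_sum : \sum_i e i i = 1 }.

Definition peirce (R : nzRingType) n (e : 'I_n -> 'I_n -> R) i j (x : R) : Prop :=
  e i i * x = x /\ x * e j j = x.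

Section Peirce.
Variables (R : nzRingType) (n : nat) (e : 'I_n -> 'I_n -> R).
Hypothesis mu : matrix_units e.
Implicit Types (i j k l : 'I_n) (x y : R).

Lemma peirce_unit i j : peirce e i j (e i j).
Proof. by split; rewrite (mu_mul mu). Qed.

Lemma peirceM i j k x y : peirce e i j x -> peirce e j k y -> peirce e i k (x * y).
Proof. by move=> [ix xj] [jy yk]; split; rewrite ?mulrA ?ix // -mulrA yk. Qed.

Lemma peirce_mul0 i j k l x y : j != k -> peirce e i j x -> peirce e k l y -> x * y = 0.
Proof.
move=> jk [_ xj] [ky _]; rewrite -xj -ky mulrA -(mulrA x).
by rewrite (mu_mul0 mu) // mulr0 mul0r.
Qed.

Lemma peirce_sq i j x : i != j -> peirce e i j x -> x * x = 0.
Proof. by rewrite eq_sym => ji hx; exact: (peirce_mul0 ji hx hx). Qed.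

Lemma peirce0 i j : peirce e i j 0.
Proof. by split; rewrite ?mulr0 ?mul0r. Qed.

Lemma peirceN i j x : peirce e i j x -> peirce e i j (- x).
Proof. by move=> [ix xj]; split; rewrite ?mulrN ?mulNr ?ix ?xj. Qed.

Lemma peirceD i j x y : peirce e i j x -> peirce e i j y -> peirce e i j (x + y).
Proof. by move=> [ix xj] [iy yj]; split; rewrite ?mulrDr ?mulrDl ?ix ?xj ?iy ?yj. Qed.

Lemma matrix_unit_neq0 i j : e i j != 0.
Proof.
apply/eqP => e0; have := mu_sum mu; rewrite big1 => [/esym/eqP|k _].
  by rewrite oner_eq0.
by rewrite -(mu_mul mu k i k) -(mu_mul mu i j k) e0 mul0r mulr0.
Qed.

Lemma sl2_pair_units i j : i != j -> sl2_pair (e i j) (e j i).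
Proof.
move=> ij; have ji : j != i by rewrite eq_sym.
split; rewrite ?(mu_mul mu) ?(mu_mul0 mu) //.
Qed.
End Peirce.

(** * Generation by off-diagonal Peirce components *)

Section Generation.
Variables (F : fieldType) (A : unitAlgType F).
Hypothesis locA : locally_matrix A.

(** In a matrix subalgebra holding x, y, their inverses and the idempotents e i i, these idempotents
    are diagonalised together, so every elementary matrix lies over a single Peirce component. A
    commutator is a product of elementary matrices, and those over a diagonal component are
    commutators through another index. *)
Lemma comm_units_peirce_ind n (e : 'I_n -> 'I_n -> A) (P : A -> Prop) :
  matrix_units e -> (1 < n)%N -> P 1 ->
  (forall x y, P x -> P y -> P (x * y)) ->
  (forall i j x, i != j -> peirce e i j x -> P (1 + x)) ->
  forall g, comm_units g -> P g.
Proof.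
move=> mu n1 P1 PM PX; apply: comm_units_ind => // x y ux uy.
have [m [f [finj Hf]]] := loc_mx locA ([:: x; y; x^-1; y^-1] ++ [seq e i i | i <- enum 'I_n]).
have [Mx xE] : exists M, x = f M by apply: Hf; rewrite !inE eqxx.
have [My yE] : exists M, y = f M by apply: Hf; rewrite !inE eqxx orbT.
have [Mx' xE'] : exists M, x^-1 = f M by apply: Hf; rewrite !inE eqxx !orbT.
have [My' yE'] : exists M, y^-1 = f M by apply: Hf; rewrite !inE eqxx !orbT.
have [eps epsE] : exists eps, forall i, e i i = f (eps i).
  have H i : exists M, e i i = f M.
    by apply: Hf; rewrite mem_cat; apply/orP; right;
      apply: (map_f (fun i => e i i)); rewrite mem_enum.
  by exists (fun i => projT1 (cid (H i))) => i; case: (cid (H i)).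
have xx' : Mx * Mx' = 1 by apply: finj; rewrite rmorphM rmorph1 /= -xE -xE' divrr.
have yy' : My * My' = 1 by apply: finj; rewrite rmorphM rmorph1 /= -yE -yE' divrr.
have uX : Mx \is a GRing.unit by apply/unitrP; exists Mx'; split=> //; exact: mulmx1C.
have uY : My \is a GRing.unit by apply/unitrP; exists My'; split=> //; exact: mulmx1C.
have epsM i : eps i * eps i = eps i.
  by apply: finj; rewrite rmorphM /= -epsE (mu_mul mu).
have eps0 i j : i != j -> eps i * eps j = 0.
  by move=> ij; apply: finj; rewrite rmorphM /= -!epsE (mu_mul0 mu) // rmorph0.
have eps1 : \sum_i eps i = 1.
  apply: finj; rewrite raddf_sum rmorph1 /= -(mu_sum mu).
  by apply: eq_bigr => i _; rewrite epsE.
have [Q uQ diag] : exists2 Q : 'M[F]_m.+1, Q \is a GRing.unit &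
    forall i a b, a != b -> (Q * eps i * Q^-1) a b = 0.
  apply: codiagonalize_idempotents => // i j.
  by have [->//|ij] := eqVneq i j; rewrite !eps0 // eq_sym.
pose h M := f (Q^-1 * M * Q).
have hM M N : h (M * N) = h M * h N.
  rewrite /h -rmorphM; congr (f _); rewrite !mulrA; congr (_ * _ * _).
  by rewrite mulrK.
have h1 : h 1 = 1 by rewrite /h mulr1 mulVr // rmorph1.
have h0 : h 0 = 0 by rewrite /h mulr0 mul0r rmorph0.
have hD M N : h (M + N) = h M + h N by rewrite /h mulrDr mulrDl rmorphD.
pose D i := Q * eps i * Q^-1.
have hDi i : h (D i) = e i i by rewrite /h /D epsE mulrA mulrA mulVr // mul1r mulrVK.
have DD i : D i * D i = D i.
  by rewrite /D !mulrA mulrVK // -(mulrA Q) epsM.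
have D0 i j : i != j -> D i * D j = 0.
  by move=> ij; rewrite /D !mulrA mulrVK // -(mulrA Q) eps0 // mulr0 mul0r.
have D1 : \sum_i D i = 1.
  by rewrite /D -mulr_suml -mulr_sumr eps1 mulr1 divrr.
have Dmul i a M b : (D i * M) a b = D i a a * M a b.
  rewrite mxE (bigD1 a) //= big1 ?addr0 // => c ca.
  by rewrite diag ?mul0r // eq_sym.
have mulD i a M b : (M * D i) a b = M a b * D i b b.
  rewrite mxE (bigD1 b) //= big1 ?addr0 // => c cb.
  by rewrite diag ?mulr0.
have Dnz i a : D i a a != 0 -> D i a a = 1.
  move=> nz; have /matrixP/(_ a a) := DD i; rewrite Dmul => E.
  by apply: (mulfI nz); rewrite E mulr1.
(* Every basis vector belongs to one of the blocks cut out by the idempotents. *)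
have cls a : exists i, D i a a = 1.
  have [i /Dnz Hi|N] := pickP (fun i => D i a a != 0); first by exists i.
  have := D1 => /matrixP/(_ a a); rewrite summxE big1 => [|i _].
    by rewrite mxE eqxx => /esym/eqP; rewrite oner_eq0.
  by apply/eqP/negbFE/N.
have DE i a b : D i a a = 1 -> D i * delta_mx a b = delta_mx a b.
  move=> Da; apply/matrixP => c d; rewrite Dmul [delta_mx _ _ _ _]mxE.
  by have [->|_] := eqVneq c a; rewrite ?Da ?mul1r //= mulr0.
have ED i a b : D i b b = 1 -> delta_mx a b * D i = delta_mx a b.
  move=> Db; apply/matrixP => c d; rewrite mulD [delta_mx _ _ _ _]mxE.
  by have [->|_] := eqVneq d b; rewrite ?Db ?mulr1 // andbF mul0r.
have hP i j a b t : D i a a = 1 -> D j b b = 1 -> peirce e i j (h (t *: delta_mx a b)).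
  by move=> Da Db; split; rewrite -hDi -hM -?scalerAr -?scalerAl ?DE ?ED.
have elemP t a b : a != b -> P (h (elem_mx t a b)).
  move=> ab; rewrite /elem_mx hD h1; have [i Da] := cls a; have [j Db] := cls b.
  have [ij|ij] := eqVneq i j; last by apply: (PX i j) => //; apply: hP.
  pose i0 : 'I_n := Ordinal (ltnW n1); pose i1 : 'I_n := Ordinal n1.
  pose k := if i == i0 then i1 else i0.
  have ik : i != k by rewrite /k; have [->|] := eqVneq i i0.
  have [c Dc] : exists c, D k c c = 1.
    have [c /Dnz Hc|N] := pickP (fun c => D k c c != 0); first by exists c.
    have /eqP[] := matrix_unit_neq0 mu k k.
    rewrite -hDi (_ : D k = 0) ?h0 //.
    apply/matrixP => c d; rewrite [RHS]mxE; have [<-|cd] := eqVneq c d.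
      by apply/eqP/negbFE/N.
    exact: diag.
  pose u := h (t *: delta_mx a c); pose v := h (1 *: delta_mx c b).
  have uv : h (t *: delta_mx a b) = u * v.
    by rewrite -hM -scalerAl -scalerAr scale1r [delta_mx _ _ * _]mul_delta_mx.
  have pu : peirce e i k u by apply: hP.
  have pv : peirce e k i v by apply: hP => //; rewrite ij.
  have vu : v * u = 0.
    rewrite -hM -scalerAl -scalerAr [delta_mx _ _ * _]mul_delta_mx_0 1?eq_sym //.
    by rewrite !scaler0 h0.
  have ki : k != i by rewrite eq_sym.
  have uu := peirce_sq mu ik pu; have vv := peirce_sq mu ki pv.
  have -> : 1 + h (t *: delta_mx a b) = (1 + u) * (1 + v) * (1 - u) * (1 - v).
    rewrite uv; transitivity (1 + u * v + (1 + u) * (v * u) * (v - 1) + u * u * (v - 1)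
        - v * v - u * (v * v)).
      by rewrite vu uu vv !(mulr0, mul0r) !subr0 !addr0.
    by ncring.
  exact: (PM _ _ (PM _ _ (PM _ _ (PX _ _ _ ik pu) (PX _ _ _ ki pv))
    (PX _ _ _ ik (peirceN pu))) (PX _ _ _ ki (peirceN pv))).
have genP M : elem_prod M -> P (h M).
  by elim=> [|t a b {}M ab _ IH]; rewrite ?h1 // hM; apply: PM => //; apply: elemP.
have uq M : M \is a GRing.unit -> Q * M * Q^-1 \is a GRing.unit.
  by move=> uM; rewrite unitrMl ?unitrV // unitrMl.
have := genP _ (elem_prod_commutator (uq _ uX) (uq _ uY)).
have hQ M : h (Q * M * Q^-1) = f M by rewrite /h mulrA mulrA mulVr // mul1r mulrVK.
have hV M : M \is a GRing.unit -> h (Q * M * Q^-1)^-1 = f M^-1.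
  move=> uM; rewrite -hQ; congr h; apply: (mulrI (uq _ uM)).
  by rewrite divrr ?uq // !mulrA mulrVK // mulrK // divrr.
by rewrite 3!hM !hV // !hQ !rmorphV //= -xE -yE.
Qed.

(** S is a subring but not known to be a subspace, so scalars travel inside the square-zero elements
    t e_ij, and diagonal units are products of two of these. The noncommuting pair serves to exclude
    subalgebras of size one. *)
Lemma subring_comm_units (S : A -> Prop) :
  (exists x y : A, x * y != y * x) ->
  (forall x y, S x -> S y -> S (x + y)) -> (forall x, S x -> S (- x)) ->
  (forall x y, S x -> S y -> S (x * y)) ->
  (forall a, a * a = 0 -> S (1 + a)) -> forall b, S b.
Proof.
move=> [x [y xy]] SD SN SM SX b.
have [m [f [finj Hf]]] := loc_mx locA [:: b; x; y].
have [Mb ->] : exists M, b = f M by apply: Hf; rewrite !inE eqxx.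
have [Mx xE] : exists M, x = f M by apply: Hf; rewrite !inE eqxx orbT.
have [My yE] : exists M, y = f M by apply: Hf; rewrite !inE eqxx !orbT.
case: m => [|m] in f finj {Hf} Mb Mx xE My yE *.
  case/eqP: xy; rewrite xE yE -!rmorphM /= [Mx]mx11_scalar [My]mx11_scalar.
  by rewrite -![_%:M * _%:M]scalar_mxM mulrC.
have S1 : S 1 by rewrite -[1]addr0; apply: SX; rewrite mulr0.
have S0 : S 0 by rewrite -(subrr 1); apply: SD => //; apply: SN.
have Sq a : a * a = 0 -> S a.
  by move=> /SX aa; rewrite -(addKr 1 a); apply: SD => //; apply: SN.
have Sij t i j : i != j -> S (f (t *: delta_mx i j)).
  move=> ij; apply: Sq; rewrite -rmorphM -scalerAl -scalerAr.
  by rewrite [delta_mx _ _ * _]mul_delta_mx_0 1?eq_sym // !scaler0 rmorph0.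
have Sall t i j : S (f (t *: delta_mx i j)).
  have [->|] := eqVneq i j; last exact: Sij.
  pose k : 'I_m.+2 := if j == ord0 then ord_max else ord0.
  have jk : j != k by rewrite /k; have [->|] := eqVneq j ord0.
  have -> : t *: delta_mx j j = (t *: delta_mx j k) * (1 *: delta_mx k j) :> 'M[F]_m.+2.
    by rewrite -scalerAl -scalerAr scale1r [delta_mx _ _ * _]mul_delta_mx.
  by rewrite rmorphM; apply: SM; apply: Sij; rewrite // eq_sym.
rewrite (matrix_sum_delta Mb) raddf_sum; apply: big_ind => // i _.
by rewrite /= raddf_sum; apply: big_ind => // j _; exact: Sall.
Qed.
End Generation.

Section Extension.
Variables (F : fieldType) (A B : unitAlgType F) (phi : A -> B) (phi' : B -> A).
Hypotheses (F2 : 2%:R != 0 :> F) (F3 : 3%:R != 0 :> F).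
Hypotheses (locA : locally_matrix A) (locB : locally_matrix B).
Hypothesis iso : group_iso phi phi'.

Lemma loc_morphism_inj (theta : {rmorphism A -> B}) : injective theta.
Proof.
apply: raddf_inj => x tx; apply/eqP; apply: contraT => x0.
have [m [f [finj Hf]]] := loc_mx locA [:: x].
have [X xE] := Hf x (mem_head _ _).
have [i [j Xij]] : exists i j, X i j != 0.
  by apply: mx_neq0P; apply: contraNneq x0 => X0; rewrite xE X0 rmorph0.
have t0 k : theta (f (delta_mx k k)) = 0.
  (* [theta] need not be linear, so the scalar is written as a ring element. *)
  have -> : delta_mx k k = (X i j)^-1%:M * (delta_mx k i * X * delta_mx j k).
    rewrite -[_ * _ * delta_mx j k]/(_ *m _ *m _) delta_mx_sandwich.
    by rewrite -[_%:M * _]/(_ *m _) mul_scalar_mx scalerA mulVf // scale1r.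
  by rewrite !rmorphM /= -xE tx mulr0 mul0r mulr0.
have := oner_eq0 B; rewrite -(rmorph1 theta) -(rmorph1 f).
have -> : (1 : 'M[F]_m.+1) = \sum_k delta_mx k k by rewrite -mx1_sum_delta.
by rewrite !raddf_sum big1 ?eqxx // => k _; rewrite /= t0.
Qed.

(** Surjectivity holds because the image is a subring containing each 1 + a with a^2 = 0, and
    injectivity because A is simple. *)
Lemma extension_bijective (theta : A -> B) :
  (forall x y, theta (x + y) = theta x + theta y) ->
  (forall x y, theta (x * y) = theta x * theta y) -> theta 1 = 1 ->
  (exists x y : B, x * y != y * x) ->
  (forall g, comm_units g -> theta g = phi g) ->
  exists t : {rmorphism A -> B}, bijective t /\
    forall g, comm_units g -> t g = phi g.
Proof.
move=> tD tM t1 nc tE.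
have tB : zmod_morphism theta.
  have t0 : theta 0 = 0 by apply: (@addIr _ (theta 0)); rewrite -tD !add0r.
  move=> x y; rewrite tD; congr (_ + _); apply: (@addIr _ (theta y)).
  by rewrite -tD !addNr.
pose t : {rmorphism A -> B} := HB.pack theta
  (GRing.isZmodMorphism.Build _ _ theta tB)
  (GRing.isMonoidMorphism.Build _ _ theta (conj t1 tM)).
exists t; split=> //.
have tS : forall b, exists x, t x = b.
  apply: (subring_comm_units locB nc).
  - by move=> _ _ [x <-] [y <-]; exists (x + y); rewrite rmorphD.
  - by move=> _ [x <-]; exists (- x); rewrite rmorphN.
  - by move=> _ _ [x <-] [y <-]; exists (x * y); rewrite rmorphM.
  move=> a aa; have ha := comm_units_1D F2 F3 locB aa.
  by exists (phi' (1 + a)); rewrite /= tE ?(gi_K' iso) //; apply: (gi_in' iso).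
exists (fun b => projT1 (cid (tS b))) => [x|b]; last by case: (cid (tS b)).
by case: (cid _) => y /= /(@loc_morphism_inj t).
Qed.

Section NonCommutative.
Variables (n : nat) (e : 'I_n -> 'I_n -> A).
Hypothesis mu : matrix_units e.
Hypothesis n1 : (1 < n)%N.
Local Notation psi := (unip_part phi).

Lemma image_noncommutative : exists x y : B, x * y != y * x.
Proof.
pose i : 'I_n := Ordinal (ltnW n1); pose j : 'I_n := Ordinal n1.
have ij : i != j by []; have ji : j != i by [].
have h k l : k != l -> comm_units (1 + e k l).
  by move=> kl; apply: (comm_units_1D F2 F3 locA); exact: (peirce_sq mu kl (peirce_unit mu k l)).
exists (phi (1 + e i j)), (phi (1 + e j i)); apply/eqP.
rewrite -!(gi_mul iso); try exact: h.
move=> /(gi_inj iso (comm_unitsM (h _ _ ij) (h _ _ ji)) (comm_unitsM (h _ _ ji) (h _ _ ij))) E.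
have : e i i - e j j = 0.
  rewrite -(mu_mul mu i j i) -(mu_mul mu j i j).
  transitivity ((1 + e i j) * (1 + e j i) - (1 + e j i) * (1 + e i j)); first by ncring.
  by rewrite E subrr.
move=> /(congr1 (fun t => e i i * t)); rewrite mulrBr (mu_mul mu) (mu_mul0 mu) // subr0 mulr0.
by move=> /eqP; rewrite (negbTE (matrix_unit_neq0 mu i i)).
Qed.

(** The ring B is generated by 1 and the images of off-diagonal Peirce elements. This replaces
    matrix units in B. *)
Lemma subring_unip_part (S : B -> Prop) : S 1 ->
  (forall x y, S x -> S y -> S (x + y)) -> (forall x, S x -> S (- x)) ->
  (forall x y, S x -> S y -> S (x * y)) ->
  (forall i j x, i != j -> peirce e i j x -> S (psi x)) -> forall b, S b.
Proof.
move=> S1 SD SN SM SX; apply: (subring_comm_units locB image_noncommutative) => // a aa.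
have ha := comm_units_1D F2 F3 locB aa.
rewrite -(gi_K' iso ha).
suff [] : comm_units (phi' (1 + a)) /\ S (phi (phi' (1 + a))) by [].
pose P g := comm_units g /\ S (phi g).
apply: (comm_units_peirce_ind locA (P := P) mu n1) => //.
- by split; [exact: comm_units1 | rewrite (gi_one iso)].
- move=> x y [hx Sx] [hy Sy]; split; first exact: comm_unitsM.
  by rewrite (gi_mul iso) //; apply: SM.
- move=> i j x ij hx; split; first by apply/(comm_units_1D F2 F3 locA)/(peirce_sq mu ij hx).
  by rewrite unip_partE; apply: SD => //; apply: SX hx.
exact: (gi_in' iso).
Qed.
End NonCommutative.

(** * The dichotomy between homomorphism and anti-homomorphism *)

Section ThreeIndices.
Variables (n : nat) (e : 'I_n -> 'I_n -> A).
Hypothesis mu : matrix_units e.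
Hypothesis n2 : (2 < n)%N.
Local Notation psi := (unip_part phi).
Local Notation pe := (peirce e).
Implicit Types (i j k l r s t : 'I_n) (x y z w : A).

Lemma third_index i j : exists2 k, k != i & k != j.
Proof.
pose i0 : 'I_n := Ordinal (ltnW (ltnW n2)); pose i1 : 'I_n := Ordinal (ltnW n2).
pose i2 : 'I_n := Ordinal n2.
have [/andP[]|] := boolP ((i0 != i) && (i0 != j)); first by exists i0.
have [/andP[]|] := boolP ((i1 != i) && (i1 != j)); first by exists i1.
rewrite !negb_and !negbK => /orP[]/eqP<- /orP[]/eqP//= <-; by exists i2.
Qed.

Let sq i j x : i != j -> pe i j x -> x * x = 0.
Proof. by move=> ij hx; exact: (peirce_sq mu ij hx). Qed.

Let psi_mul0 i j k l x y : i != j -> k != l -> j != k -> i != l ->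
  pe i j x -> pe k l y -> psi x * psi y = 0.
Proof.
move=> ij kl jk il hx hy; apply: (unip_part_mul0 F2 F3 locA locB iso).
- exact: (sq ij hx).
- exact: (sq kl hy).
- exact: (peirce_mul0 mu jk hx hy).
- by rewrite eq_sym in il; exact: (peirce_mul0 mu il hy hx).
Qed.

Let psi_bracket i j k x y : i != j -> j != k -> i != k -> pe i j x -> pe j k y ->
  psi (x * y) = psi x * psi y - psi y * psi x.
Proof.
move=> ij jk ik hx hy; apply: (unip_part_bracket F2 F3 locA locB iso).
- exact: (sq ij hx).
- exact: (sq jk hy).
- by rewrite eq_sym in ik; exact: (peirce_mul0 mu ik hy hx).
Qed.

Local Ltac dist := solve [by [] | by rewrite eq_sym].

(** The product psi x psi y behaves on the right like an element with column index k. The only case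
    not covered by orthogonality is s = j, where the bracket moves psi z past psi y. *)
Let hom_part_mul0 i j k r s x y z : i != j -> j != k -> i != k -> r != s -> r != k ->
  pe i j x -> pe j k y -> pe r s z -> psi x * psi y * psi z = 0.
Proof.
move=> ij jk ik rs rk hx hy hz.
have [sj|sj] := eqVneq s j; last first.
  by rewrite -mulrA (psi_mul0 _ _ _ _ hy hz) ?mulr0; try dist.
rewrite {s}sj in rs hz; rewrite -mulrA.
have -> : psi y * psi z = psi z * psi y - psi (z * y).
  by rewrite (psi_bracket rs jk rk hz hy) opprB addrC subrK.
rewrite mulrBr mulrA (psi_mul0 _ _ _ _ hx hz); try dist.
rewrite (psi_mul0 _ _ _ _ hx (peirceM hz hy)); try dist.
by rewrite mul0r subrr.
Qed.

Let mul_anti_part0 i j k r s x y z : i != j -> j != k -> i != k -> r != s -> r != k ->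
  pe i j x -> pe j k y -> pe r s z -> psi z * (psi y * psi x) = 0.
Proof.
move=> ij jk ik rs rk hx hy hz; rewrite mulrA.
have [sj|sj] := eqVneq s j; last by rewrite (psi_mul0 _ _ _ _ hz hy) ?mul0r.
rewrite {s}sj in rs hz.
have -> : psi z * psi y = psi (z * y) + psi y * psi z.
  by rewrite (psi_bracket rs jk rk hz hy) subrK.
rewrite mulrDl -mulrA (psi_mul0 _ _ _ _ hz hx); try dist.
rewrite mulr0 addr0 (psi_mul0 _ _ _ _ (peirceM hz hy) hx); dist.
Qed.

(** Products in the reversed order, which vanish when psi is multiplicative and survive when it
    reverses products. *)
Definition anti_part (v : B) : Prop := exists r s t z w,
  [/\ r != s, s != t, r != t, pe r s z & pe s t w /\ v = psi w * psi z].

Let hom_anti_part0 i j k x y v : i != j -> j != k -> i != k ->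
  pe i j x -> pe j k y -> anti_part v -> psi x * psi y * v = 0.
Proof.
move=> ij jk ik hx hy [r [s [t [z [w [rs st rt hz [hw ->]]]]]]].
have [sk|sk] := eqVneq s k; last first.
  by rewrite mulrA (hom_part_mul0 ij jk ik st sk hx hy hw) mul0r.
rewrite {s}sk in rs st hz hw.
have [jt|jt] := eqVneq j t; last first.
  by rewrite -mulrA (mul_anti_part0 rs st rt jk jt hz hw hy) mulr0.
rewrite -{t}jt in st rt hw.
have -> : psi w * psi z = psi z * psi w - psi (z * w).
  by rewrite (psi_bracket rs st rt hz hw) opprB addrC subrK.
rewrite mulrBr (hom_part_mul0 ij jk ik rt rs hx hy (peirceM hz hw)) subr0.
rewrite mulrA -(mulrA _ (psi y)) (psi_mul0 _ _ _ _ hy hz); try dist.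
by rewrite mulr0 mul0r.
Qed.

Let psi_decomposition i j x : i != j -> pe i j x -> exists k y z,
  [/\ i != k, k != j, pe i k y, pe k j z & psi x = psi y * psi z - psi z * psi y].
Proof.
move=> ij hx; have [k ki kj] := third_index i j; rewrite eq_sym in ki.
exists k, (x * e j k), (e k j); have hy := peirceM hx (peirce_unit mu j k).
split=> //; first exact: peirce_unit.
rewrite -(psi_bracket ki kj ij hy (peirce_unit mu k j)) -mulrA (mu_mul mu).
by rewrite hx.2.
Qed.

(** If U is a direct product psi x psi y and V a reversed one, then U b V = 0 for every b in B, and
    primeness decides. *)
Lemma hom_or_anti :
  (forall i j k x y, i != j -> j != k -> i != k -> pe i j x -> pe j k y ->
    psi y * psi x = 0) \/
  (forall i j k x y, i != j -> j != k -> i != k -> pe i j x -> pe j k y ->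
    psi x * psi y = 0).
Proof.
have UbV i j k x y v b : i != j -> j != k -> i != k ->
    pe i j x -> pe j k y -> anti_part v -> psi x * psi y * b * v = 0.
  move=> ij jk ik hx hy.
  (* Quantifying over all u killing the reversed products makes S closed under multiplication. A
     generator is a direct product minus a reversed one; the former kills V from the left, the
     latter is killed by u. *)
  pose S b := forall u, (forall v, anti_part v -> u * v = 0) ->
    forall v, anti_part v -> u * b * v = 0.
  suff : S b by move=> Sb hv; apply: Sb => // v' hv'; apply: (hom_anti_part0 ij jk ik hx hy hv').
  apply: (subring_unip_part mu (ltnW n2)) b =>
    [u Hu w hw|c d Hc Hd u Hu w hw|c Hc u Hu w hw|c d Hc Hd u Hu w hw|
     r s z rs hz u Hu w hw].
  - by rewrite mulr1 Hu.
  - by rewrite mulrDr mulrDl Hc // Hd // addr0.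
  - by rewrite mulrN mulNr Hc // oppr0.
  - by rewrite mulrA; apply: Hd => // v' hv'; apply: Hc.
  have [l [y' [z' [rl ls hy' hz' ->]]]] := psi_decomposition rs hz.
  have Uw := hom_anti_part0 rl ls rs hy' hz' hw.
  rewrite mulrBr mulrBl -[u * _ * w]mulrA Uw mulr0 sub0r.
  by rewrite Hu ?mul0r ?oppr0 //; exists r, l, s, y', z'.
have [H|H] := pselect (forall v, anti_part v -> v = 0).
  by left=> i j k x y ij jk ik hx hy; apply: H; exists i, j, k, x, y.
right=> i j k x y ij jk ik hx hy; apply: contrapT => U0; apply: H => v hv.
have [b|E|//] := @loc_prime _ _ locB (psi x * psi y) v; last by case: U0.
exact: (UbV _ _ _ _ _ _ _ ij jk ik hx hy hv).
Qed.
End ThreeIndices.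
End Extension.

(** * The ring isomorphism in the homomorphic case *)

Section HomCase.
Variables (F : fieldType) (A B : unitAlgType F) (phi : A -> B) (phi' : B -> A).
Hypotheses (F2 : 2%:R != 0 :> F) (F3 : 3%:R != 0 :> F).
Hypotheses (locA : locally_matrix A) (locB : locally_matrix B).
Hypothesis iso : group_iso phi phi'.
Variables (n : nat) (e : 'I_n -> 'I_n -> A).
Hypothesis mu : matrix_units e.
Hypothesis n2 : (2 < n)%N.
Local Notation psi := (unip_part phi).
Local Notation pe := (peirce e).
Implicit Types (i j k l r s t : 'I_n) (x y z w : A).

Hypothesis anti0 : forall i j k x y, i != j -> j != k -> i != k ->
  pe i j x -> pe j k y -> psi y * psi x = 0.

Let sq i j x : i != j -> pe i j x -> x * x = 0.
Proof. by move=> ij hx; exact: (peirce_sq mu ij hx). Qed.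

Let psiM i j k x y : i != j -> j != k -> i != k -> pe i j x -> pe j k y ->
  psi x * psi y = psi (x * y).
Proof.
move=> ij jk ik hx hy; rewrite (unip_part_bracket F2 F3 locA locB iso).
- by rewrite (anti0 ij jk ik hx hy) subr0.
- exact: (sq ij hx).
- exact: (sq jk hy).
- by rewrite eq_sym in ik; exact: (peirce_mul0 mu ik hy hx).
Qed.

Let psi_mul0 i j k l x y : i != j -> k != l -> j != k ->
  pe i j x -> pe k l y -> psi x * psi y = 0.
Proof.
move=> ij kl jk hx hy; have [il|il] := eqVneq i l.
  rewrite -{}il in kl hy.
  by apply: (anti0 kl ij _ hy hx); rewrite eq_sym.
apply: (unip_part_mul0 F2 F3 locA locB iso).
- exact: (sq ij hx).
- exact: (sq kl hy).
- exact: (peirce_mul0 mu jk hx hy).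
- by rewrite eq_sym in il; exact: (peirce_mul0 mu il hy hx).
Qed.

Let psiD i j x y : i != j -> pe i j x -> pe i j y -> psi (x + y) = psi x + psi y.
Proof.
move=> ij hx hy; have ji : j != i by rewrite eq_sym.
apply: (unip_partD F2 F3 locA locB iso).
- exact: (sq ij hx).
- exact: (sq ij hy).
- exact: (peirce_mul0 mu ji hx hy).
- exact: (peirce_mul0 mu ji hy hx).
Qed.

Let p i j : B := psi (e i j).

Let pU i j : pe i j (e i j) := peirce_unit mu i j.

Let pM i j k : i != j -> j != k -> i != k -> p i j * p j k = p i k.
Proof. by move=> ij jk ik; rewrite /p (psiM ij jk ik) ?(mu_mul mu). Qed.

Let third i j := third_index n2 i j.

Let o : 'I_n := Ordinal (ltnW (ltnW n2)).
Let o1 : 'I_n := Ordinal (ltnW n2).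

(** On the corner of [e o o] elements need not have square zero, so psi is out of reach; z is routed
    through the off-diagonal index [o1] and back. *)
Let rho z : B := psi (z * e o o1) * p o1 o.
Let E : B := rho (e o o).

Let rhoE k z : k != o -> pe o o z -> rho z = psi (z * e o k) * p k o.
Proof.
move=> ko hz; have [->//|k1] := eqVneq k o1.
have ok : o != k by rewrite eq_sym.
have o1o : o1 != o by []; have oo1 : o != o1 by [].
rewrite /rho -(pM (j := k) _ ko o1o) 1?eq_sym // mulrA.
congr (_ * _); rewrite (psiM oo1 _ ok) //; first by rewrite -mulrA (mu_mul mu).
- by rewrite eq_sym.
- exact: peirceM hz (pU _ _).
Qed.

Let E_E k : k != o -> E = p o k * p k o.
Proof. by move=> ko; rewrite /E (rhoE ko) ?(mu_mul mu) //; apply: pU. Qed.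

(** The two factors are routed through different indices, so that the middle product has distinct
    outer indices and psi is multiplicative on it. *)
Let rhoM z w : pe o o z -> pe o o w -> rho (z * w) = rho z * rho w.
Proof.
move=> hz hw; have [l lo lo1] := third o o1.
have ol : o != l by rewrite eq_sym.
have o1l : o1 != l by rewrite eq_sym.
have hzw := peirceM hz hw.
rewrite (rhoE lo hw) (rhoE lo hzw) /rho mulrA; congr (_ * _).
have hw' := peirceM hw (pU o l).
rewrite -(mulrA (psi _)) (psiM (i := o1) (j := o) (k := l)) //
  (psiM (i := o) (j := o1) (k := l)) //.
- by rewrite !mulrA -(mulrA z) (mu_mul mu) -(mulrA z) hw.1.
- exact: peirceM hz (pU _ _).
- exact: peirceM (pU _ _) hw'.
Qed.

Let rhoD z w : pe o o z -> pe o o w -> rho (z + w) = rho z + rho w.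
Proof.
move=> hz hw; rewrite /rho -[RHS]mulrDl [(z + w) * _]mulrDl; congr (_ * _).
apply: (psiD (i := o) (j := o1)) => //.
- exact: peirceM hz (pU _ _).
- exact: peirceM hw (pU _ _).
Qed.

Let rho0 : rho 0 = 0.
Proof. by rewrite /rho mul0r (unip_part0 iso) mul0r. Qed.

Let E_rho z : pe o o z -> E * rho z = rho z.
Proof. by move=> hz; rewrite -rhoM ?hz.1 //; apply: pU. Qed.

Let rho_E z : pe o o z -> rho z * E = rho z.
Proof. by move=> hz; rewrite -rhoM ?hz.2 //; apply: pU. Qed.

(** The would-be images of [e i o], and below of [e o i], with E in place of the missing diagonal
    value. They reassemble a matrix over the corner into an element of B. *)
Let eta i : B := if i == o then E else p i o.
Let eta' i : B := if i == o then E else p o i.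

Let eta'_eta i j : eta' i * eta j = if i == j then E else 0.
Proof.
rewrite /eta /eta'; have [->|io] := eqVneq i o.
  have [jo|jo] := eqVneq j o.
    by rewrite /= E_rho //; apply: pU.
  have [k ko kj] := third o j.
  rewrite (E_E ko) -mulrA (psi_mul0 ko jo _ (pU _ _) (pU _ _)) ?mulr0 //.
  by rewrite eq_sym.
have oi : o != i by rewrite eq_sym.
have [->|jo] := eqVneq j o.
  rewrite (negbTE io) (E_E io) mulrA (psi_mul0 oi oi io (pU _ _) (pU _ _)).
  by rewrite mul0r.
have [->|ij] := eqVneq i j; first by rewrite (E_E jo).
by rewrite (psi_mul0 oi jo ij (pU _ _) (pU _ _)).
Qed.

Let coord i j x := e o i * x * e j o.

Let coord_pe i j x : pe o o (coord i j x).
Proof.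
rewrite /coord; split; first by rewrite !mulrA (mu_mul mu).
by rewrite -(mulrA (e o i * x)) (mu_mul mu).
Qed.

Let theta x : B := \sum_i \sum_j eta i * rho (coord i j x) * eta' j.

Let thetaD x y : theta (x + y) = theta x + theta y.
Proof.
rewrite /theta -big_split; apply: eq_bigr => i _; rewrite -big_split.
apply: eq_bigr => j _; rewrite /= -mulrDl -mulrDr -rhoD; try exact: coord_pe.
by congr (_ * rho _ * _); rewrite /coord mulrDr mulrDl.
Qed.

Let rho_sum (f : 'I_n -> A) : (forall i, pe o o (f i)) ->
  rho (\sum_i f i) = \sum_i rho (f i).
Proof.
move=> hf; suff [] : pe o o (\sum_i f i) /\ rho (\sum_i f i) = \sum_i rho (f i) by [].
apply: (big_rec2 (fun x b => pe o o x /\ rho x = b)) => [|i x b _ [hx <-]].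
  by split; [exact: peirce0 | exact: rho0].
by split; [exact: peirceD | rewrite rhoD].
Qed.

Let thetaM x y : theta (x * y) = theta x * theta y.
Proof.
have H j : eta' j * theta y = \sum_l rho (coord j l y) * eta' l.
  rewrite /theta mulr_sumr (bigD1 j) //= [X in _ + X]big1 => [|i ij].
    rewrite addr0 mulr_sumr; apply: eq_bigr => l _.
    by rewrite 2!mulrA eta'_eta eqxx E_rho //; apply: coord_pe.
  rewrite mulr_sumr big1 // => l _.
  by rewrite 2!mulrA eta'_eta eq_sym (negbTE ij) !mul0r.
rewrite {2}/theta mulr_suml; apply: eq_bigr => i _.
rewrite mulr_suml.
under [RHS]eq_bigr => j _ do rewrite -mulrA H mulr_sumr.
rewrite exchange_big; apply: eq_bigr => l _ /=.
under eq_bigr => j _ do rewrite mulrA -(mulrA (eta i)) -rhoM ?(coord_pe) //.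
rewrite -mulr_suml -mulr_sumr -rho_sum; last by move=> j; apply: peirceM; apply: coord_pe.
congr (_ * rho _ * _); rewrite /coord.
under eq_bigr => j _ do rewrite !mulrA -(mulrA (e o i * x)) (mu_mul mu).
by rewrite -!mulr_suml -mulr_sumr (mu_sum mu) mulr1 !mulrA.
Qed.

Let theta_psi i j x : i != j -> pe i j x -> theta x = psi x.
Proof.
move=> ij hx; have ji : j != i by rewrite eq_sym.
rewrite /theta (bigD1 i) //= [X in _ + X]big1 => [|i' i'i]; last first.
  apply: big1 => j' _; have -> : coord i' j' x = 0.
    by rewrite /coord -hx.1 !mulrA (mu_mul0 mu) // !mul0r.
  by rewrite rho0 mulr0 mul0r.
rewrite addr0 (bigD1 j) //= [X in _ + X]big1 => [|j' j'j]; last first.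
  have -> : coord i j' x = 0.
    by rewrite /coord -hx.2 -!mulrA (mu_mul0 mu) 1?eq_sym // !mulr0.
  by rewrite rho0 mulr0 mul0r.
rewrite addr0 /eta /eta'; have [iE|io] := eqVneq i o.
  rewrite {i}iE in ij ji hx *; rewrite (negbTE ji).
  have [k ko kj] := third o j.
  have ok : o != k by rewrite eq_sym.
  have jk : j != k by rewrite eq_sym.
  rewrite E_rho; last exact: coord_pe.
  rewrite (rhoE ko); last exact: coord_pe.
  rewrite /coord hx.1 -(mulrA x) (mu_mul mu) -mulrA pM //.
  rewrite /p (psiM ok kj ij) ?pU //; last exact: peirceM hx (pU _ _).
  by rewrite -mulrA (mu_mul mu) hx.2.
have oi : o != i by rewrite eq_sym.
have [jE|jo] := eqVneq j o.
  rewrite {j}jE in ij ji hx *; have [k ko ki] := third o i.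
  have ok : o != k by rewrite eq_sym.
  have ik : i != k by rewrite eq_sym.
  rewrite -(mulrA (p i o)) rho_E; last exact: coord_pe.
  rewrite (rhoE ko); last exact: coord_pe.
  rewrite /coord -!(mulrA _ x) hx.2 mulrA.
  have hx' := peirceM hx (pU o k).
  have hx'' := peirceM (pU o i) hx'.
  rewrite {1}/p -(mulrA (e o i)) (psiM io ok ik) ?pU //.
  rewrite mulrA (mu_mul mu) hx'.1 (psiM ik ko ij) ?pU //.
  by rewrite -mulrA (mu_mul mu) hx.2.
have [k ko kj] := third o j.
have ok : o != k by rewrite eq_sym.
have oj : o != j by rewrite eq_sym.
have jk : j != k by rewrite eq_sym.
rewrite (rhoE ko); last exact: coord_pe.
rewrite /coord -(mulrA _ (e j o)) (mu_mul mu).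
have hx' := peirceM (pU o i) hx.
rewrite -(mulrA (p i o)) -(mulrA (psi _)) pM // {2}/p (psiM ok kj oj) ?pU //; last first.
  exact: peirceM hx' (pU _ _).
rewrite -mulrA (mu_mul mu) hx'.2 /p (psiM io oj ij) ?pU //.
by rewrite mulrA (mu_mul mu) hx.1.
Qed.

(** The defect 1 - theta 1 kills every psi x, so right multiplication turns it only into scalar
    multiples of itself. Hence it annihilates B psi(e_ij), and primeness makes it zero, psi being
    injective. *)
Let theta1 : theta 1 = 1.
Proof.
have K0 i j x : i != j -> pe i j x -> (1 - theta 1) * psi x = 0.
  by move=> ij hx; rewrite -(theta_psi ij hx) mulrBl -thetaM !mul1r subrr.
have scal b : exists c : F, (1 - theta 1) * b = c *: (1 - theta 1).
  pose S b' := exists c : F, (1 - theta 1) * b' = c *: (1 - theta 1).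
  apply: (subring_unip_part F2 F3 locA locB iso mu (ltnW n2) (S := S)).
  - by exists 1; rewrite mulr1 scale1r.
  - by move=> x y [c cE] [d dE]; exists (c + d); rewrite mulrDr cE dE scalerDl.
  - by move=> x [c cE]; exists (- c); rewrite mulrN cE scaleNr.
  - by move=> x y [c cE] [d dE]; exists (c * d); rewrite mulrA cE -scalerAl dE scalerA.
  by move=> i j x ij hx; exists 0; rewrite (K0 _ _ _ ij hx) scale0r.
have oo1 : o != o1 by [].
have [b|/eqP|p0] := @loc_prime _ _ locB (1 - theta 1) (p o o1).
- by have [c ->] := scal b; rewrite -scalerAl (K0 _ _ _ oo1) ?scaler0.
- by rewrite subr_eq0 => /eqP.
case/eqP: (matrix_unit_neq0 mu o o1).
apply: (unip_part_inj F2 F3 locA iso); rewrite ?mul0r //.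
  exact: (sq oo1 (pU _ _)).
by rewrite (unip_part0 iso).
Qed.

Lemma hom_case_extension : exists t : {rmorphism A -> B}, bijective t /\
  forall g, comm_units g -> t g = phi g.
Proof.
apply: (extension_bijective F2 F3 locA locB iso thetaD thetaM theta1).
  exact: (image_noncommutative F2 F3 locA iso mu (ltnW n2)).
move=> g hg; suff [] : comm_units g /\ theta g = phi g by [].
pose P g := comm_units g /\ theta g = phi g.
apply: (comm_units_peirce_ind locA (P := P) mu (ltnW n2)) hg.
- by split; [exact: comm_units1 | rewrite (gi_one iso)].
- move=> x y [hx Ex] [hy Ey]; split; first exact: comm_unitsM.
  by rewrite thetaM Ex Ey (gi_mul iso).
- move=> i j x ij hx; split; first by apply/(comm_units_1D F2 F3 locA)/(sq ij hx).
  by rewrite thetaD theta1 (theta_psi ij hx) unip_partE.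
Qed.
End HomCase.

(** * Algebras of degree two *)

Lemma lrmorphism_matrix_units (F : fieldType) (A : unitAlgType F) m
    (f : {lrmorphism 'M[F]_m.+1 -> A}) :
  matrix_units (fun i j => f (delta_mx i j)).
Proof.
split=> [i j k|i j k l jk|].
- by rewrite -rmorphM; congr (f _); exact: mul_delta_mx.
- by rewrite -rmorphM -[RHS](rmorph0 f); congr (f _); exact: mul_delta_mx_0.
- by rewrite -raddf_sum -[RHS](rmorph1 f) -mx1_sum_delta.
Qed.

(* Hua's identity x^-1 - (x + 1)^-1 = (x (x + 1))^-1 shows that s preserves squares. *)
Lemma additive_inverse_mul (F : fieldType) (s : F -> F) : 2%:R != 0 :> F ->
  (forall x y, s (x + y) = s x + s y) -> s 1 = 1 ->
  (forall x, x != 0 -> s x * s x^-1 = 1) -> forall x y, s (x * y) = s x * s y.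
Proof.
move=> F2 sD s1 sV.
have s0 : s 0 = 0 by apply: (@addIr _ (s 0)); rewrite -sD !add0r.
have sN x : s (- x) = - s x.
  by apply: (@addIr _ (s x)); rewrite -sD !addNr.
have nz x : x != 0 -> s x != 0.
  by move=> /sV E; apply: contraTneq (oner_neq0 F) => E0; rewrite -E E0 mul0r eqxx.
have sI x : x != 0 -> s x^-1 = (s x)^-1.
  by move=> x0; apply: (mulfI (nz _ x0)); rewrite sV // mulfV // nz.
have sq x : s (x * x) = s x * s x.
  have [->|x0] := eqVneq x 0; first by rewrite mul0r s0 mul0r.
  have [x1|x1] := eqVneq (x + 1) 0.
    have -> : x = - 1 by apply/eqP; rewrite -addr_eq0 x1.
    by rewrite [in LHS]mulrNN mulr1 sN s1 mulrNN mulr1.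
  have xx1 : x * (x + 1) != 0 by rewrite mulf_neq0.
  have E : x^-1 - (x + 1)^-1 = (x * (x + 1))^-1 by field; rewrite x0 x1.
  have := congr1 s E; rewrite sD sN !sI // sD s1.
  have sx0 := nz _ x0; have := nz _ x1; rewrite sD s1 => sx1 => E'.
  have : (s x * (s x + 1))^-1 = (s (x * (x + 1)))^-1 by rewrite -E'; field; rewrite sx0 sx1.
  by move=> /invr_inj; rewrite !mulrDr !mulr1 sD => /addIr.
move=> x y; have := sq (x + y).
have -> : (x + y) * (x + y) = x * x + y * y + (x * y + x * y) by ring.
rewrite !sD !sq => H; apply: (mulfI F2).
have -> : 2%:R * s (x * y) = s x * s x + s y * s y + (s (x * y) + s (x * y))
  - (s x * s x + s y * s y) by ring.
by rewrite H; ring.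
Qed.

Section SemilinearMatrix.
Variables (F : fieldType) (B : unitAlgType F) (n : nat) (E : 'I_n.+1 -> 'I_n.+1 -> B).
Variable s : F -> F.
Hypothesis mu : matrix_units E.
Hypotheses (sD : forall x y, s (x + y) = s x + s y) (s1 : s 1 = 1)
  (sM : forall x y, s (x * y) = s x * s y).

Definition semilinear_matrix (M : 'M[F]_n.+1) : B := \sum_i \sum_j s (M i j) *: E i j.

Let s0 : s 0 = 0.
Proof. by apply: (@addIr _ (s 0)); rewrite -sD !add0r. Qed.

Lemma semilinear_matrixD M N :
  semilinear_matrix (M + N) = semilinear_matrix M + semilinear_matrix N.
Proof.
rewrite /semilinear_matrix -big_split; apply: eq_bigr => i _; rewrite -big_split.
by apply: eq_bigr => j _; rewrite mxE sD scalerDl.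
Qed.

Lemma semilinear_matrix1 : semilinear_matrix 1 = 1.
Proof.
rewrite -(mu_sum mu); apply: eq_bigr => i _; rewrite (bigD1 i) //= big1 => [|j ji].
  by rewrite mxE eqxx s1 scale1r addr0.
by rewrite mxE eq_sym (negbTE ji) s0 scale0r.
Qed.

Lemma semilinear_matrixM M N :
  semilinear_matrix (M * N) = semilinear_matrix M * semilinear_matrix N.
Proof.
rewrite {2}/semilinear_matrix mulr_suml; apply: eq_bigr => i _.
have H j : E i j * semilinear_matrix N = \sum_k s (N j k) *: E i k.
  rewrite /semilinear_matrix mulr_sumr (bigD1 j) //= [X in _ + X]big1 => [|l lj].
    by rewrite addr0 mulr_sumr; apply: eq_bigr => k _; rewrite -scalerAr (mu_mul mu).
  by rewrite mulr_sumr big1 // => k _; rewrite -scalerAr (mu_mul0 mu) ?scaler0 // eq_sym.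
rewrite mulr_suml; under [RHS]eq_bigr => j _ do rewrite -scalerAl H scaler_sumr.
rewrite exchange_big; apply: eq_bigr => k _ /=.
rewrite mxE (big_morph s sD s0) scaler_suml; apply: eq_bigr => j _.
by rewrite sM scalerA.
Qed.
End SemilinearMatrix.

Section TwoByTwo.
Variables (F : fieldType) (A B : unitAlgType F) (phi : A -> B) (phi' : B -> A).
Hypotheses (F2 : 2%:R != 0 :> F) (F3 : 3%:R != 0 :> F).
Hypotheses (locA : locally_matrix A) (locB : locally_matrix B).
Hypothesis iso : group_iso phi phi'.
Variable f : {lrmorphism 'M[F]_2 -> A}.
Variable g : A -> 'M[F]_2.
Hypotheses (fK : cancel f g) (gK : cancel g f).
Local Notation psi := (unip_part phi).

Let i0 : 'I_2 := ord0.
Let i1 : 'I_2 := ord_max.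
Let e i j : A := f (delta_mx i j).
Let mu : matrix_units e := lrmorphism_matrix_units f.
Let a := e i0 i1.
Let r := e i1 i0.
Let ar : sl2_pair a r. Proof. exact: (sl2_pair_units mu). Qed.
Let p := psi a.
Let q := psi r.
Let pq : sl2_pair p q := unip_part_pair F2 F3 locA locB iso ar.
Let K := p * q + q * p.

Let ara1 : a * r + r * a = 1.
Proof.
by rewrite /a /r !(mu_mul mu) -(mu_sum mu) big_ord_recl big_ord1; congr (_ + e _ _); apply: val_inj.
Qed.

Let aa : a * a = 0. Proof. by case: ar. Qed.
Let rr : r * r = 0. Proof. by case: ar. Qed.

Let p_neq0 : p != 0.
Proof.
apply/eqP => p0; have /eqP[] := matrix_unit_neq0 mu i0 i1.
by apply: (unip_part_inj F2 F3 locA iso); rewrite ?mul0r // (unip_part0 iso).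
Qed.

Let weyl_ar : weyl a r = a - r.
Proof. by rewrite /weyl -(addrA 1) -opprD ara1 subrr add0r. Qed.

Let weyl_sq : weyl a r * weyl a r = - 1.
Proof.
rewrite weyl_ar -ara1; transitivity (a * a + r * r - (a * r + r * a)); first by ncring.
by rewrite aa rr addr0 sub0r.
Qed.

Let weyl_pq : weyl p q = 1 - K + p - q.
Proof. by rewrite /weyl /K; ncring. Qed.

Let KK : K * K = K.
Proof.
have [pp qq pqp qpq] := pq.
transitivity (p * q * p * q + q * p * q * p + p * (q * q) * p + q * (p * p) * q).
  by rewrite /K; ncring.
by rewrite pp qq pqp qpq !mulr0 !mul0r !addr0.
Qed.

Let Kp : K * p = p.
Proof.
have [pp qq pqp qpq] := pq; rewrite /K mulrDl pqp -mulrA pp mulr0 addr0 //.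
Qed.

Let pK : p * K = p.
Proof.
have [pp qq pqp qpq] := pq; rewrite /K mulrDr !mulrA pqp pp mul0r add0r //.
Qed.

Let Kq : K * q = q.
Proof.
have [pp qq pqp qpq] := pq; rewrite /K mulrDl qpq -mulrA qq mulr0 add0r //.
Qed.

Let qK : q * K = q.
Proof.
have [pp qq pqp qpq] := pq; rewrite /K mulrDr !mulrA qpq qq mul0r addr0 //.
Qed.

Let hw : comm_units (weyl a r) := comm_units_weyl F2 F3 ar.

(** The Weyl element squares to -1 in A, while in B its image squares to 1 - 2 K. Centrality of -1
    then makes the idempotent K central, and primeness of B yields K = 1. *)
Let phi_opp1 : phi (- 1) = 1 - K - K.
Proof.
have [pp qq pqp qpq] := pq.
rewrite -weyl_sq (gi_mul iso) // (unip_part_weyl F2 F3 locA locB iso) // weyl_pq.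
transitivity (1 - K - K + (K * K - K) + (p - K * p) + (p - p * K) - (q - K * q) - (q - q * K)
   + p * p + q * q - (p * q + q * p - K)); first by ncring.
by rewrite KK Kp pK Kq qK pp qq !subrr !subr0 !addr0 ?subrr ?subr0.
Qed.

Let K_central x : K * x = x * K.
Proof.
apply: (subring_comm_units locB (S := fun x => K * x = x * K)).
- exact: (image_noncommutative F2 F3 locA iso mu isT).
- by move=> y z yE zE; rewrite mulrDr yE zE -mulrDl.
- by move=> y yE; rewrite mulrN mulNr yE.
- by move=> y z yE zE; rewrite (mulrA K) yE -(mulrA y K) zE (mulrA y).
move=> c cc; have hc := comm_units_1D F2 F3 locB cc.
have h1 : comm_units (- 1 : A) by rewrite -weyl_sq; apply: comm_unitsM.
have hc' := gi_in' iso hc.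
have : phi (- 1) * phi (phi' (1 + c)) = phi (phi' (1 + c)) * phi (- 1).
  by rewrite -!(gi_mul iso) // mulN1r mulrN1.
rewrite (gi_K' iso hc) phi_opp1 => E.
suff D : K * (1 + c) - (1 + c) * K = 0 by apply/eqP; rewrite -subr_eq0 D.
apply: (double_eq0 F2).
transitivity ((1 + c) * (1 - K - K) - (1 - K - K) * (1 + c)); first by ncring.
by rewrite E subrr.
Qed.

Let K1 : K = 1.
Proof.
have [x|K0|/eqP] := @loc_prime _ _ locB K (1 - K).
- by rewrite K_central -mulrA mulrBr mulr1 KK subrr mulr0.
- by case/eqP: p_neq0; rewrite -Kp K0 mul0r.
- by rewrite subr_eq0 => /eqP.
Qed.

(** Anything commuting with b commutes with t b, so psi(t b) lies in the double centralizer of pb,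
    and having square zero it has no constant term. *)
Let scalar_image (b : A) (pb : B) t : b * b = 0 -> psi b = pb -> pb * pb = 0 -> pb != 0 ->
  exists m, psi (t *: b) = m *: pb.
Proof.
move=> bb bE pbb pb0; have tt := square_zeroZ t bb.
have iso' := group_iso_sym iso.
have [l [m lm]] : exists l m, psi (t *: b) = l%:A + m *: pb.
  apply: (loc_double_centralizer locB pb0 pbb) => s ss sp.
  pose c := unip_part phi' s.
  have cc : c * c = 0 := unip_part_sq F2 F3 locB locA iso' ss.
  have hs := comm_units_1D F2 F3 locB ss.
  have cE : psi c = s.
    by rewrite {1}/unip_part -unip_partE (gi_K' iso hs) addrC addKr.
  have bc : c * b = b * c.
    have bE' : unip_part phi' pb = b.
      have hb := comm_units_1D F2 F3 locA bb.
      by rewrite -bE {1}/unip_part -unip_partE (gi_K iso hb) addrC addKr.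
    by rewrite -bE'; apply: (unip_part_comm F2 F3 locB iso').
  rewrite -cE; apply: (unip_part_comm F2 F3 locA iso) => //.
  by rewrite -scalerAl -scalerAr bc.
exists m; rewrite lm; suff -> : l = 0 by rewrite scale0r add0r.
have := unip_part_sq F2 F3 locA locB iso tt; rewrite lm.
move=> /(congr1 (fun x => x * pb)); rewrite mul0r -mulrA.
have X : (l%:A + m *: pb) * pb = l *: pb.
  by rewrite mulrDl mulr_algl -scalerAl pbb scaler0 addr0.
rewrite X -scalerAr X scalerA => /eqP.
by rewrite scaler_eq0 (negbTE pb0) orbF mulf_eq0 orbb => /eqP.
Qed.

Lemma two_by_two_extension : exists t : {rmorphism A -> B}, bijective t /\
  forall g, comm_units g -> t g = phi g.
Proof.
have [pp qq pqp qpq] := pq.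
have q0 : q != 0 by apply: contraNneq p_neq0 => q0; rewrite -pqp q0 mulr0 mul0r.
have [s sE] : exists s : F -> F, forall t, psi (t *: a) = s t *: p.
  have H t := scalar_image t aa erefl pp p_neq0.
  by exists (fun t => projT1 (cid (H t))) => t; case: (cid (H t)).
have [s' s'E] : exists s : F -> F, forall t, psi (t *: r) = s t *: q.
  have H t := scalar_image t rr erefl qq q0.
  by exists (fun t => projT1 (cid (H t))) => t; case: (cid (H t)).
have pI : injective (fun c : F => c *: p).
  move=> c d /eqP; rewrite -subr_eq0 -scalerBl scaler_eq0 (negbTE p_neq0) orbF.
  by rewrite subr_eq0 => /eqP.
have sD x y : s (x + y) = s x + s y.
  apply: pI; rewrite /= scalerDl -!sE scalerDl.
  by apply: (unip_partD F2 F3 locA locB iso); rewrite -?(scalerAl, scalerAr) -?scalerAr aa ?scaler0.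
have s1 : s 1 = 1 by apply: pI; rewrite /= -sE !scale1r.
(* The Weyl element conjugates 1 + t a to 1 - t r, tying the scalars on r to those on a. *)
have ss' t : s' t = s t.
  have qp0 : q * p != 0.
    by apply: contraNneq p_neq0 => qp0; rewrite -pqp -mulrA qp0 mulr0.
  have tt := square_zeroZ t aa; have tr := square_zeroZ (- t) rr.
  have ht := comm_units_1D F2 F3 locA tt; have htr := comm_units_1D F2 F3 locA tr.
  have : phi (weyl a r) * phi (1 + t *: a) = phi (1 + (- t) *: r) * phi (weyl a r).
    rewrite -!(gi_mul iso) //; congr phi; rewrite weyl_ar.
    transitivity (a - r - t *: (r * a)).
      rewrite mulrDr mulr1; congr (_ + _).
      by rewrite -scalerAr mulrBl aa sub0r scalerN.
    rewrite [RHS]mulrDl mul1r; congr (_ + _).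
    by rewrite -scalerAl mulrBr rr subr0 scaleNr.
  rewrite (unip_part_weyl F2 F3 locA locB iso) // weyl_pq K1 subrr add0r !(@unip_partE _ _ _ phi).
  have -> : psi (- t *: r) = - (s' t *: q).
    by rewrite scaleNr (unip_partN F2 F3 locA locB iso) ?s'E //; apply: square_zeroZ.
  rewrite sE [LHS]mulrDr [RHS]mulrDl mulr1 mul1r => /addrI.
  rewrite -scalerAr mulrBl pp sub0r scalerN mulNr -scalerAl [q * (p - q)]mulrBr qq subr0.
  move=> /oppr_inj/esym/eqP; rewrite -subr_eq0 -scalerBl scaler_eq0 (negbTE qp0) orbF.
  by rewrite subr_eq0 => /eqP.
have sV x : x != 0 -> s x * s x^-1 = 1.
  move=> x0; have [_ _ H _] := unip_part_pair F2 F3 locA locB iso (sl2_pairZ x0 ar).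
  have sx0 : s x != 0.
    apply: contraNneq p_neq0 => sx0; rewrite sE sx0 scale0r in H.
    have xa : x *: a = 0.
      apply: (unip_part_inj F2 F3 locA iso); rewrite ?mul0r //; first exact: square_zeroZ.
      by rewrite sE sx0 scale0r (unip_part0 iso).
    by rewrite /p -[a](scalerK x0) xa scaler0 (unip_part0 iso).
  move: H; rewrite sE s'E ss' -!(scalerAl, scalerAr) pqp !scalerA => /pI E.
  by apply: (mulfI sx0); rewrite mulr1 -[RHS]E; ring.
have sM := additive_inverse_mul F2 sD s1 sV.
pose E (i j : 'I_2) : B :=
  if i == i0 then (if j == i0 then p * q else p) else (if j == i0 then q else q * p).
have ord2 (i : 'I_2) : i = i0 \/ i = i1.
  by case: i => [[|[|//]]] hi; [left | right]; apply: val_inj.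
have E00 : E i0 i0 = p * q by [].
have E01 : E i0 i1 = p by [].
have E10 : E i1 i0 = q by [].
have E11 : E i1 i1 = q * p by [].
have pqq : p * q * q = 0 by rewrite -mulrA qq mulr0.
have qpp : q * p * p = 0 by rewrite -mulrA pp mulr0.
have muE : matrix_units E.
  split.
  - move=> i j k; case: (ord2 i) => ->; case: (ord2 j) => ->; case: (ord2 k) => ->;
      by rewrite ?(E00, E01, E10, E11); try rewrite !mulrA; rewrite ?(pqp, qpq).
  - move=> i j k l; case: (ord2 i) => ->; case: (ord2 j) => ->; case: (ord2 k) => ->;
      case: (ord2 l) => -> // _;
      by rewrite ?(E00, E01, E10, E11); try rewrite !mulrA; rewrite ?(pqq, qpp, pp, qq, mul0r).
  - rewrite big_ord_recl big_ord1; have -> : lift ord0 ord0 = i1 by apply: val_inj.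
    by rewrite E00 E11 -/K K1.
pose theta x := semilinear_matrix E s (g x).
have gD x y : g (x + y) = g x + g y by apply: (can_inj fK); rewrite rmorphD /= !gK.
have gM x y : g (x * y) = g x * g y by apply: (can_inj fK); rewrite rmorphM /= !gK.
have g1 : g 1 = 1 by apply: (can_inj fK); rewrite rmorph1 gK.
have thD x y : theta (x + y) = theta x + theta y by rewrite /theta gD semilinear_matrixD.
have thM x y : theta (x * y) = theta x * theta y by rewrite /theta gM semilinear_matrixM.
have th1 : theta 1 = 1 by rewrite /theta g1 semilinear_matrix1.
apply: (extension_bijective F2 F3 locA locB iso thD thM th1).
  exact: (image_noncommutative F2 F3 locA iso mu isT).
move=> h hh; suff [] : comm_units h /\ theta h = phi h by [].
pose P h := comm_units h /\ theta h = phi h.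
apply: (comm_units_peirce_ind locA (P := P) mu isT) hh.
- by split; [exact: comm_units1 | rewrite (gi_one iso)].
- move=> x y [hx Ex] [hy Ey]; split; first exact: comm_unitsM.
  by rewrite thM Ex Ey (gi_mul iso).
- move=> i j x ij hx; split.
    by apply/(comm_units_1D F2 F3 locA)/(peirce_sq mu ij hx).
  rewrite thD th1 unip_partE; congr (_ + _).
  have xE : x = g x i j *: e i j.
    rewrite -{1}hx.1 -{1}hx.2 -{1}[x]gK -!rmorphM mulrA /=.
    rewrite -[_ * _ * _]/(_ *m _ *m _) delta_mx_sandwich.
    by rewrite linearZZ.
  have -> : theta x = s (g x i j) *: E i j.
    rewrite /theta /semilinear_matrix; set c := g x i j in xE *.
    have gE : g x = c *: delta_mx i j by apply: (can_inj fK); rewrite gK linearZZ.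
    have s0 : s 0 = 0 by apply: (@addIr _ (s 0)); rewrite -sD !add0r.
    rewrite gE (bigD1 i) //= [X in _ + X]big1 => [|k ki]; last first.
      by rewrite big1 // => l _; rewrite !mxE (negbTE ki) mulr0 s0 scale0r.
    rewrite addr0 (bigD1 j) //= [X in _ + X]big1 => [|l lj]; last first.
      by rewrite !mxE (negbTE lj) andbF mulr0 s0 scale0r.
    by rewrite !mxE !eqxx mulr1 !addr0.
  rewrite [in RHS]xE {xE}; case: (ord2 i) ij => ->; case: (ord2 j) => -> // _.
  by rewrite -[RHS]/(psi (_ *: r)) s'E ss'.
Qed.

End TwoByTwo.

(** * Anti-automorphisms *)

Record anti_automorphism (R : nzRingType) (tau tau' : R -> R) : Prop := AntiAutomorphism {
  anti_add : forall x y, tau (x + y) = tau x + tau y;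
  anti_mul : forall x y, tau (x * y) = tau y * tau x;
  anti_one : tau 1 = 1;
  anti_K : cancel tau tau';
  anti_K' : cancel tau' tau }.

Section AntiAutomorphism.
Variables (F : fieldType) (A : unitAlgType F).
Hypothesis locA : locally_matrix A.

Lemma lrmorphism_exists (R S : algType F) (h : R -> S) :
  (forall x y, h (x + y) = h x + h y) -> (forall x y, h (x * y) = h x * h y) ->
  h 1 = 1 -> (forall c x, h (c *: x) = c *: h x) ->
  exists k : {lrmorphism R -> S}, k =1 h.
Proof.
move=> hD hM h1 hZ.
have h0 : h 0 = 0 by apply: (@addIr _ (h 0)); rewrite -hD !add0r.
have hB : zmod_morphism h.
  move=> x y; rewrite hD; congr (_ + _); apply: (@addIr _ (h y)).
  by rewrite -hD !addNr.
pose k : {lrmorphism R -> S} := HB.pack h (GRing.isZmodMorphism.Build _ _ h hB)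
  (GRing.isMonoidMorphism.Build _ _ h (conj h1 hM))
  (GRing.isScalable.Build _ _ _ _ h hZ).
by exists k.
Qed.

Lemma embedding_factor m m' (f : {lrmorphism 'M[F]_m.+1 -> A})
    (f' : {lrmorphism 'M[F]_m'.+1 -> A}) : injective f' ->
  (forall i j, exists N, f (delta_mx i j) = f' N) ->
  exists h : {lrmorphism 'M[F]_m.+1 -> 'M[F]_m'.+1}, forall M, f' (h M) = f M.
Proof.
move=> f'inj dl.
have sub M : exists N, f' N = f M.
  have [N NE] : exists N : 'I_m.+1 -> 'I_m.+1 -> 'M[F]_m'.+1,
      forall i j, f' (N i j) = f (delta_mx i j).
    exists (fun i j => projT1 (cid (dl i j))) => i j; by case: (cid (dl i j)).
  exists (\sum_i \sum_j M i j *: N i j).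
  rewrite [in RHS](matrix_sum_delta M) !raddf_sum; apply: eq_bigr => i _ /=.
  rewrite !raddf_sum; apply: eq_bigr => j _ /=.
  by rewrite (linearZZ f) (linearZZ f'); congr (_ *: _); exact: NE.
pose j0 M := projT1 (cid (sub M)).
have j0E M : f' (j0 M) = f M by rewrite /j0; case: (cid _).
have [j jE] : exists j : {lrmorphism 'M[F]_m.+1 -> 'M[F]_m'.+1}, j =1 j0.
  apply: lrmorphism_exists => [x y|x y||c x]; apply: f'inj.
  - by rewrite rmorphD /= !j0E rmorphD.
  - by rewrite rmorphM /= !j0E rmorphM.
  - by rewrite j0E !rmorph1.
  - by rewrite linearZZ /= !j0E linearZZ.
by exists j => M; rewrite jE j0E.
Qed.

(* A full matrix subalgebra of [A], as the range of an embedding [f], with the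
   anti-automorphism [f M |-> f (u M^T u^-1)]. *)
Definition stage := {m : nat & ({lrmorphism 'M[F]_m.+1 -> A} * 'M[F]_m.+1)%type}.

Definition stage_valid (s : stage) : Prop :=
  injective (projT2 s).1 /\ (projT2 s).2 \is a GRing.unit.

Definition stage_rel (s : stage) (x y : A) : Prop :=
  exists M, x = (projT2 s).1 M /\
    y = (projT2 s).1 ((projT2 s).2 * M^T * (projT2 s).2^-1).

(** Besides the inclusion j of the old subalgebra into the new one, M |-> (j (u M^T u^-1))^T is an
    embedding too. A unit v conjugating j to it makes (v^T)^-1 the twist whose anti-automorphism
    extends the old one. *)
Lemma stage_extend s b : stage_valid s -> exists s', [/\ stage_valid s',
  forall x y, stage_rel s x y -> stage_rel s' x y & exists y, stage_rel s' b y].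
Proof.
case: s => m [f u] [/= finj uu].
have [m' [f' [f'inj Hf']]] :=
  loc_mx locA (b :: [seq f (delta_mx i j) | i <- enum 'I_m.+1, j <- enum 'I_m.+1]).
have [i j0|j jE] := embedding_factor f'inj (f := f).
  by apply: Hf'; rewrite inE; apply/orP; right;
    apply: (allpairs_f (fun i j => f (delta_mx i j))); rewrite mem_enum.
have trM n (x y : 'M[F]_n.+1) : (x * y)^T = y^T * x^T by exact: trmx_mul.
have [j' j'E] : exists j' : {lrmorphism 'M[F]_m.+1 -> 'M[F]_m'.+1},
    forall M, j' M = (j (u * M^T * u^-1))^T.
  apply: lrmorphism_exists => [x y|x y||c x].
  - by rewrite linearD /= mulrDr mulrDl !rmorphD /= linearD.
  - rewrite -trM -rmorphM trM; congr (j _)^T.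
    by rewrite !mulrA mulrVK.
  - by rewrite trmx1 mulr1 divrr // rmorph1 trmx1.
  - by rewrite linearZ /= -scalerAr -scalerAl !linearZ.
have [v uv vE] := matrix_embeddings_conj j j'.
have uvT : v^T \is a GRing.unit by rewrite -[_ \is a _]/(v^T \in unitmx) unitmx_tr.
exists (existT _ m' (f', (v^T)^-1)); split=> /=.
- by split=> //=; rewrite unitrV.
- move=> _ _ [M [-> ->]]; exists (j M); rewrite /= !jE; split=> //.
  rewrite invrK -jE; congr (f' _).
  have := vE M; rewrite j'E => /(congr1 trmx); rewrite !trM trmxK => E.
  by rewrite -(mulrA (v^T)^-1) E mulKr.
have [N ->] := Hf' b (mem_head _ _).
by eexists; exists N; split.
Qed.

Lemma stage_rel_fun s x y y' : stage_valid s ->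
  stage_rel s x y -> stage_rel s x y' -> y = y'.
Proof. by case: s => m [f u] [/= finj uu] [M [-> ->]] [N [/finj <- ->]]. Qed.

Lemma stage_rel_inj s x x' y : stage_valid s ->
  stage_rel s x y -> stage_rel s x' y -> x = x'.
Proof.
case: s => m [f u] [/= finj uu] [M [-> ->]] [N [-> /finj]].
have uV : u^-1 \is a GRing.unit by rewrite unitrV.
by move=> /(mulIr uV)/(mulrI uu)/trmx_inj ->.
Qed.

Lemma stage_rel_surj s y y' : stage_valid s -> stage_rel s y y' ->
  exists x, stage_rel s x y.
Proof.
case: s => m [f u] [/= finj uu] [N [-> _]].
exists (f (u^-1 * N * u)^T); eexists; split; first by [].
by rewrite trmxK !mulrA divrr // mul1r mulrK.
Qed.

Lemma stage_relD s x x' y y' : stage_rel s x y -> stage_rel s x' y' ->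
  stage_rel s (x + x') (y + y').
Proof.
case: s => m [f u] [M [-> ->]] [N [-> ->]] /=; exists (M + N).
split; first by rewrite rmorphD.
by rewrite linearD /= mulrDr mulrDl rmorphD.
Qed.

Lemma stage_relM s x x' y y' : stage_valid s -> stage_rel s x y -> stage_rel s x' y' ->
  stage_rel s (x * x') (y' * y).
Proof.
case: s => m [f u] [/= finj uu] [M [-> ->]] [N [-> ->]] /=; exists (M * N).
rewrite -!rmorphM; split=> //; congr (f _).
by rewrite [(M * N)^T]trmx_mul !mulrA mulrVK.
Qed.

Lemma stage_rel1 s : stage_valid s -> stage_rel s 1 1.
Proof.
case: s => m [f u] [/= finj uu]; exists 1; rewrite /= rmorph1; split=> //.
by rewrite trmx1 mulr1 divrr // rmorph1.
Qed.

Lemma stage_relZ s c x y : stage_rel s x y -> stage_rel s (c *: x) (c *: y).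
Proof.
case: s => m [f u] [M [-> ->]] /=; exists (c *: M) => /=.
split; first by rewrite linearZZ.
have -> : (c *: M)^T = c *: M^T by rewrite linearZ.
by rewrite -scalerAr -scalerAl linearZZ.
Qed.

(** Stage k + 1 is chosen to contain the k-th vector of an enumerated spanning set. The stage
    relations increase, and their union is the graph of a bijection. *)
Lemma anti_automorphism_exists : countable_dim A ->
  exists tau tau' : A -> A, anti_automorphism tau tau'.
Proof.
move=> [S [/countable_injP[num numI] _ spanS]].
(* Numbers that index no vector get the value 0, which is harmless to adjoin. *)
pose b (k : nat) : A := if pselect (exists x, S x /\ num x = k) is left H
  then projT1 (cid H) else 0.
have bE x : S x -> b (num x) = x.
  move=> Sx; rewrite /b; case: pselect => [H|[]]; last by exists x.
  case: (cid H) => y /= [Sy yx]; apply: numI; rewrite ?inE //.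
have nextP (s : stage) k : exists s', stage_valid s -> [/\ stage_valid s',
    forall x y, stage_rel s x y -> stage_rel s' x y & exists y, stage_rel s' (b k) y].
  have [sv|nsv] := pselect (stage_valid s); last by exists s.
  by have [s' Hs'] := stage_extend (b k) sv; exists s'.
pose next s k := projT1 (cid (nextP s k)).
have [m0 [f0 [f0inj _]]] := loc_mx locA [::].
pose s0 : stage := existT _ m0 (f0, 1).
pose fix st k : stage := if k is k'.+1 then next (st k') k' else s0.
have valid k : stage_valid (st k).
  elim: k => [|k IH] /=; first by split=> //=; exact: unitr1.
  by rewrite /next; case: (cid _) => s' /= /(_ IH)[].
have stepP k : (forall x y, stage_rel (st k) x y -> stage_rel (st k.+1) x y) /\
    exists y, stage_rel (st k.+1) (b k) y.
  by rewrite /= /next; case: (cid _) => s' /= /(_ (valid k))[].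
have mono k l x y : (k <= l)%N -> stage_rel (st k) x y -> stage_rel (st l) x y.
  move=> /subnK <-; elim: (l - k)%N => [//|d IH] /IH; exact: (stepP _).1.
have dom x : exists k y, stage_rel (st k) x y.
  have [X [c [XS ->]]] := spanS x; elim: X XS => [|z X IH] XS.
    exists 0%N, 0; rewrite big_nil.
    have := stage_relZ 0 (stage_rel1 (valid 0)); by rewrite !scale0r.
  have [|k [y hy]] := IH; first by move=> w wX; apply: XS; rewrite inE wX orbT.
  have Sz := XS z (mem_head _ _).
  have [w] := (stepP (num z)).2; rewrite bE // => hw.
  exists (maxn k (num z).+1), (c z *: w + y); rewrite big_cons.
  apply: stage_relD; first by apply: stage_relZ; apply: mono hw; apply: leq_maxr.
  by apply: mono hy; apply: leq_maxl.
pose R x y := exists k, stage_rel (st k) x y.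
have common x y x' y' : R x y -> R x' y' ->
    exists2 k, stage_rel (st k) x y & stage_rel (st k) x' y'.
  move=> [k hk] [l hl]; exists (maxn k l).
    by apply: mono hk; apply: leq_maxl.
  by apply: mono hl; apply: leq_maxr.
have Rfun x y y' : R x y -> R x y' -> y = y'.
  by move=> h h'; have [k hk hk'] := common _ _ _ _ h h'; exact: stage_rel_fun (valid k) hk hk'.
have Rtot x : exists y, R x y by have [k [y hy]] := dom x; exists y, k.
have Rsurj y : exists x, R x y.
  have [k [z hz]] := dom y; have [x hx] := stage_rel_surj (valid k) hz.
  by exists x, k.
pose tau x := projT1 (cid (Rtot x)); pose tau' y := projT1 (cid (Rsurj y)).
have tauR x : R x (tau x) by rewrite /tau; case: (cid _).
have tauR' y : R (tau' y) y by rewrite /tau'; case: (cid _).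
exists tau, tau'; split=> [x y|x y||x|y].
- have [k h h'] := common _ _ _ _ (tauR x) (tauR y).
  by apply: Rfun (tauR _) _; exists k; apply: stage_relD.
- have [k h h'] := common _ _ _ _ (tauR x) (tauR y).
  by apply: Rfun (tauR _) _; exists k; apply: stage_relM.
- by apply: Rfun (tauR _) _; exists 0%N; apply: stage_rel1.
- have [k h h'] := common _ _ _ _ (tauR x) (tauR' (tau x)).
  exact: (stage_rel_inj (valid k) h' h).
- exact: Rfun (tauR _) (tauR' y).
Qed.

End AntiAutomorphism.

(** * Conclusion *)

Section AntiTwist.
Variables (A B : unitRingType) (phi : A -> B) (phi' : B -> A) (tau tau' : A -> A).
Hypothesis iso : group_iso phi phi'.
Hypothesis anti : anti_automorphism tau tau'.

Lemma anti_automorphism_sym : anti_automorphism tau' tau.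
Proof.
case: anti => D M one K K'; split=> // [x y|x y|].
- by rewrite -{1}[x]K' -{1}[y]K' -D K.
- by rewrite -{1}[x]K' -{1}[y]K' -M K.
- by rewrite -one K.
Qed.

Lemma anti_inv x : x \is a GRing.unit ->
  tau x \is a GRing.unit /\ tau x^-1 = (tau x)^-1.
Proof.
move=> ux; have xV : tau x * tau x^-1 = 1 by rewrite -(anti_mul anti) mulVr // (anti_one anti).
have Vx : tau x^-1 * tau x = 1 by rewrite -(anti_mul anti) divrr // (anti_one anti).
have u : tau x \is a GRing.unit by apply/unitrP; exists (tau x^-1).
by split=> //; apply: (mulrI u); rewrite divrr.
Qed.

Lemma anti_comm_units x : comm_units x -> comm_units (tau x).
Proof.
apply: (comm_units_ind (P := fun x => comm_units (tau x))) => [|y z hy hz|y z uy uz].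
- by rewrite (anti_one anti); apply: comm_units1.
- by rewrite (anti_mul anti); apply: comm_unitsM.
have [vy Ey] := anti_inv uy; have [vz Ez] := anti_inv uz.
have := @comm_units_comm _ (tau z)^-1 (tau y)^-1; rewrite !unitrV !invrK => /(_ vz vy).
by rewrite !(anti_mul anti) Ey Ez !mulrA.
Qed.
End AntiTwist.

Lemma anti_twist_group_iso (A B : unitRingType) (phi : A -> B) (phi' : B -> A)
    (tau tau' : A -> A) : group_iso phi phi' -> anti_automorphism tau tau' ->
  group_iso (fun x => phi (tau x^-1)) (fun y => (tau' (phi' y))^-1).
Proof.
move=> iso anti; have anti' := anti_automorphism_sym anti.
have h x : comm_units x -> comm_units (tau x^-1).
  by move=> hx; apply: (anti_comm_units anti); apply: comm_unitsV.
split=> [x hx|y hy|x y hx hy|x hx|y hy].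
- exact/(gi_in iso)/h.
- by apply: comm_unitsV; apply: (anti_comm_units anti'); apply: (gi_in' iso).
- rewrite invrM; try exact: comm_units_unit.
  by rewrite (anti_mul anti) (gi_mul iso) //; apply: h.
- by rewrite (gi_K iso (h _ hx)) (anti_K anti) invrK.
- by rewrite invrK (anti_K' anti) (gi_K' iso).
Qed.

Section Main.
Variables (F : fieldType) (A B : unitAlgType F) (phi : A -> B) (phi' : B -> A).
Hypotheses (F2 : 2%:R != 0 :> F) (F3 : 3%:R != 0 :> F).
Hypotheses (locA : locally_matrix A) (locB : locally_matrix B).
Hypothesis iso : group_iso phi phi'.

Definition extends (theta : {rmorphism A -> B}) (h : A -> B) : Prop :=
  bijective theta /\ forall g, comm_units g -> theta g = h g.

(** The commutator subgroup of A is trivial, hence so is that of B; this rules out matrix units of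
    size two in B, so B is F as well. *)
Lemma scalar_extension : (forall x : A, exists c : F, x = c%:A) ->
  exists theta, extends theta phi.
Proof.
move=> sA.
have trivA (g : A) : comm_units g -> g = 1.
  move: g; apply: comm_units_ind => [//|x y -> ->|x y ux uy].
    by rewrite mulr1.
  have xy : x * y = y * x by have [c ->] := sA x; rewrite mulr_algl mulr_algr.
  by rewrite xy mulrK // divrr.
have sB (b : B) : exists c : F, b = c%:A.
  have [m [f [finj Hf]]] := loc_mx locB [:: b].
  have [Mb ->] := Hf b (mem_head _ _).
  case: m => [|m] in f finj {Hf} Mb *.
    exists (Mb 0 0); rewrite {1}[Mb]mx11_scalar -[_%:M]mulr1 -[_%:M * 1]/(_%:M *m 1).
    by rewrite mul_scalar_mx linearZZ rmorph1.
  have aa : f (delta_mx ord0 ord_max) * f (delta_mx ord0 ord_max) = 0.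
    by rewrite -rmorphM -[RHS](rmorph0 f); congr (f _); apply: mul_delta_mx_0.
  have h := comm_units_1D F2 F3 locB aa.
  have := gi_K' iso h; rewrite (trivA _ (gi_in' iso h)) (gi_one iso).
  rewrite -{1}[1]addr0 => /addrI/esym; rewrite -[RHS](rmorph0 f) => /finj.
  by move=> /matrixP/(_ ord0 ord_max)/eqP; rewrite !mxE !eqxx oner_eq0.
have AI (c d : F) : c%:A = d%:A :> A -> c = d.
  by move=> /eqP; rewrite -subr_eq0 -scalerBl scaler_eq0 oner_eq0 orbF subr_eq0 => /eqP.
pose c x := projT1 (cid (sA x)).
have cE x : x = (c x)%:A by rewrite /c; case: (cid _).
have cA t : c t%:A = t by apply: AI; rewrite -cE.
pose t0 x : B := (c x)%:A.
have t0B : zmod_morphism t0.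
  move=> x y; rewrite /t0 {1}(cE x) {1}(cE y) -scalerBl cA.
  by rewrite scalerBl.
have t0M : monoid_morphism t0.
  split; first by rewrite /t0 -{1}[1](scale1r 1) cA scale1r.
  move=> x y; rewrite /t0 {1}(cE x) {1}(cE y) mulr_algl scalerA cA mulr_algl scalerA //.
pose t : {rmorphism A -> B} := HB.pack t0 (GRing.isZmodMorphism.Build _ _ t0 t0B)
  (GRing.isMonoidMorphism.Build _ _ t0 t0M).
exists t; split.
  exists (fun b => (projT1 (cid (sB b)))%:A) => [x|b] /=.
    rewrite /t0; case: (cid _) => d /= /eqP.
    rewrite -subr_eq0 -scalerBl scaler_eq0 oner_eq0 orbF subr_eq0 => /eqP <-.
    by rewrite -cE.
  by rewrite /t0 cA; case: (cid _).
by move=> g /trivA->; rewrite rmorph1 (gi_one iso).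
Qed.

Lemma three_extension m (f : {lrmorphism 'M[F]_m.+3 -> A}) tau tau' :
  anti_automorphism tau tau' ->
  (exists theta, extends theta phi) \/
  (exists theta, extends theta (fun g => phi (tau g^-1))).
Proof.
move=> anti; pose e i j := f (delta_mx i j).
have mu : matrix_units e := lrmorphism_matrix_units f.
have n2 : (2 < m.+3)%N by [].
have [H|H] := hom_or_anti F2 F3 locA locB iso mu n2.
  by left; apply: (hom_case_extension F2 F3 locA locB iso mu n2 H).
(* These units are adapted to the twisted isomorphism: [tau] carries their Peirce components to
   those of [e] with indices exchanged, which turns the second alternative into the first. *)
right; pose e' i j := tau' (e j i).
have anti' := anti_automorphism_sym anti.
have tau0 : tau' 0 = 0 by apply: (@addIr _ (tau' 0)); rewrite -(anti_add anti') !add0r.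
have mu' : matrix_units e'.
  split=> [i j k|i j k l jk|].
  - by rewrite /e' -(anti_mul anti') (mu_mul mu).
  - by rewrite /e' -(anti_mul anti') (mu_mul0 mu) ?tau0 // eq_sym.
  - by rewrite /e' -(big_morph tau' (anti_add anti') tau0) (mu_sum mu) (anti_one anti').
have tauN x : tau (- x) = - tau x.
  have tau0' : tau 0 = 0 by apply: (@addIr _ (tau 0)); rewrite -(anti_add anti) !add0r.
  by apply: (@addIr _ (tau x)); rewrite -(anti_add anti) !addNr.
have pe i j x : peirce e' i j x -> peirce e j i (tau x).
  move=> [ix xj]; split.
    by rewrite -{2}xj (anti_mul anti) (anti_K' anti).
  by rewrite -{2}ix (anti_mul anti) (anti_K' anti).
have iso' := anti_twist_group_iso iso anti.
apply: (hom_case_extension F2 F3 locA locB iso' mu' n2) => i j k x y ij jk ik hx hy.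
have part i' j' z : i' != j' -> peirce e' i' j' z ->
    unip_part (fun x => phi (tau x^-1)) z = unip_part phi (- tau z).
  move=> ij' hz; rewrite /unip_part square_zero_inv ?(peirce_sq mu' ij' hz) //.
  by rewrite (anti_add anti) (anti_one anti) tauN.
rewrite (part _ _ _ ij hx) (part _ _ _ jk hy).
apply: (H k j i); rewrite 1?eq_sym //; apply: peirceN; exact: pe.
Qed.

(** If no embedded matrix algebra has size at least 3, an embedded M_2 is already all of A, and
    without one A is F. *)
Lemma extension_or_twist tau tau' : anti_automorphism tau tau' ->
  (exists theta, extends theta phi) \/
  (exists theta, extends theta (fun g => phi (tau g^-1))).
Proof.
move=> anti.
have [[m [f _]]|no3] := pselect (exists m (f : {lrmorphism 'M[F]_m.+3 -> A}), True).
  exact: (three_extension f anti).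
left; have small (X : seq A) : exists m (f : {lrmorphism 'M[F]_m.+1 -> A}),
    [/\ (m < 2)%N, injective f & forall x, x \in X -> exists M, x = f M].
  have [m [f [finj Hf]]] := loc_mx locA X.
  case: m => [|[|m]] in f finj Hf *; [by exists 0%N, f|by exists 1%N, f|].
  by case: no3; exists m, f.
have [[f finj]|no2] := pselect (exists f : {lrmorphism 'M[F]_2 -> A}, injective f).
  have fsurj x : exists M, x = f M.
    have [m [h [m2 hinj Hh]]] := small
      (x :: [seq f (delta_mx i j) | i <- enum 'I_2, j <- enum 'I_2]).
    have [N ->] := Hh x (mem_head _ _).
    have [i j|k kE] := embedding_factor hinj (f := f).
      by apply: Hh; rewrite inE; apply/orP; right;
        apply: (allpairs_f (fun i j => f (delta_mx i j))); rewrite mem_enum.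
    case: m => [|[|//]] in h m2 hinj Hh N k kE *.
      have kC (X Y : 'M[F]_2) : k (X * Y) = k (Y * X).
        rewrite !rmorphM /= [k X]mx11_scalar [k Y]mx11_scalar.
        by rewrite -![_%:M * _%:M]scalar_mxM mulrC.
      have : f (delta_mx ord0 ord_max * delta_mx ord_max ord0) =
             f (delta_mx ord_max ord0 * delta_mx ord0 ord_max) by rewrite -!kE kC.
      move=> /finj; rewrite ![_ * _]mul_delta_mx => /matrixP/(_ ord0 ord0)/eqP.
      by rewrite !mxE /= oner_eq0.
    (* A unital endomorphism of M_2 is inner, hence onto, so x lies in the range of f. *)
    have [u uu uE] := matrix_embeddings_conj idfun k.
    exists (u^-1 * N * u); rewrite -kE; congr (h _).
    by apply: (mulIr uu); rewrite -uE /= !mulrA divrr // mul1r.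
  pose g x := projT1 (cid (fsurj x)).
  have gK : cancel g f by move=> x; rewrite /g; case: (cid _).
  have fK : cancel f g by move=> M; apply: finj; rewrite gK.
  exact: (two_by_two_extension F2 F3 locA locB iso fK gK).
apply: scalar_extension => x; have [m [f [m2 finj Hf]]] := small [:: x].
have [M ->] := Hf x (mem_head _ _).
case: m => [|[|//]] in f m2 finj M {Hf} *; last by case: no2; exists f.
exists (M 0 0); rewrite {1}[M]mx11_scalar -[_%:M]mulr1 -[_%:M * 1]/(_%:M *m 1).
by rewrite mul_scalar_mx linearZZ rmorph1.
Qed.
End Main.

Definition raw_map (A B : unitRingType) (phi : unit_commutators A -> unit_commutators B)
    (x : A) : B :=
  if pselect (exists g : unit_commutators A, ucval g = x) is left H
  then ucval (phi (projT1 (cid H))) else 0.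

Lemma raw_mapE (A B : unitRingType) (phi : unit_commutators A -> unit_commutators B) g :
  raw_map phi (ucval g) = ucval (phi g).
Proof.
rewrite /raw_map; case: pselect => [H|[]]; last by exists g.
by case: (cid H) => h /= /ucval_inj->.
Qed.

Lemma raw_group_iso (A B : unitRingType)
    (phi : {multiplicative unit_commutators A -> unit_commutators B}) phi' :
  cancel phi phi' -> cancel phi' phi -> group_iso (raw_map phi) (raw_map phi').
Proof.
move=> K K'; split=> [_ [g <-]|_ [g <-]|_ _ [g <-] [h <-]|_ [g <-]|_ [g <-]].
- by rewrite raw_mapE; exists (phi g).
- by rewrite raw_mapE; exists (phi' g).
- by rewrite -ucvalM !raw_mapE gmulfM.
- by rewrite !raw_mapE K.
- by rewrite !raw_mapE K'.
Qed.

Lemma permx_tr_anti (F : fieldType) (s : steinitz) :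
  anti_automorphism (@permx_tr F s) (@permx_tr F s).
Proof.
have trK : involutive (@permx_tr F s) by move=> M; apply/val_inj.
split=> // [M N|M N|]; apply/val_inj => //.
- rewrite /= /GRing.mul /=.
  have [m [a [b [_ [_ [-> -> _]]]]]] := permx_common (pvalP M) (pvalP N) (pvalP N).
  by rewrite per_mxM !per_mx_tr per_mxM trmx_mul.
- by rewrite /= -(per_mx1 F 0) per_mx_tr trmx1.
Qed.

Lemma transpose_via_anti (F : fieldType) (A : algType F) (s : steinitz)
    (iota : {lrmorphism A -> permx F s}) (iotaV : permx F s -> A) :
  cancel iota iotaV -> cancel iotaV iota ->
  anti_automorphism (transpose_via iota iotaV) (transpose_via iota iotaV).
Proof.
move=> K K'; have tr := permx_tr_anti F s.
have inv : involutive (transpose_via iota iotaV).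
  by move=> a; rewrite /transpose_via K' (anti_K tr) K.
split=> // [x y|x y|]; apply: (can_inj K); rewrite /transpose_via ?rmorphD ?rmorphM ?rmorph1 /= !K'.
- by rewrite (anti_add tr).
- by rewrite (anti_mul tr).
- exact: (anti_one tr).
Qed.

Theorem theorem2 (F : fieldType) (A B : unitAlgType F)
    (charF2 : 2%N \notin [pchar F]) (charF3 : 3%N \notin [pchar F])
    (dimA : countable_dim A) (locA : locally_matrix A)
    (dimB : countable_dim B) (locB : locally_matrix B) :
  ((exists phi : {multiplicative unit_commutators A -> unit_commutators B},
      bijective phi) ->
    exists theta : {rmorphism A -> B}, bijective theta) /\
  (forall (iota : {lrmorphism A -> permx F (st A)})
          (iotaV : permx F (st A) -> A),
    cancel iota iotaV -> cancel iotaV iota ->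
    forall phi : {multiplicative unit_commutators A -> unit_commutators B},
    bijective phi ->
    (exists theta : {rmorphism A -> B}, bijective theta /\
      forall g : unit_commutators A, theta (ucval g) = ucval (phi g)) \/
    (exists theta : {rmorphism A -> B}, bijective theta /\
      forall g : unit_commutators A,
        ucval (phi g) = theta (transpose_via iota iotaV (ucval g^-1%g)))).
Proof.
have F2 : 2%:R != 0 :> F by apply: contra charF2; rewrite inE.
have F3 : 3%:R != 0 :> F by apply: contra charF3; rewrite inE.
split=> [[phi [phi' K K']]|iota iotaV iK iK' phi [phi' K K']].
  have [tau [tau' anti]] := anti_automorphism_exists locA dimA.
  have [[theta [tb _]]|[theta [tb _]]] :=
    extension_or_twist F2 F3 locA locB (raw_group_iso K K') anti; by exists theta.
have anti := transpose_via_anti iK iK'.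
have [[theta [tb tE]]|[theta [tb tE]]] :=
    extension_or_twist F2 F3 locA locB (raw_group_iso K K') anti.
  by left; exists theta; split=> // g; rewrite tE ?raw_mapE //; exists g.
right; exists theta; split=> // g.
(* The twisted formula is evaluated at the transpose of g^-1; since the transpose is an involution,
   its argument becomes g. *)
have hg : comm_units (ucval g^-1%g) by exists g^-1%g.
rewrite tE; last exact: (anti_comm_units anti hg).
have [_ <-] := anti_inv anti (comm_units_unit hg).
by rewrite (anti_K anti) ucvalV invrK raw_mapE.
Qed.
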